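(* Let $\mathcal{T}$ be a finite set of trajectories in an undirected, connected graph $G=(V,E,c)$ with positive edge costs, let $h\in\mathbb{N}$, and let $m$ be the maximal length (number of pairs) of a trajectory in $\mathcal{T}$. Assume shortest-path distances $d(u,v)$ can be obtained in constant time. Then the tree index (temporal interval tree combined with pivot-based spatial filters with $h$ pivots at each node) for $\mathcal{T}$ can be computed in $\mathcal{O}(\log(|\mathcal{T}|)\cdot|\mathcal{T}|\cdot h\,m)$ time, and it uses $\mathcal{O}(|\mathcal{T}|\cdot h)$ memory.
   Context: $G=(V,E,c)$ has finite vertex set $V$, edges $E\subseteq\{\{u,v\}\subseteq V:u\ne v\}$, costs $c:E\to\mathbb{R}_{>0}$, and shortest-path distance $d$. A time interval is $[a,b]$, $a,b\in\mathbb{Z}$, $a<b$; $|I|$ is the length of an interval. A trajectory is $T=((v_1,t_1),\dots,(v_\ell,t_\ell))$ with $v_i\in V$, $t_i=[a_i,b_i]$, $a_{i+1}=b_i$, $v_i\ne v_{i+1}$; its length is $\ell$, its starting time $a_1$ and ending time $b_\ell$. For trajectories $T=((v_i,t_i))_i$, $Q=((u_j,s_j))_j$ and interval $s$: $Sim(Q,T,s)=\frac{1}{|s|}\sum_{i,j}|s\cap t_i\cap s_j|e^{-d(v_i,u_j)}$, $Dist=1-Sim$. A pivot-based spatial filter with $h$ pivots for a set $\mathcal{S}$ of trajectories: choose the $h$ vertices $p_1,\dots,p_h$ most frequently visited by trajectories of $\mathcal{S}$; let $t=[a,b]$ with $a$ the earliest starting and $b$ the latest ending time over $\mathcal{S}$;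 let $P_i=((p_i,t))$; store the $P_i$ and all values $Dist(T,P_i,t)$, $T\in\mathcal{S}$. The tree index is a binary tree built recursively: at a node with trajectory set $\mathcal{T}_x$ (the root has $\mathcal{T}$), compute the median $\mu$ of the end-points of the trajectories in $\mathcal{T}_x$; trajectories ending before $\mu$ go to the left child, those starting after $\mu$ go to the right child, and the remaining ones are stored at the node; recursion stops when the set reaches a fixed minimum size (a leaf stores its set). At each node a pivot-based spatial filter with $h$ pivots is built for the trajectories stored at that node. *)

(* Defs.v *)
From mathcomp Require Import all_boot all_order all_algebra.
From mathcomp Require Import all_classical all_reals all_analysis.

Set Implicit Arguments.
Unset Strict Implicit.
Unset Printing Implicit Defensive.

Import Order.TTheory GRing.Theory Num.Theory.
Local Open Scope ring_scope.

(** * Graphs and shortest-path distances *)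

Record wgraph (R : realType) (V : finType) := WGraph {
  edges : {set {set V}};
  ecost : {set V} -> R;   (* only the values on [edges] are meaningful *)
  edges_card2 : forall e, e \in edges -> #|e| = 2%N;
  ecost_gt0 : forall e, e \in edges -> 0 < ecost e }.

Definition adj (R : realType) (V : finType) (G : wgraph R V) : rel V :=
  fun u v => [set u; v] \in edges G.

Definition connected_graph (R : realType) (V : finType) (G : wgraph R V) :=
  forall u v : V, connect (adj G) u v.

Fixpoint walk_cost (R : realType) (V : finType) (G : wgraph R V)
    (u : V) (p : seq V) : R :=
  if p is w :: p' then ecost G [set u; w] + walk_cost G w p' else 0.

(* In a connected graph the infimum is attained, at a simple path. *)
Definition gdist (R : realType) (V : finType) (G : wgraph R V) (u v : V) : R :=
  inf [set x : R | exists p : seq V,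
    [/\ path (adj G) u p, last u p = v & x = walk_cost G u p]]%classic.

(** * Trajectories *)

(* The pair (a, b) stands for the time interval [a, b]. *)
Notation tinterval := (int * int)%type.

Definition ilen (s : tinterval) : int := Num.max 0 (s.2 - s.1).

Definition icap (s t : tinterval) : tinterval :=
  (Num.max s.1 t.1, Num.min s.2 t.2).

Notation traj V := (seq (V * tinterval)).

Definition is_traj (V : finType) (T : traj V) : bool :=
  if T is x :: T' then
    all (fun y => y.2.1 < y.2.2) T
    && path (fun y z => (z.2.1 == y.2.2) && (y.1 != z.1)) x T'
  else false.

Definition tstart (V : finType) (T : traj V) : int :=
  if T is x :: _ then x.2.1 else 0.

Definition tend (V : finType) (T : traj V) : int :=
  if T is x :: T' then (last x T').2.2 else 0.

Definition Sim (R : realType) (V : finType) (G : wgraph R V)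
    (Q T : traj V) (s : tinterval) : R :=
  ((ilen s)%:~R)^-1 *
  \sum_(x <- T) \sum_(y <- Q)
    (ilen (icap (icap s x.2) y.2))%:~R * expR (- gdist G x.1 y.1).

Definition Dist (R : realType) (V : finType) (G : wgraph R V)
    (Q T : traj V) (s : tinterval) : R := 1 - Sim G Q T s.

(** * Pivot-based spatial filters *)

Definition visits (V : finType) (S : seq (traj V)) (v : V) : nat :=
  (\sum_(T <- S) count (fun x => x.1 == v) T)%N.

Record pivfilter (R : realType) (V : finType) := PivFilter {
  ptrajs : seq (traj V);
  pdists : seq (seq R) }.

(* [S] is nonempty in every use. If there are fewer than [h] vertices, then all
   of them are pivots. Ties between equally frequent vertices are broken
   arbitrarily. *)
Definition is_pivfilter (R : realType) (V : finType) (G : wgraph R V) (h : nat)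
    (S : seq (traj V)) (F : pivfilter R V) : Prop :=
  exists (ps : seq V) (t : tinterval),
    [/\ [/\ uniq ps, size ps = minn h #|V| &
          forall p q : V, p \in ps -> q \notin ps ->
            (visits S q <= visits S p)%N],
        t.1 \in map (@tstart V) S /\ (forall T, T \in S -> t.1 <= tstart T),
        t.2 \in map (@tend V) S /\ (forall T, T \in S -> tend T <= t.2),
        ptrajs F = [seq [:: (p, t)] | p <- ps] &
        pdists F = [seq [seq Dist G T P t | P <- ptrajs F] | T <- S]].

(** * The tree index *)

(* [TNone] is the absent child: no node is created for an empty set. *)
Inductive tindex (R : realType) (V : finType) :=
| TNone
| TLeaf (S0 : seq (traj V)) (F : pivfilter R V)
| TNode (mu : int) (S0 : seq (traj V)) (F : pivfilter R V) (l r : tindex R V).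

Arguments TNone {R V}.

Definition endpoints (V : finType) (S : seq (traj V)) : seq int :=
  map (@tstart V) S ++ map (@tend V) S.

(* The number of end-points is even; either middle one may be taken. *)
Definition is_median (mu : int) (s : seq int) : Prop :=
  [/\ mu \in s,
      (2 * count (fun x => (x < mu)%R) s <= size s)%N &
      (2 * count (fun x => (mu < x)%R) s <= size s)%N].

Inductive is_tindex (R : realType) (V : finType) (G : wgraph R V)
    (minsz h : nat) : seq (traj V) -> tindex R V -> Prop :=
| is_TNone : is_tindex G minsz h [::] TNone
| is_TLeaf Tx S F :
    (0 < size Tx <= minsz)%N ->
    perm_eq S Tx -> is_pivfilter G h S F ->
    is_tindex G minsz h Tx (TLeaf S F)
| is_TNode Tx mu S F l r :
    (minsz < size Tx)%N ->
    is_median mu (endpoints Tx) ->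
    perm_eq S [seq T <- Tx | (tstart T <= mu) && (mu <= tend T)] ->
    is_pivfilter G h S F ->
    is_tindex G minsz h [seq T <- Tx | tend T < mu] l ->
    is_tindex G minsz h [seq T <- Tx | mu < tstart T] r ->
    is_tindex G minsz h Tx (TNode mu S F l r).

(** * Machine model

    A unit-cost RAM over integers and reals, programmed by a first-order while
    language. Integers (used for data and addresses) support addition,
    subtraction and comparison only; reals support the field operations,
    comparison and exp, and no real can be converted back to an integer.
    [RDist] queries the shortest-path distance of two vertices. Evaluating one
    expression node, and executing one command, each cost one time unit. *)

Inductive iexp :=
| IConst (z : int)
| IVar (x : nat)
| ILoad (a : iexp)
| IAdd (e1 e2 : iexp)
| ISub (e1 e2 : iexp).

Inductive rexp :=
| RInt (e : iexp)
| RVar (x : nat)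
| RLoad (a : iexp)
| RAdd (e1 e2 : rexp)
| RSub (e1 e2 : rexp)
| RMul (e1 e2 : rexp)
| RDiv (e1 e2 : rexp)
| RExp (e : rexp)
| RDist (u v : iexp).

Inductive bexp :=
| BLe (e1 e2 : iexp)
| BRLe (e1 e2 : rexp)
| BNot (b : bexp)
| BAnd (b1 b2 : bexp).

Inductive com :=
| CSkip
| CISet (x : nat) (e : iexp)
| CRSet (x : nat) (e : rexp)
| CIStore (a e : iexp)
| CRStore (a : iexp) (e : rexp)
| CSeq (c1 c2 : com)
| CIf (b : bexp) (c1 c2 : com)
| CWhile (b : bexp) (c : com).

Fixpoint icost (e : iexp) : nat :=
  match e with
  | IConst _ | IVar _ => 1
  | ILoad a => (icost a).+1
  | IAdd e1 e2 | ISub e1 e2 => (icost e1 + icost e2).+1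
  end.

Fixpoint rcost (e : rexp) : nat :=
  match e with
  | RVar _ => 1
  | RInt a | RLoad a => (icost a).+1
  | RAdd e1 e2 | RSub e1 e2 | RMul e1 e2 | RDiv e1 e2 =>
      (rcost e1 + rcost e2).+1
  | RExp e1 => (rcost e1).+1
  | RDist u v => (icost u + icost v).+1
  end.

Fixpoint bcost (b : bexp) : nat :=
  match b with
  | BLe e1 e2 => (icost e1 + icost e2).+1
  | BRLe e1 e2 => (rcost e1 + rcost e2).+1
  | BNot b1 => (bcost b1).+1
  | BAnd b1 b2 => (bcost b1 + bcost b2).+1
  end.

Record state (R : realType) := State {
  ireg : nat -> int;
  rreg : nat -> R;
  imem : int -> int;
  rmem : int -> R }.

Definition upd (A : eqType) (B : Type) (f : A -> B) (x : A) (y : B) : A -> B :=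
  fun z => if z == x then y else f z.

Fixpoint ieval (R : realType) (st : state R) (e : iexp) : int :=
  match e with
  | IConst z => z
  | IVar x => ireg st x
  | ILoad a => imem st (ieval st a)
  | IAdd e1 e2 => ieval st e1 + ieval st e2
  | ISub e1 e2 => ieval st e1 - ieval st e2
  end.

(* [dq] is the distance oracle. *)
Fixpoint reval (R : realType) (dq : int -> int -> R) (st : state R)
    (e : rexp) : R :=
  match e with
  | RInt a => (ieval st a)%:~R
  | RVar x => rreg st x
  | RLoad a => rmem st (ieval st a)
  | RAdd e1 e2 => reval dq st e1 + reval dq st e2
  | RSub e1 e2 => reval dq st e1 - reval dq st e2
  | RMul e1 e2 => reval dq st e1 * reval dq st e2
  | RDiv e1 e2 => reval dq st e1 / reval dq st e2
  | RExp e1 => expR (reval dq st e1)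
  | RDist u v => dq (ieval st u) (ieval st v)
  end.

Fixpoint beval (R : realType) (dq : int -> int -> R) (st : state R)
    (b : bexp) : bool :=
  match b with
  | BLe e1 e2 => ieval st e1 <= ieval st e2
  | BRLe e1 e2 => reval dq st e1 <= reval dq st e2
  | BNot b1 => ~~ beval dq st b1
  | BAnd b1 b2 => beval dq st b1 && beval dq st b2
  end.

(* [exec dq c st k st']: started in [st], [c] halts in [st'] after time [k]. *)
Inductive exec (R : realType) (dq : int -> int -> R) :
    com -> state R -> nat -> state R -> Prop :=
| exec_skip st : exec dq CSkip st 1 st
| exec_iset x e st :
    exec dq (CISet x e) st (icost e).+1
      (State (upd (ireg st) x (ieval st e)) (rreg st) (imem st) (rmem st))
| exec_rset x e st :
    exec dq (CRSet x e) st (rcost e).+1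
      (State (ireg st) (upd (rreg st) x (reval dq st e)) (imem st) (rmem st))
| exec_istore a e st :
    exec dq (CIStore a e) st (icost a + icost e).+1
      (State (ireg st) (rreg st)
         (upd (imem st) (ieval st a) (ieval st e)) (rmem st))
| exec_rstore a e st :
    exec dq (CRStore a e) st (icost a + rcost e).+1
      (State (ireg st) (rreg st) (imem st)
         (upd (rmem st) (ieval st a) (reval dq st e)))
| exec_seq c1 c2 st k1 st1 k2 st2 :
    exec dq c1 st k1 st1 -> exec dq c2 st1 k2 st2 ->
    exec dq (CSeq c1 c2) st (k1 + k2).+1 st2
| exec_if b c1 c2 st k st' :
    exec dq (if beval dq st b then c1 else c2) st k st' ->
    exec dq (CIf b c1 c2) st (bcost b + k).+1 st'
| exec_while_false b c st :
    ~~ beval dq st b ->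
    exec dq (CWhile b c) st (bcost b).+1 st
| exec_while_true b c st k1 st1 k2 st2 :
    beval dq st b ->
    exec dq c st k1 st1 -> exec dq (CWhile b c) st1 k2 st2 ->
    exec dq (CWhile b c) st (bcost b + k1 + k2).+1 st2.

(** * Input and output encodings *)

(* Vertices are numbered 0, ..., #|V| - 1. *)
Definition vcode (V : finType) (v : V) : int := Posz (enum_rank v).

Definition dist_oracle (R : realType) (V : finType) (G : wgraph R V)
    (i j : int) : R :=
  match [pick u : V | vcode u == i], [pick v : V | vcode v == j] with
  | Some u, Some v => gdist G u v
  | _, _ => 0
  end.

Definition enc_traj (V : finType) (T : traj V) : seq int :=
  Posz (size T) :: flatten [seq [:: vcode x.1; x.2.1; x.2.2] | x <- T].

Definition enc_input (V : finType) (Ts : seq (traj V)) (h : nat) : seq int :=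
  [:: Posz #|V|; Posz (size Ts); Posz h] ++ flatten (map (@enc_traj V) Ts).

Definition init_state (R : realType) (V : finType) (Ts : seq (traj V))
    (h : nat) : state R :=
  State (fun _ => 0) (fun _ => 0)
    (fun a => if a is Posz n then nth 0 (enc_input Ts h) n else 0)
    (fun _ => 0).

(* A node refers to its trajectories by their positions in the input [Ts] (the
   trajectories themselves are not copied into the index), and to its table of
   [Dist] values by its address [q] in the real memory. *)
Definition leaf_words (R : realType) (V : finType) (Ts S : seq (traj V))
    (F : pivfilter R V) (q : int) : seq int :=
  [:: 0; Posz (size S); Posz (size (ptrajs F)); q]
  ++ [seq Posz (index T Ts) | T <- S] ++ flatten (map (@enc_traj V) (ptrajs F)).

Definition node_words (R : realType) (V : finType) (Ts : seq (traj V))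
    (mu : int) (S : seq (traj V)) (F : pivfilter R V) (q pl pr : int) : seq int :=
  [:: 1; mu; pl; pr; Posz (size S); Posz (size (ptrajs F)); q]
  ++ [seq Posz (index T Ts) | T <- S] ++ flatten (map (@enc_traj V) (ptrajs F)).

Definition block_at (A : Type) (m : int -> A) (a : int) (s : seq A) : Prop :=
  forall (x0 : A) (i : nat), (i < size s)%N -> m (a + Posz i) = nth x0 s i.

(* [index_at Ts st a t]: in the memory of [st], the tree [t] is stored at address
   [a]; 0 is the null pointer. *)
Fixpoint index_at (R : realType) (V : finType) (Ts : seq (traj V))
    (st : state R) (a : int) (t : tindex R V) : Prop :=
  match t with
  | TNone => a = 0
  | TLeaf S0 F => a <> 0 /\ exists q : int,
      block_at (imem st) a (leaf_words Ts S0 F q) /\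
      block_at (rmem st) q (flatten (pdists F))
  | TNode mu S0 F l r => a <> 0 /\ exists q pl pr : int,
      [/\ block_at (imem st) a (node_words Ts mu S0 F q pl pr),
          block_at (rmem st) q (flatten (pdists F)),
          index_at Ts st pl l & index_at Ts st pr r]
  end.

(* The number of memory cells, integer and real, of the blocks in [index_at]. *)
Fixpoint index_cells (R : realType) (V : finType) (Ts : seq (traj V))
    (t : tindex R V) : nat :=
  match t with
  | TNone => 0
  | TLeaf S0 F => size (leaf_words Ts S0 F 0) + size (flatten (pdists F))
  | TNode mu S0 F l r =>
      size (node_words Ts mu S0 F 0 0 0) + size (flatten (pdists F))
      + index_cells Ts l + index_cells Ts r
  end.

Definition max_len (V : finType) (Ts : seq (traj V)) : nat :=
  (\max_(T <- Ts) size T)%N.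

(* Main.v *)
Require Import Defs.
From mathcomp Require Import all_boot all_order all_algebra.
From mathcomp Require Import all_classical all_reals all_analysis.
From mathcomp Require Import zify.
Import Order.TTheory GRing.Theory Num.Theory.

Set Implicit Arguments.
Unset Strict Implicit.
Unset Printing Implicit Defensive.

(** All end-points are sorted once. A node then receives the sorted list of the
    end-points of its set, reads off the median in constant time, and passes
    sublists to its children, which are therefore sorted again. A trajectory
    that ends before the median has both end-points below it, so a child has at
    most half the size of its parent and the depth is logarithmic.

    The pivots of a node with stored set S are found in h rounds, each of which
    scans all O(|S| m) visits of S for the most visited vertex not yet chosen;
    the table of distances takes |S| h m further steps. The median is itself an
    end-point, so no node stores an empty set: there are at most |T| nodes, and
    the O(h) cells of overhead per node are paid for by its set.

    The program is written in a language with unbounded integer arrays, which is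
    translated to the RAM with constant slowdown. Recursion is replaced by a
    stack; a run that processes an entry and all its descendants is a finite
    number of iterations of the main loop. *)

(** * A language of named arrays and its translation to the RAM *)

(** The time bound has no term in |V|, although visits are counted per vertex and a pivot may be a
    vertex that is never visited. So no node may clear or scan |V| counters. Each node takes a fresh
    block of cells, which are initially 0, and an unvisited vertex enters the search for pivots only
    through a pointer that moves past vertices already chosen, hence at most h times per node. The
    integers of the machine have neither multiplication nor division. This is why the sorting is a
    bottom-up merge sort whose block width doubles, why products by constants are repeated sums, and
    why the median is read at position s of a list of 2s events. The start and the end of a
    trajectory are always kept or dropped together, so sublists of the sorted events are again the
    sorted events of a set of trajectories. All counting is done in [nat] with [trunc_log 2]; the
    real logarithm appears only in the last step and contributes the factor 1 / ln 2. *)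

Inductive aexp := ACst of int | AVar of nat | AAdd of aexp & aexp | ASub of aexp & aexp.

Inductive gexp := GLe of aexp & aexp | GNot of gexp | GAnd of gexp & gexp.

(* [Ld x s e] loads cell [e] of array [s] into register [x], and [St s e v]
   stores [v] there. [AccAdd] and [Out] are the two real-valued steps needed for
   a value of [Dist]: they extend the sum, and write [1 - sum / length]. *)
Inductive hcom :=
| Set_ of nat & aexp
| Ld of nat & nat & aexp
| St of nat & aexp & aexp
| AccZero
| AccAdd of aexp & aexp & aexp
| Out of aexp & aexp
| Seq of hcom & hcom
| If of gexp & hcom & hcom
| While of gexp & hcom.

Fixpoint aval (r : nat -> int) (e : aexp) : int :=
  match e with
  | ACst z => z
  | AVar x => r x
  | AAdd e1 e2 => aval r e1 + aval r e2
  | ASub e1 e2 => aval r e1 - aval r e2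
  end%R.

Fixpoint gval (r : nat -> int) (b : gexp) : bool :=
  match b with
  | GLe e1 e2 => (aval r e1 <= aval r e2)%R
  | GNot b1 => ~~ gval r b1
  | GAnd b1 b2 => gval r b1 && gval r b2
  end.

(** [Nat.eqb] computes on numerals, so that [/=] evaluates a register after a chain of
    assignments. *)
Definition rupd (B : Type) (f : nat -> B) (x : nat) (v : B) : nat -> B :=
  fun y => if Nat.eqb y x then v else f y.

Lemma rupdE (B : Type) (f : nat -> B) x v y :
  rupd f x v y = if y == x then v else f y.
Proof. by rewrite /rupd; case: PeanoNat.Nat.eqb_spec => [->|/eqP/negPf->//]; rewrite eqxx. Qed.

Lemma rupd_neq (B : Type) (f : nat -> B) x v y : y != x -> rupd f x v y = f y.
Proof. by rewrite rupdE => /negPf->. Qed.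

Lemma upd_eq (B : Type) (f : nat -> B) x v : upd f x v x = v.
Proof. by rewrite /upd eqxx. Qed.

Lemma upd_neq (B : Type) (f : nat -> B) x v y : y != x -> upd f x v y = f y.
Proof. by rewrite /upd => /negPf->. Qed.

(* Accesses at a negative index read 0 and write nothing. *)
Definition getz (f : nat -> int) (z : int) : int := if z is Posz i then f i else 0%R.

Definition setz (B : Type) (f : nat -> B) (z : int) (v : B) : nat -> B :=
  if z is Posz i then upd f i v else f.

Section HighLevel.
Variable R : realType.

Record hst := HSt {
  rg : nat -> int;
  mm : nat -> nat -> int;
  acc : R;
  rm : nat -> R }.

Variable dq : int -> int -> R.

Inductive hexec : hcom -> hst -> nat -> hst -> Prop :=
| hx_set x e st :
    hexec (Set_ x e) st 1 (HSt (rupd (rg st) x (aval (rg st) e)) (mm st) (acc st) (rm st))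
| hx_ld x s e st :
    hexec (Ld x s e) st 1
      (HSt (rupd (rg st) x (getz (mm st s) (aval (rg st) e))) (mm st) (acc st) (rm st))
| hx_st s e v st :
    hexec (St s e v) st 1
      (HSt (rg st) (rupd (mm st) s (setz (mm st s) (aval (rg st) e) (aval (rg st) v)))
         (acc st) (rm st))
| hx_zero st : hexec AccZero st 1 (HSt (rg st) (mm st) 0%R (rm st))
| hx_add d u v st :
    hexec (AccAdd d u v) st 1 (HSt (rg st) (mm st)
      (acc st + (aval (rg st) d)%:~R
        * expR (- dq (aval (rg st) u) (aval (rg st) v)))%R (rm st))
| hx_out q d st :
    hexec (Out q d) st 1 (HSt (rg st) (mm st) (acc st)
      (setz (rm st) (aval (rg st) q) (1 - acc st / (aval (rg st) d)%:~R)%R))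
| hx_seq c1 c2 st k1 st1 k2 st2 :
    hexec c1 st k1 st1 -> hexec c2 st1 k2 st2 -> hexec (Seq c1 c2) st (k1 + k2) st2
| hx_if b c1 c2 st k st' :
    hexec (if gval (rg st) b then c1 else c2) st k st' -> hexec (If b c1 c2) st k.+1 st'
| hx_while_false b c st : ~~ gval (rg st) b -> hexec (While b c) st 1 st
| hx_while_true b c st k1 st1 k2 st2 :
    gval (rg st) b -> hexec c st k1 st1 -> hexec (While b c) st1 k2 st2 ->
    hexec (While b c) st (k1 + k2).+1 st2.

(** [Seq] is free in [hexec] but costs one unit on the RAM. As both parts take positive time, the
    translation can charge that unit to them. *)
Lemma hexec_gt0 c st k st' : hexec c st k st' -> 0 < k.
Proof. by elim=> // *; lia. Qed.

Fixpoint aexp_com (e : aexp) : iexp :=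
  match e with
  | ACst z => IConst z
  | AVar x => IVar x
  | AAdd e1 e2 => IAdd (aexp_com e1) (aexp_com e2)
  | ASub e1 e2 => ISub (aexp_com e1) (aexp_com e2)
  end.

Fixpoint gexp_com (b : gexp) : bexp :=
  match b with
  | GLe e1 e2 => BLe (aexp_com e1) (aexp_com e2)
  | GNot b1 => BNot (gexp_com b1)
  | GAnd b1 b2 => BAnd (gexp_com b1) (gexp_com b2)
  end.

(* Array 0 is the nonnegative half of the memory; arrays 1, ..., 8 are
   interleaved on the negative half, so that all of them are unbounded. *)
Definition cell (s i : nat) : int := if s is j.+1 then Negz (8 * i + j) else Posz i.

Lemma cell_inj s i s' i' : s <= 8 -> s' <= 8 -> cell s i = cell s' i' -> s = s' /\ i = i'.
Proof.
case: s s' => [|s] [|s'] //= ? ?; first by case=> ->.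
by move=> /eqP/eqP [] ?; split; lia.
Qed.

(** Three doublings replace the product by 8. The expression [e] is copied eight times, which costs
    a factor that depends on the program only. *)
Definition cell_com (s : nat) (e : iexp) : iexp :=
  if s is j.+1 then
    let e2 := IAdd e e in let e4 := IAdd e2 e2 in ISub (IConst (Negz j)) (IAdd e4 e4)
  else e.

(** The sign tests around the accesses realize [getz] and [setz]: the cell computed from a negative
    index could belong to another array. *)
Fixpoint hcom_com (c : hcom) : com :=
  match c with
  | Set_ x e => CISet x (aexp_com e)
  | Ld x s e =>
      let a := aexp_com e in
      CIf (BLe (IConst 0) a) (CISet x (ILoad (cell_com s a))) (CISet x (IConst 0))
  | St s e v =>
      let a := aexp_com e in
      CIf (BLe (IConst 0) a) (CIStore (cell_com s a) (aexp_com v)) CSkip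
  | AccZero => CRSet 0 (RInt (IConst 0))
  | AccAdd d u v =>
      CRSet 0 (RAdd (RVar 0) (RMul (RInt (aexp_com d))
        (RExp (RSub (RInt (IConst 0)) (RDist (aexp_com u) (aexp_com v))))))
  | Out q d =>
      let a := aexp_com q in
      CIf (BLe (IConst 0) a)
        (CRStore a (RSub (RInt (IConst 1)) (RDiv (RVar 0) (RInt (aexp_com d))))) CSkip
  | Seq c1 c2 => CSeq (hcom_com c1) (hcom_com c2)
  | If b c1 c2 => CIf (gexp_com b) (hcom_com c1) (hcom_com c2)
  | While b c => CWhile (gexp_com b) (hcom_com c)
  end.

Fixpoint hcom_wf (c : hcom) : bool :=
  match c with
  | Ld _ s _ | St s _ _ => s <= 8
  | Seq c1 c2 | If _ c1 c2 => hcom_wf c1 && hcom_wf c2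
  | While _ c => hcom_wf c
  | _ => true
  end.

(* A bound on the RAM time per unit of [hexec] time. *)
Fixpoint slowdown (c : hcom) : nat :=
  match c with
  | Set_ x e => (icost (aexp_com e)).+1
  | Ld x s e =>
      (bcost (BLe (IConst 0) (aexp_com e)) + (icost (cell_com s (aexp_com e))).+2).+3
  | St s e v =>
      (bcost (BLe (IConst 0) (aexp_com e))
       + (icost (cell_com s (aexp_com e)) + icost (aexp_com v)).+2).+3
  | AccZero => 3
  | AccAdd d u v => (icost (aexp_com d) + (icost (aexp_com u) + icost (aexp_com v)) + 20)
  | Out q d => bcost (BLe (IConst 0) (aexp_com q)) + icost (aexp_com q) + icost (aexp_com d) + 20
  | Seq c1 c2 => (slowdown c1 + slowdown c2).+1
  | If b c1 c2 => (bcost (gexp_com b) + slowdown c1 + slowdown c2).+1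
  | While b c => (bcost (gexp_com b) + slowdown c).+1
  end.

Definition sim (st : state R) (hs : hst) : Prop :=
  [/\ forall x, ireg st x = rg hs x,
      forall s i, s <= 8 -> imem st (cell s i) = mm hs s i,
      rreg st 0 = acc hs &
      forall q, rmem st (Posz q) = rm hs q].

Lemma ieval_aexp st hs e : sim st hs -> ieval st (aexp_com e) = aval (rg hs) e.
Proof. by case=> sr _ _ _; elim: e => //= e1 -> e2 ->. Qed.

Lemma beval_gexp st hs b : sim st hs -> beval dq st (gexp_com b) = gval (rg hs) b.
Proof.
move=> S; elim: b => [e1 e2|b IH|b1 IH1 b2 IH2] /=.
- by rewrite !(ieval_aexp _ S).
- by rewrite IH.
- by rewrite IH1 IH2.
Qed.

Lemma ieval_cell (st : state R) s e i :
  ieval st e = Posz i -> ieval st (cell_com s e) = cell s i.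
Proof. by case: s => [|s] //= ->; rewrite !NegzE; lia. Qed.

Lemma upd_rupd (B : Type) (f : nat -> B) x v y : upd f x v y = rupd f x v y.
Proof. by rewrite rupdE. Qed.

(** The factor [slowdown c] depends on the program text alone, so a time bound for [hexec] becomes
    one for the RAM with a constant independent of the input. *)
Lemma hexec_com c hs k hs' st : hexec c hs k hs' -> hcom_wf c -> sim st hs ->
  exists k' st', [/\ exec dq (hcom_com c) st k' st', k' <= slowdown c * k & sim st' hs'].
Proof.
move=> H; elim: H st => {c hs k hs'}.
- move=> x e hs st _ S; do 2!eexists; split; [exact: exec_iset|by rewrite /= muln1|].
  rewrite (ieval_aexp _ S); case: S => s1 s2 s3 s4; split=> //= y.
  by rewrite upd_rupd !rupdE; case: eqP.
- move=> x s e hs st /= ss S.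
  have [s1 s2 s3 s4] := S.
  have E := ieval_aexp e S.
  have T : exists k' st', [/\ exec dq (if beval dq st (BLe (IConst 0) (aexp_com e)) then
      CISet x (ILoad (cell_com s (aexp_com e))) else CISet x (IConst 0)) st k' st',
      k' <= (icost (cell_com s (aexp_com e))).+2 & sim st'
      (HSt (rupd (rg hs) x (getz (mm hs s) (aval (rg hs) e))) (mm hs) (acc hs) (rm hs))].
    rewrite /= E; case: (aval (rg hs) e) E => [i|i] E /=; do 2!eexists.
      split; [exact: exec_iset|by []|].
      split=> //= y; rewrite (ieval_cell _ E) s2 // upd_rupd !rupdE; by case: eqP.
    split; [exact: exec_iset|by []|].
    split=> //= y; rewrite upd_rupd !rupdE; by case: eqP.
  have [k' [st' [T1 T2 T3]]] := T.
  by do 2!eexists; split; [apply: exec_if T1|rewrite muln1 /= in T2 *; lia|].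
- move=> s e v hs st /= ss S.
  have [s1 s2 s3 s4] := S.
  have E := ieval_aexp e S.
  have T : exists k' st', [/\ exec dq (if beval dq st (BLe (IConst 0) (aexp_com e)) then
      CIStore (cell_com s (aexp_com e)) (aexp_com v) else CSkip) st k' st',
      k' <= (icost (cell_com s (aexp_com e)) + icost (aexp_com v)).+2 & sim st'
      (HSt (rg hs) (rupd (mm hs) s (setz (mm hs s) (aval (rg hs) e) (aval (rg hs) v)))
         (acc hs) (rm hs))].
    rewrite /= E; case: (aval (rg hs) e) E => [i|i] E /=; do 2!eexists.
      split; [exact: exec_istore|by []|].
      split=> //= s' i' ss'; rewrite (ieval_cell _ E) (ieval_aexp _ S) rupdE /upd.
      case: eqP => [/(cell_inj ss' ss) [-> ->]|ne]; first by rewrite !eqxx.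
      case: eqP => [es|_]; last exact: s2.
      by case: eqP => [ei|_]; [case: ne; rewrite es ei|rewrite s2 ?es].
    split; [exact: exec_skip|by []|].
    split=> //= s' i' ss'; rewrite rupdE; case: eqP => [->|_]; exact: s2.
  have [k' [st' [T1 T2 T3]]] := T.
  by do 2!eexists; split; [apply: exec_if T1|rewrite muln1 /= in T2 *; lia|].
- move=> hs st _ [s1 s2 s3 s4]; do 2!eexists; split; [exact: exec_rset|by []|].
  by split.
- move=> d u v hs st _ S; do 2!eexists; split; [exact: exec_rset|rewrite /=; lia|].
  have [s1 s2 s3 s4] := S.
  by split=> //=; rewrite /upd eqxx !(ieval_aexp _ S) s3 mulr0z sub0r.
- move=> q d hs st _ S.
  have [s1 s2 s3 s4] := S.
  have E := ieval_aexp q S.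
  have T : exists k' st', [/\ exec dq (if beval dq st (BLe (IConst 0) (aexp_com q)) then
      CRStore (aexp_com q) (RSub (RInt (IConst 1)) (RDiv (RVar 0) (RInt (aexp_com d))))
      else CSkip) st k' st',
      k' <= icost (aexp_com q) + icost (aexp_com d) + 10 & sim st'
      (HSt (rg hs) (mm hs) (acc hs)
      (setz (rm hs) (aval (rg hs) q) (1 - acc hs / (aval (rg hs) d)%:~R)%R))].
    rewrite /= E; case: (aval (rg hs) q) E => [i|i] E /=; do 2!eexists.
      split; [exact: exec_rstore|rewrite /=; lia|].
      split=> //= q'; rewrite E (ieval_aexp _ S) s3 /upd.
      by case: (q' =P i) => [->|ne]; [rewrite eqxx|case: eqP => // -[]].
    by split; [exact: exec_skip|lia|].
  have [k' [st' [T1 T2 T3]]] := T.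
  by do 2!eexists; split; [apply: exec_if T1|rewrite muln1 /= in T2 *; lia|].
- move=> c1 c2 hs k1 hs1 k2 hs2 H1 IH1 H2 IH2 st /= /andP[w1 w2] S.
  have [k1' [st1 [E1 le1 S1]]] := IH1 _ w1 S.
  have [k2' [st2 [E2 le2 S2]]] := IH2 _ w2 S1.
  exists (k1' + k2').+1, st2; split=> //; first exact: exec_seq E1 E2.
  have := hexec_gt0 H1; have := hexec_gt0 H2.
  move: le1 le2; nia.
- move=> b c1 c2 hs k hs' H IH st /= /andP[w1 w2] S.
  have [] := IH st _ S; first by case: ifP.
  move=> k' [st' [E1 le1 S1]].
  exists (bcost (gexp_com b) + k').+1, st'; split=> //.
    by apply: exec_if; rewrite (beval_gexp b S); move: E1; case: ifP.
  move: le1; case: ifP => _; nia.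
- move=> b c hs g st /= w S.
  exists (bcost (gexp_com b)).+1, st; split=> //; last lia.
  by apply: exec_while_false; rewrite (beval_gexp b S).
- move=> b c hs k1 hs1 k2 hs2 g H1 IH1 H2 IH2 st /= w S.
  have [k1' [st1 [E1 le1 S1]]] := IH1 _ w S.
  have [k2' [st2 [E2 le2 S2]]] := IH2 _ w S1.
  exists (bcost (gexp_com b) + k1' + k2').+1, st2; split=> //.
    by apply: exec_while_true E1 E2; rewrite (beval_gexp b S).
  move: le1 le2 => /=; nia.
Qed.

(** * Frames and a logic of runs *)

Fixpoint wregs (c : hcom) : seq nat :=
  match c with
  | Set_ x _ | Ld x _ _ => [:: x]
  | Seq c1 c2 | If _ c1 c2 => wregs c1 ++ wregs c2
  | While _ c => wregs c
  | _ => [::]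
  end.

Fixpoint warrs (c : hcom) : seq nat :=
  match c with
  | St s _ _ => [:: s]
  | Seq c1 c2 | If _ c1 c2 => warrs c1 ++ warrs c2
  | While _ c => warrs c
  | _ => [::]
  end.

Fixpoint wreal (c : hcom) : bool :=
  match c with
  | Out _ _ => true
  | Seq c1 c2 | If _ c1 c2 => wreal c1 || wreal c2
  | While _ c => wreal c
  | _ => false
  end.

(** What a command leaves alone is read off its syntax. Loop invariants therefore mention only what
    the loop changes, and the rest is recovered from the frame. *)
Definition frame (c : hcom) (st st' : hst) : Prop :=
  [/\ forall x, x \notin wregs c -> rg st' x = rg st x,
      forall s, s \notin warrs c -> mm st' s = mm st s &
      ~~ wreal c -> rm st' = rm st].

Lemma frame_refl c st : frame c st st.
Proof. by []. Qed.

Lemma frame_trans c st1 st2 st3 : frame c st1 st2 -> frame c st2 st3 -> frame c st1 st3.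
Proof.
move=> [a1 b1 c1] [a2 b2 c2]; split=> [x xc|s sc|w].
- by rewrite a2 ?a1.
- by rewrite b2 ?b1.
- by rewrite c2 ?c1.
Qed.

Lemma hexec_frame c st k st' : hexec c st k st' -> frame c st st'.
Proof.
elim=> {c st k st'}.
- by move=> x e st; split=> //= y; rewrite inE => yx; rewrite rupd_neq.
- by move=> x s e st; split=> //= y; rewrite inE => yx; rewrite rupd_neq.
- by move=> s e v st; split=> //= y; rewrite inE => yx; rewrite rupd_neq.
- by [].
- by [].
- by [].
- move=> c1 c2 st k1 st1 k2 st2 _ [a1 b1 r1] _ [a2 b2 r2]; split=> /=.
  + by move=> x; rewrite mem_cat negb_or => /andP[x1 x2]; rewrite a2 ?a1.
  + by move=> x; rewrite mem_cat negb_or => /andP[x1 x2]; rewrite b2 ?b1.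
  + by rewrite negb_or => /andP[x1 x2]; rewrite r2 ?r1.
- move=> b c1 c2 st k st' _; case: ifP => _ [a1 b1 r1]; split=> /=.
  + by move=> x; rewrite mem_cat negb_or => /andP[x1 x2]; rewrite a1.
  + by move=> x; rewrite mem_cat negb_or => /andP[x1 x2]; rewrite b1.
  + by rewrite negb_or => /andP[x1 x2]; rewrite r1.
  + by move=> x; rewrite mem_cat negb_or => /andP[x1 x2]; rewrite a1.
  + by move=> x; rewrite mem_cat negb_or => /andP[x1 x2]; rewrite b1.
  + by rewrite negb_or => /andP[x1 x2]; rewrite r1.
- by [].
- by move=> b c st k1 st1 k2 st2 _ _ f1 _ f2; apply: (frame_trans f1 f2).
Qed.

(** Total correctness, with the running time passed to the postcondition. The rules below turn a
    proof about a program into its symbolic execution. *)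
Definition tr (c : hcom) (Q : nat -> hst -> Prop) (st : hst) : Prop :=
  exists k st', hexec c st k st' /\ Q k st'.

Lemma tr_frame c (Q Q' : nat -> hst -> Prop) st :
  tr c Q st -> (forall k st', frame c st st' -> Q k st' -> Q' k st') -> tr c Q' st.
Proof.
move=> [k [st' [H q]]] QQ; exists k, st'; split=> //; apply: QQ q; exact: hexec_frame H.
Qed.

Lemma tr_set x e (Q : nat -> hst -> Prop) st :
  Q 1 (HSt (rupd (rg st) x (aval (rg st) e)) (mm st) (acc st) (rm st)) ->
  tr (Set_ x e) Q st.
Proof. by move=> q; do 2!eexists; split; [exact: hx_set|]. Qed.

Lemma tr_ld i x s e (Q : nat -> hst -> Prop) st :
  aval (rg st) e = Posz i ->
  Q 1 (HSt (rupd (rg st) x (mm st s i)) (mm st) (acc st) (rm st)) ->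
  tr (Ld x s e) Q st.
Proof. by move=> E q; do 2!eexists; split; [exact: hx_ld|rewrite E]. Qed.

Lemma tr_st i s e v (Q : nat -> hst -> Prop) st :
  aval (rg st) e = Posz i ->
  Q 1 (HSt (rg st) (rupd (mm st) s (upd (mm st s) i (aval (rg st) v))) (acc st) (rm st)) ->
  tr (St s e v) Q st.
Proof. by move=> E q; do 2!eexists; split; [exact: hx_st|rewrite E]. Qed.

Lemma tr_zero (Q : nat -> hst -> Prop) st :
  Q 1 (HSt (rg st) (mm st) 0%R (rm st)) -> tr AccZero Q st.
Proof. by move=> q; do 2!eexists; split; [exact: hx_zero|]. Qed.

Lemma tr_add d u v (Q : nat -> hst -> Prop) st :
  Q 1 (HSt (rg st) (mm st) (acc st + (aval (rg st) d)%:~R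
    * expR (- dq (aval (rg st) u) (aval (rg st) v)))%R (rm st)) ->
  tr (AccAdd d u v) Q st.
Proof. by move=> q; do 2!eexists; split; [exact: hx_add|]. Qed.

Lemma tr_out i q d (Q : nat -> hst -> Prop) st :
  aval (rg st) q = Posz i ->
  Q 1 (HSt (rg st) (mm st) (acc st)
        (upd (rm st) i (1 - acc st / (aval (rg st) d)%:~R)%R)) ->
  tr (Out q d) Q st.
Proof. by move=> E q'; do 2!eexists; split; [exact: hx_out|rewrite E]. Qed.

Lemma tr_seq c1 c2 (Q : nat -> hst -> Prop) st :
  tr c1 (fun k1 st1 => tr c2 (fun k2 => Q (k1 + k2)) st1) st -> tr (Seq c1 c2) Q st.
Proof.
move=> [k1 [st1 [H1 [k2 [st2 [H2 q]]]]]].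
by exists (k1 + k2), st2; split=> //; exact: hx_seq H1 H2.
Qed.

Lemma tr_if b c1 c2 (Q : nat -> hst -> Prop) st :
  (gval (rg st) b -> tr c1 (fun k => Q k.+1) st) ->
  (~~ gval (rg st) b -> tr c2 (fun k => Q k.+1) st) -> tr (If b c1 c2) Q st.
Proof.
move=> H1 H2; case g : (gval (rg st) b).
  have [k [st' [H q]]] := H1 g.
  by exists k.+1, st'; split=> //; apply: hx_if; rewrite g.
have [k [st' [H q]]] := H2 (negbT g).
by exists k.+1, st'; split=> //; apply: hx_if; rewrite g.
Qed.

(* [I phi st] is an invariant indexed by a potential that pays for the run. *)
Lemma tr_while b c (I : nat -> hst -> Prop) phi st0 (Q : nat -> hst -> Prop) :
  I phi st0 ->
  (forall phi st, I phi st -> frame c st0 st -> gval (rg st) b ->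
     tr c (fun k st' => exists2 phi', phi' + k < phi & I phi' st') st) ->
  (forall phi' k st', I phi' st' -> frame c st0 st' -> ~~ gval (rg st') b ->
     k + phi' <= phi.+1 -> Q k st') ->
  tr (While b c) Q st0.
Proof.
move=> I0 step fin.
(* The strict decrease of the potential pays for the successful test of each round; the unit added
   to [phi] at the end pays for the failing one. *)
have : forall N phi st, phi < N -> I phi st -> frame c st0 st ->
    tr (While b c) (fun k st' => exists phi', [/\ I phi' st', frame c st0 st',
       ~~ gval (rg st') b & k + phi' <= phi.+1]) st.
  elim=> // N IH ph st ltN Ist F.
  case g : (gval (rg st) b).
    have [k [st' [H [ph' lt' I']]]] := step _ _ Ist F g.
    have F' : frame c st0 st' := frame_trans F (hexec_frame H).
    have [|k2 [st2 [H2 [ph2 [I2 F2 g2 le2]]]]] := IH ph' st' _ I' F'; first lia.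
    exists (k + k2).+1, st2; split; first exact: hx_while_true g H H2.
    by exists ph2; split=> //; lia.
  exists 1, st; split; first by apply: hx_while_false; rewrite g.
  by exists ph; split=> //; rewrite ?g //; lia.
move=> /(_ phi.+1 phi st0 (leqnn _) I0 (frame_refl _ _)) [k [st' [H [ph' [I' F' g' le']]]]].
by exists k, st'; split=> //; exact: fin I' F' g' le'.
Qed.

(** The potential is [(N - i) * A.+1]: every remaining round pays for its body and one test. *)
Lemma tr_for b c (I : nat -> hst -> Prop) N A st0 (Q : nat -> hst -> Prop) :
  I 0 st0 ->
  (forall i st, i <= N -> I i st -> frame c st0 st -> gval (rg st) b = (i < N)) ->
  (forall i st, i < N -> I i st -> frame c st0 st ->
     tr c (fun k st' => k <= A /\ I i.+1 st') st) ->
  (forall k st', I N st' -> frame c st0 st' -> k <= (N * A.+1).+1 -> Q k st') ->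
  tr (While b c) Q st0.
Proof.
move=> I0 g step fin.
apply: (@tr_while _ _ (fun phi st => exists i, [/\ i <= N, phi = (N - i) * A.+1 & I i st])
          (N * A.+1)).
- by exists 0; rewrite subn0.
- move=> phi st [i [leN -> Ii]] F; rewrite (g i) // => ltN.
  have [k [st' [H [leA I']]]] := step _ _ ltN Ii F.
  exists k, st'; split=> //; exists ((N - i.+1) * A.+1); last by exists i.+1.
  have -> : N - i = (N - i.+1).+1 by lia.
  by rewrite mulSn; lia.
- move=> phi k st' [i [leN -> Ii]] F; rewrite (g i) // -leqNgt => geN.
  have ei : i = N by lia.
  by rewrite ei subnn mul0n addn0 in Ii *; apply: fin.
Qed.

End HighLevel.
Arguments acc {R}.
Arguments HSt {R}.
Arguments rupd {B} f x v y /.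

(** * Array segments *)

Definition seg (A : Type) (f : nat -> A) (a : nat) (s : seq A) : Prop :=
  forall x0 i, i < size s -> f (a + i) = nth x0 s i.

Lemma seg_nil A (f : nat -> A) a : seg f a [::]. Proof. by []. Qed.

Lemma seg_ext A (f f' : nat -> A) a s :
  (forall i, a <= i < a + size s -> f' i = f i) -> seg f a s -> seg f' a s.
Proof.
by move=> ff H x0 i lt_i; rewrite ff ?(H x0) // leq_addr ltn_add2l.
Qed.

Lemma seg_cat A (f : nat -> A) a s1 s2 :
  seg f a (s1 ++ s2) <-> seg f a s1 /\ seg f (a + size s1) s2.
Proof.
split=> [H|[H1 H2] x0 i].
  split=> x0 i lt_i.
    by rewrite (H x0) ?size_cat ?nth_cat ?lt_i //; apply: leq_trans lt_i (leq_addr _ _).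
  by rewrite -addnA (H x0) ?size_cat ?ltn_add2l // nth_cat ltnNge leq_addr /= addKn.
rewrite size_cat nth_cat => lt_i; case: ltnP => le; first exact: H1.
have -> : f (a + i) = f (a + size s1 + (i - size s1)) by rewrite -addnA subnKC.
by apply: H2; rewrite ltn_subLR.
Qed.

Lemma seg_cons A (f : nat -> A) a x s : seg f a (x :: s) <-> f a = x /\ seg f a.+1 s.
Proof.
rewrite -cat1s seg_cat addn1; split=> [[H1 H2]|[H1 H2]]; split=> //.
  by rewrite -(addn0 a) (H1 x).
by move=> x0 [] // _; rewrite addn0.
Qed.

Lemma seg_rcons A (f : nat -> A) a x s :
  seg f a (rcons s x) <-> seg f a s /\ f (a + size s) = x.
Proof.
rewrite -cats1 seg_cat seg_cons.
by split=> [[? []//]|[? ?]]; split.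
Qed.

Lemma seg_nth f a (s : seq nat) i : seg f a (map Posz s) -> i < size s ->
  f (a + i) = Posz (nth 0 s i).
Proof. by move=> H lt_i; rewrite (H (Posz 0)) ?size_map // (nth_map 0). Qed.

(* Transports the known register values of [st] along a frame [F] to [st']. *)
Ltac carry F st st' :=
  repeat match goal with
  | H : rg st ?k = ?v |- _ =>
      lazymatch goal with
      | _ : rg st' k = v |- _ => fail
      | _ => let H' := fresh "C" in
             have H' : rg st' k = v by (rewrite -H; case: F => F _ _; exact: (F k isT))
      end
  end.

(** * The program *)

Coercion AVar : nat >-> aexp.
Notation "c1 ;; c2" := (Seq c1 c2) (at level 61, right associativity).
Notation "e1 [+] e2" := (AAdd e1 e2) (at level 50, left associativity).
Notation "e1 [-] e2" := (ASub e1 e2) (at level 50, left associativity).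
Notation "e1 [<=] e2" := (GLe e1 e2) (at level 55).
Notation "e1 [<] e2" := (GLe (AAdd e1 (ACst (Posz 1))) e2) (at level 55).
Notation lit n := (ACst (Posz n)).
Notation incr x := (Set_ x (AVar x [+] lit 1)).

(* MAIN holds the input and the index; POS the addresses of the input
   trajectories; TIM the times of the events, where events e and n + e are the
   start and the end of trajectory e; EV lists of events; STK the stack; VLST
   the vertices visited at the current node; CNT their numbers of visits. *)
Notation MAIN := 0.
Notation POS := 1.
Notation TIM := 2.
Notation EV := 3.
Notation STK := 4.
Notation VLST := 5.
Notation CNT := 6.

(* [rFO], [rEF] and [rQF] point to the first free cell of MAIN, EV and the real
   memory. [rCB] is the base of the counters in CNT: each node uses new ones,
   which are still 0. *)
Notation rV := 1.
Notation rN := 2.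
Notation rM := 3.
Notation rH := 4.
Notation rFO := 5.
Notation rEF := 6.
Notation rQF := 7.
Notation rCB := 8.
Notation rSP := 9.
Notation rLO := 10.
Notation rS := 11.
Notation rPP := 12.
Notation rP := 13.
Notation rI := 14.
Notation rJ := 15.
Notation rK := 16.
Notation rW := 17.
Notation rX := 18.
Notation rY := 19.
Notation rA := 20.
Notation rB := 21.
Notation rE := 22.
Notation rC := 23.
Notation rMU := 24.
Notation rLF := 25.
Notation rHP := 26.
Notation rSL := 27.
Notation rSE := 28.
Notation rT1 := 29.
Notation rT2 := 30.
Notation rVL := 31.
Notation rR := 32.
Notation rPT := 33.
Notation rBV := 34.
Notation rBC := 35.
Notation rPE := 36.
Notation rBA := 37.
Notation rO := 38.
Notation rIE := 39.
Notation rJE := 40.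
Notation rHI := 41.
Notation rLL := 43.
Notation rLS := 44.
Notation rRL := 45.
Notation rRS := 46.

(** The language has no skip; assigning a register to itself takes its place, here and in later
    programs. *)
Definition minto (x y : nat) : hcom := If (y [<=] x) (Set_ x y) (Set_ x x).
Definition maxto (x y : nat) : hcom := If (x [<=] y) (Set_ x y) (Set_ x x).

(** In an encoded trajectory of length l, word 2 is the first start and word 3l the last end, so a
    trajectory is parsed in constant time, without reading its other points. *)
Definition parse_body : hcom :=
  St POS rI rP;;
  Ld rX MAIN rP;;
  Ld rA MAIN (rP [+] lit 2);;
  St TIM rI rA;;
  Set_ rP (rP [+] (rX [+] rX [+] rX));;
  Ld rB MAIN rP;;
  St TIM (rN [+] rI) rB;;
  incr rP;;
  incr rI.

Definition events_body : hcom := St EV rI rI;; incr rI.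

Definition parse_input : hcom :=
  Ld rV MAIN (lit 0);;
  Ld rN MAIN (lit 1);;
  Ld rH MAIN (lit 2);;
  minto rH rV;;
  Set_ rM (rN [+] rN);;
  Set_ rP (lit 3);;
  Set_ rI (lit 0);;
  While (rI [<] rN) parse_body;;
  Set_ rI (lit 0);;
  While (rI [<] rM) events_body.

Definition take_left : hcom := St EV rO rX;; incr rI.
Definition take_right : hcom := St EV rO rY;; incr rJ.

Definition merge_body : hcom :=
  If (rI [<] rIE)
    (If (rJ [<] rJE)
      (Ld rX EV rI;; Ld rY EV rJ;; Ld rA TIM rX;; Ld rB TIM rY;;
       If (rA [<=] rB) take_left take_right)
      (Ld rX EV rI;; take_left))
    (Ld rY EV rJ;; take_right);;
  incr rO.

(** The output of a pass lies exactly [rM] cells behind its input, so two blocks are merged as soon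
    as [rO] reaches [rJE + rM]. *)
Definition merge_loop : hcom := While (rO [<] (rJE [+] rM)) merge_body.

(* The current pass reads the tape EV from [rBA] to [rEF], and writes its output
   right behind, from [rEF] on. *)
Definition block_body : hcom :=
  Set_ rI rK;;
  Set_ rIE (rK [+] rW);;
  minto rIE rEF;;
  Set_ rJ rIE;;
  Set_ rJE (rIE [+] rW);;
  minto rJE rEF;;
  Set_ rO (rK [+] rM);;
  merge_loop;;
  Set_ rK rJE.

Definition pass_body : hcom :=
  Set_ rK rBA;;
  While (rK [<] rEF) block_body;;
  Set_ rBA rEF;;
  Set_ rEF (rEF [+] rM);;
  Set_ rW (rW [+] rW).

Definition sort_events : hcom :=
  Set_ rBA (lit 0);;
  Set_ rEF rM;;
  Set_ rW (lit 1);;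
  While (rW [<] rM) pass_body.

(* The array [dst] receives, from index [rO] on, the events of the
   current node that satisfy [cond]; [rC] counts the starts among them. *)
Definition filter_body (cond : gexp) (dst : nat) : hcom :=
  Ld rE EV rP;;
  If (rN [<=] rE) (Set_ rX (rE [-] rN)) (Set_ rX rE);;
  Ld rA TIM rX;;
  Ld rB TIM (rN [+] rX);;
  If cond
    (St dst rO rE;; incr rO;; If (rE [<] rN) (incr rC) (Set_ rC rC))
    (Set_ rC rC);;
  incr rP.

Definition filter_events (cond : gexp) (dst : nat) : hcom :=
  Set_ rP rLO;;
  Set_ rHI (rLO [+] rS [+] rS);;
  Set_ rC (lit 0);;
  While (rP [<] rHI) (filter_body cond dst).

Definition point_body : hcom :=
  Ld rX MAIN rP;;
  St VLST rVL rX;;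
  incr rVL;;
  Ld rY CNT (rCB [+] rX);;
  St CNT (rCB [+] rX) (rY [+] lit 1);;
  Set_ rP (rP [+] lit 3).

Definition collect_body : hcom :=
  Ld rE MAIN rI;;
  Ld rA TIM rE;;
  Ld rB TIM (rN [+] rE);;
  minto rT1 rA;;
  maxto rT2 rB;;
  Ld rP POS rE;;
  Ld rX MAIN rP;;
  Set_ rPE (rP [+] (rX [+] rX [+] rX));;
  incr rP;;
  While (rP [<=] rPE) point_body;;
  incr rI.

Definition collect : hcom :=
  Set_ rI rSL;;
  Ld rE MAIN rI;;
  Ld rT1 TIM rE;;
  Ld rT2 TIM (rN [+] rE);;
  Set_ rVL (lit 0);;
  While (rI [<] rSE) collect_body.

Definition best_body : hcom :=
  Ld rX VLST rI;;
  Ld rY CNT (rCB [+] rX);;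
  If (rBC [<] rY) (Set_ rBV rX;; Set_ rBC rY) (Set_ rBV rBV);;
  incr rI.

(* Picked vertices get the counter -1. The search for the best vertex starts at
   the first unpicked vertex [rPT], since unvisited vertices are not in VLST. *)
Definition choose_body : hcom :=
  Ld rY CNT (rCB [+] rPT);;
  If (rY [<] lit 0)
    (incr rPT)
    (Set_ rBV rPT;;
     Set_ rBC rY;;
     Set_ rI (lit 0);;
     While (rI [<] rVL) best_body;;
     St CNT (rCB [+] rBV) (ACst (Negz 0));;
     St MAIN rFO (lit 1);;
     St MAIN (rFO [+] lit 1) rBV;;
     St MAIN (rFO [+] lit 2) rT1;;
     St MAIN (rFO [+] lit 3) rT2;;
     Set_ rFO (rFO [+] lit 4);;
     incr rR).

Definition choose_pivots : hcom :=
  Set_ rR (lit 0);;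
  Set_ rPT (lit 0);;
  While (rR [<] rH) choose_body;;
  Set_ rCB (rCB [+] rV).

Definition term_body : hcom :=
  Ld rX MAIN rP;;
  Ld rA MAIN (rP [+] lit 1);;
  Ld rB MAIN (rP [+] lit 2);;
  AccAdd (rB [-] rA) rY rX;;
  Set_ rP (rP [+] lit 3).

(** A stored pivot takes four words: the length 1, the vertex and the two ends of its interval.
    Hence the offset 1 and the stride 4. *)
Definition pivot_body : hcom :=
  Ld rY MAIN (rJ [+] lit 1);;
  Ld rP POS rE;;
  Ld rX MAIN rP;;
  Set_ rPE (rP [+] (rX [+] rX [+] rX));;
  incr rP;;
  AccZero;;
  While (rP [<=] rPE) term_body;;
  Out rQF (rT2 [-] rT1);;
  incr rQF;;
  Set_ rJ (rJ [+] lit 4).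

Definition dist_body : hcom :=
  Ld rE MAIN rI;;
  Set_ rJ rSE;;
  While (rJ [<] rFO) pivot_body;;
  incr rI.

Definition dist_table : hcom :=
  Set_ rI rSL;;
  While (rI [<] rSE) dist_body.

Definition ends_before : gexp := rB [<] rMU.
Definition starts_after : gexp := rMU [<] rA.

(* A leaf ([rLF] > 0) keeps all of its trajectories. *)
Definition stays : gexp :=
  GAnd (rE [<] rN)
    (GNot (GAnd (rLF [<=] lit 0) (GNot (GAnd (rA [<=] rMU) (rMU [<=] rB))))).

Definition build_filter : hcom :=
  Set_ rO (rHP [+] lit 3);;
  Set_ rSL rO;;
  filter_events stays MAIN;;
  Set_ rSE rO;;
  Set_ rFO rO;;
  St MAIN rHP rC;;
  St MAIN (rHP [+] lit 1) rH;;
  St MAIN (rHP [+] lit 2) rQF;;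
  collect;;
  choose_pivots;;
  dist_table.

Definition push (x y : nat) (e : aexp) : hcom :=
  St STK rSP x;;
  St STK (rSP [+] lit 1) y;;
  St STK (rSP [+] lit 2) e;;
  Set_ rSP (rSP [+] lit 3).

(** The list has [2 * rS] events, so its entry number [rS] is a median. The cells [rFO + 2] and
    [rFO + 3] are the child pointers; they are filled when the two pushed entries are processed, the
    left one first. *)
Definition split_node : hcom :=
  Set_ rLF (lit 0);;
  Ld rE EV (rLO [+] rS);;
  Ld rMU TIM rE;;
  St MAIN rFO (lit 1);;
  St MAIN (rFO [+] lit 1) rMU;;
  Set_ rO rEF;;
  Set_ rLL rEF;;
  filter_events ends_before EV;;
  Set_ rLS rC;;
  Set_ rRL rO;;
  filter_events starts_after EV;;
  Set_ rRS rC;;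
  Set_ rEF rO;;
  push rRL rRS (rFO [+] lit 3);;
  push rLL rLS (rFO [+] lit 2);;
  Set_ rHP (rFO [+] lit 4).

Definition make_leaf : hcom :=
  Set_ rLF (lit 1);;
  St MAIN rFO (lit 0);;
  Set_ rHP (rFO [+] lit 1).

(* A stack entry consists of the position of the sorted events of a set of
   trajectories on the tape EV, the size of the set, and the address of the
   pointer to be set to the index of the set. *)
Definition item_body (minsz : nat) : hcom :=
  Set_ rSP (rSP [-] lit 3);;
  Ld rLO STK rSP;;
  Ld rS STK (rSP [+] lit 1);;
  Ld rPP STK (rSP [+] lit 2);;
  If (rS [<=] lit 0)
    (St MAIN rPP (lit 0))
    (St MAIN rPP rFO;;
     If (rS [<=] lit minsz) make_leaf split_node;;
     build_filter).

(** The root pointer is the first cell behind the input. Its address is kept in [rW], which the main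
    loop does not write. *)
Definition program (minsz : nat) : hcom :=
  parse_input;;
  sort_events;;
  Set_ rW rP;;
  Set_ rFO (rP [+] lit 1);;
  Set_ rQF (lit 0);;
  Set_ rCB (lit 0);;
  Set_ rSP (lit 0);;
  push rBA rN rW;;
  While (lit 0 [<] rSP) (item_body minsz);;
  Ld 0 MAIN rW.

Ltac ss := lazymatch goal with |- tr _ (Seq _ _) _ _ => apply: tr_seq | _ => idtac end.
Ltac sset := ss; apply: tr_set; rewrite /=.
Ltac sld idx := ss; apply: (@tr_ld _ _ idx); [rewrite /=; lia | rewrite /=].
Ltac sst idx := ss; apply: (@tr_st _ _ idx); [rewrite /=; lia | rewrite /=].
Ltac sif := ss; apply: tr_if => /=.

Lemma tr_minto (R : realType) (dq : int -> int -> R) x y (Q : nat -> hst R -> Prop) st :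
  Q 2 (HSt (rupd (rg st) x (Num.min (rg st x) (rg st y))) (mm st) (acc st) (rm st)) ->
  tr dq (minto x y) Q st.
Proof.
move=> q; apply: tr_if => /= g; apply: tr_set; move: q; first by rewrite min_r.
by rewrite min_l //; lia.
Qed.

Lemma tr_maxto (R : realType) (dq : int -> int -> R) x y (Q : nat -> hst R -> Prop) st :
  Q 2 (HSt (rupd (rg st) x (Num.max (rg st x) (rg st y))) (mm st) (acc st) (rm st)) ->
  tr dq (maxto x y) Q st.
Proof.
move=> q; apply: tr_if => /= g; apply: tr_set; move: q; first by rewrite max_r.
by rewrite max_l //; lia.
Qed.

(** * Sorting the events *)

Section Sort.
Variables (R : realType) (dq : int -> int -> R) (tim : nat -> int) (N : nat).

Definition tle : rel nat := fun e e' => (tim e <= tim e')%R.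

Lemma tle_total : total tle. Proof. by move=> e e'; exact: le_total. Qed.

Lemma tle_trans : transitive tle. Proof. by move=> e1 e2 e3; exact: le_trans. Qed.

Lemma merge_loopP (st : hst R) i j o s1 s2 :
  (forall e, e < N -> mm st TIM e = tim e) -> rg st rM = Posz N ->
  rg st rI = Posz i -> rg st rIE = Posz (i + size s1) ->
  rg st rJ = Posz j -> rg st rJE = Posz (j + size s2) -> rg st rO = Posz o ->
  o + size s1 + size s2 = j + size s2 + N ->
  seg (mm st EV) i (map Posz s1) -> seg (mm st EV) j (map Posz s2) ->
  i + size s1 <= o -> j + size s2 <= o ->
  all (fun e => e < N) s1 -> all (fun e => e < N) s2 ->
  tr dq merge_loop (fun k st' =>
    [/\ seg (mm st' EV) o (map Posz (merge tle s1 s2)),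
        forall x, x < o -> mm st' EV x = mm st EV x &
        k <= ((size s1 + size s2) * 11).+1]) st.
Proof.
move=> Ht HM HI HIE HJ HJE HO Ho g1 g2 l1 l2 a1 a2; rewrite /merge_loop.
pose I t (st' : hst R) := exists r1 r2 out i' j', [/\
  [/\ size out = t, out ++ merge tle r1 r2 = merge tle s1 s2,
      i' + size r1 = i + size s1 & j' + size r2 = j + size s2],
  [/\ rg st' rI = Posz i', rg st' rJ = Posz j' & rg st' rO = Posz (o + t)],
  [/\ seg (mm st' EV) i' (map Posz r1), seg (mm st' EV) j' (map Posz r2) &
      seg (mm st' EV) o (map Posz out)],
  forall x, x < o -> mm st' EV x = mm st EV x &
  all (fun e => e < N) r1 /\ all (fun e => e < N) r2].
apply: (@tr_for _ _ _ _ I (size s1 + size s2) 10).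
- by exists s1, s2, [::], i, j; split=> //; split=> //; rewrite addn0.
- move=> t st' ltT [r1 [r2 [out [i' [j' [_ [_ _ HO'] _ _ _]]]]]] F.
  carry F st st'; rewrite /=; lia.
- move=> t st' ltT [r1 [r2 [out [i' [j' [[so eo e1 e2] [HI' HJ' HO'] [q1 q2 q3] ag [b1 b2]]]]]]] F.
  carry F st st'.
  have Ht' e : e < N -> mm st' TIM e = tim e by case: F => _ F _; rewrite F //; exact: Ht.
  have szm : size out + (size r1 + size r2) = size s1 + size s2.
    by have := congr1 size eo; rewrite size_cat !size_merge !size_cat.
  have upd_seg a s v : a + size s <= o + t -> seg (mm st' EV) a (map Posz s) ->
    seg (upd (mm st' EV) (o + t) v) a (map Posz s).
    by move=> le; apply: seg_ext => x; rewrite size_map => lx; rewrite upd_neq //; lia.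
  have upd_ag v x : x < o -> upd (mm st' EV) (o + t) v x = mm st EV x.
    by move=> lx; rewrite upd_neq ?ag //; lia.
  have upd_out v : seg (upd (mm st' EV) (o + t) (Posz v)) o (map Posz (rcons out v)).
    rewrite map_rcons seg_rcons size_map so upd_eq; split=> //.
    by apply: upd_seg => //; rewrite so.
  have left x r1' : r1 = x :: r1' -> merge tle r1 r2 = x :: merge tle r1' r2 ->
    forall st2 : hst R, mm st2 EV = upd (mm st' EV) (o + t) (Posz x) ->
    rg st2 rI = (Posz i' + 1)%R -> rg st2 rJ = Posz j' -> rg st2 rO = (Posz (o + t) + 1)%R ->
    I t.+1 st2.
    move=> er em st2 E2 I2 J2 O2.
    rewrite er in q1 b1 e1 em *; move: q1 => /= /seg_cons [q1 q1'].
    exists r1', r2, (rcons out x), i'.+1, j'; split; rewrite ?E2; try split=> //.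
    + by rewrite size_rcons so.
    + by rewrite cat_rcons -em -eo er.
    + by move: e1 => /=; lia.
    + by rewrite I2; lia.
    + by rewrite O2; lia.
    + by apply: upd_seg => //; rewrite /= in e1; lia.
    + by apply: upd_seg => //; lia.
    + exact: upd_ag.
    + by case/andP: b1.
  have right y r2' : r2 = y :: r2' -> merge tle r1 r2 = y :: merge tle r1 r2' ->
    forall st2 : hst R, mm st2 EV = upd (mm st' EV) (o + t) (Posz y) ->
    rg st2 rI = Posz i' -> rg st2 rJ = (Posz j' + 1)%R -> rg st2 rO = (Posz (o + t) + 1)%R ->
    I t.+1 st2.
    move=> er em st2 E2 I2 J2 O2.
    rewrite er in q2 b2 e2 em *; move: q2 => /= /seg_cons [q2 q2'].
    exists r1, r2', (rcons out y), i', j'.+1; split; rewrite ?E2; try split=> //.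
    + by rewrite size_rcons so.
    + by rewrite cat_rcons -em -eo er.
    + by move: e2 => /=; lia.
    + by rewrite J2; lia.
    + by rewrite O2; lia.
    + by apply: upd_seg => //; lia.
    + by apply: upd_seg => //; rewrite /= in e2; lia.
    + exact: upd_ag.
    + by case/andP: b2.
  rewrite /merge_body /take_left /take_right.
  sif => [lt1|ge1]; last first.
    have er1 : r1 = [::] by apply/nilP; rewrite /nilp; lia.
    case er2 : r2 => [|y r2']; first by rewrite er1 er2 /= in szm; lia.
    have hy : mm st' EV j' = Posz y by move: q2; rewrite er2 /= => /seg_cons[].
    sld j'; rewrite hy; sst (o + t); sset; sset; split; first lia.
    by apply: (right y r2') => //=; first [lia|rewrite er1 er2].
  case er1 : r1 => [|x r1']; first by rewrite er1 /= in e1; lia.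
  have hx : mm st' EV i' = Posz x by move: q1; rewrite er1 /= => /seg_cons[].
  have Nx : x < N by move: b1; rewrite er1 => /andP[].
  sif => [lt2|ge2]; last first.
    have er2 : r2 = [::] by apply/nilP; rewrite /nilp; lia.
    sld i'; rewrite hx; sst (o + t); sset; sset; split; first lia.
    by apply: (left x r1') => //=; first [lia|rewrite er1 er2 /=; case: (r1')].
  case er2 : r2 => [|y r2']; first by rewrite er2 /= in e2; lia.
  have hy : mm st' EV j' = Posz y by move: q2; rewrite er2 /= => /seg_cons[].
  have Ny : y < N by move: b2; rewrite er2 => /andP[].
  sld i'; rewrite hx; sld j'; rewrite hy; sld x; sld y; rewrite !Ht' //.
  sif => lexy.
    sst (o + t); sset; sset; split; first lia.
    by apply: (left x r1') => //=; first [lia|rewrite er1 er2 /= /tle lexy].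
  sst (o + t); sset; sset; split; first lia.
  by apply: (right y r2') => //=; first [lia|rewrite er1 er2 /= /tle (negPf lexy)].
- move=> k st' [r1 [r2 [out [i' [j' [[so eo e1 e2] _ [_ _ q] ag _]]]]]] F le_k.
  split=> //; rewrite -eo.
  have /eqP : size (out ++ merge tle r1 r2) = size (merge tle s1 s2) by rewrite eo.
  rewrite size_cat !size_merge !size_cat so => /eqP sz.
  have -> : r1 = [::] by apply/nilP; rewrite /nilp; lia.
  have -> : r2 = [::] by apply/nilP; rewrite /nilp; lia.
  by rewrite /= cats0.
Qed.

Definition runs (w : nat) (s : seq nat) : Prop :=
  forall q, sorted tle (take w (drop (q * w) s)).

Lemma runs_cat W b s : size b = W -> sorted tle b -> runs W s -> runs W (b ++ s).
Proof.
move=> <- sb rs [|q]; first by rewrite mul0n drop0 take_size_cat.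
by rewrite drop_cat mulSn ltnNge leq_addr /= addKn.
Qed.

Lemma runs_sorted W b : size b <= W -> 0 < W -> sorted tle b -> runs W b.
Proof.
move=> leW W0 sb [|q]; first by rewrite mul0n drop0 take_oversize.
by rewrite drop_oversize // mulSn; apply: leq_trans leW _; exact: leq_addr.
Qed.

Lemma pass_bodyP (st : hst R) ba w s :
  (forall e, e < N -> mm st TIM e = tim e) -> rg st rM = Posz N ->
  rg st rBA = Posz ba -> rg st rEF = Posz (ba + N) -> rg st rW = Posz w -> 0 < w ->
  size s = N -> all (fun e => e < N) s -> seg (mm st EV) ba (map Posz s) -> runs w s ->
  tr dq pass_body (fun k st' => exists s',
    [/\ perm_eq s' s, runs (w + w) s', seg (mm st' EV) (ba + N) (map Posz s'),
        [/\ rg st' rBA = Posz (ba + N), rg st' rEF = Posz (ba + N + N) & rg st' rW = Posz (w + w)]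
        & k <= 26 * N + 10]) st.
Proof.
move=> Ht HM HBA HEF HW w0 sz aN g rs; rewrite /pass_body; sset; ss.
set st0 := HSt _ _ _ _.
(* Only the last merged block can be shorter than [w + w]. As long as events remain, [out] consists
   of full blocks, so any list of sorted runs may be appended to it; the disjunction separates these
   cases. *)
pose I phi (st' : hst R) := exists done rest out, [/\
  [/\ s = done ++ rest, perm_eq out done, runs w rest & phi = 26 * size rest],
  rg st' rK = Posz (ba + size done),
  (rest = [::] /\ runs (w + w) out) \/ (forall X, runs (w + w) X -> runs (w + w) (out ++ X)),
  seg (mm st' EV) (ba + N) (map Posz out) &
  forall x, x < ba + N -> mm st' EV x = mm st EV x].
(* Each unread event carries 26 units: 11 for being merged, and the rest for the constant cost of a
   block, which may consist of a single event. *)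
apply: (@tr_while _ _ _ _ I (26 * N)).
- exists [::], s, [::]; split=> //; last by right.
  + by rewrite sz.
  + by rewrite /st0 /= HBA addn0.
- move=> phi st1 [done [rest [out [[es pe rr ->] HK alt so ag]]]] F g1.
  have [h1 h2 h3 h4] : [/\ rg st0 rM = Posz N, rg st0 rEF = Posz (ba + N),
    rg st0 rBA = Posz ba & rg st0 rW = Posz w] by rewrite /st0 /=.
  carry F st0 st1.
  rewrite /= in g1.
  have sN : size done + size rest = N by rewrite -size_cat -es.
  have [/size0nil er|rest0] := posnP (size rest); first by rewrite er /= in sN; lia.
  have {}alt X : runs (w + w) X -> runs (w + w) (out ++ X).
    by case: alt => [[er _]|]; [rewrite er in rest0|exact].
  have Ht1 e : e < N -> mm st1 TIM e = tim e by case: F => _ F _; rewrite F //; exact: Ht.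
  have so_d : size out = size done by rewrite (perm_size pe).
  pose s1 := take w rest; pose s2 := take w (drop w rest); pose rest' := drop (w + w) rest.
  have e12 : s1 ++ s2 ++ rest' = rest by rewrite /rest' -drop_drop !cat_take_drop.
  have sz1 : size s1 = minn w (size rest) by rewrite size_take_min.
  have sz2 : size s2 = minn w (size rest - w) by rewrite size_take_min size_drop.
  have sz3 : size rest' = size rest - (w + w) by rewrite size_drop.
  have aR : all (fun e => e < N) rest by move: aN; rewrite es all_cat => /andP[].
  have [a1 a2] : all (fun e => e < N) s1 /\ all (fun e => e < N) s2.
    by move: aR; rewrite -e12 !all_cat => /and3P[].
  have g0 : seg (mm st1 EV) ba (map Posz s).
    apply: seg_ext g => x; rewrite size_map sz => lx; apply: ag; lia.
  move: g0; rewrite es map_cat => /seg_cat [_]; rewrite size_map => gR.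
  have := gR; rewrite -e12 map_cat seg_cat size_map => -[gs1].
  rewrite map_cat seg_cat => -[gs2 _].
  have sorted1 : sorted tle s1 by have := rr 0; rewrite mul0n drop0.
  have sorted2 : sorted tle s2 by have := rr 1; rewrite mul1n.
  have fin : forall st2 : hst R,
      seg (mm st2 EV) (ba + N + size done) (map Posz (merge tle s1 s2)) ->
      (forall x, x < ba + N + size done -> mm st2 EV x = mm st1 EV x) ->
      rg st2 rK = Posz (ba + size done + size s1 + size s2) ->
      I (26 * size rest') st2.
    move=> st2 gm ag2 HK2.
    exists (done ++ s1 ++ s2), rest', (out ++ merge tle s1 s2); split; first split=> //.
    + by rewrite es -e12 -!catA.
    + by rewrite perm_cat // perm_merge.
    + move=> q; rewrite /rest' drop_drop (_ : q * w + (w + w) = q.+2 * w); last by rewrite !mulSn; lia.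
      exact: rr.
    + by rewrite HK2 !size_cat !addnA.
    + have sm : sorted tle (merge tle s1 s2) by apply: merge_sorted => //; exact: tle_total.
      case: (posnP (size rest')) => [/size0nil er|r0].
        left; split=> //; apply: alt; apply: runs_sorted => //; last lia.
        by rewrite size_merge size_cat sz1 sz2; lia.
      right=> X rX; rewrite -catA; apply: alt; apply: runs_cat => //.
      by rewrite size_merge size_cat sz1 sz2; lia.
    + rewrite map_cat seg_cat size_map so_d; split=> //.
      apply: seg_ext so => x; rewrite size_map so_d => lx; apply: ag2; lia.
    + by move=> x lx; rewrite ag2 ?ag //; lia.
  rewrite /block_body; sset; sset; ss.
  apply: tr_minto => /=; sset; sset; ss; apply: tr_minto => /=; sset; ss.
  have eI : Num.min (rg st1 rK + rg st1 rW)%R (rg st1 rEF) = Posz (ba + size done + size s1) by lia.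
  rewrite eI.
  have eJ : Num.min (Posz (ba + size done + size s1) + rg st1 rW)%R (rg st1 rEF)
    = Posz (ba + size done + size s1 + size s2) by lia.
  rewrite eJ.
  apply: tr_frame; first apply: (@merge_loopP _ (ba + size done) (ba + size done + size s1)
     (ba + N + size done) s1 s2) => //=; try lia.
  move=> k st2 F2 [gm ag2 lek]; sset; exists (26 * size rest'); last first.
    apply: fin => //=.
    by case: F2 => F2 _ _; rewrite F2.
  by rewrite !size_cat; lia.
- move=> phi k st' [done [rest [out [[es pe rr ->] HK alt so ag]]]] F g1 lek.
  have [h1 h2 h4] : [/\ rg st0 rM = Posz N, rg st0 rEF = Posz (ba + N)
    & rg st0 rW = Posz w] by rewrite /st0 /=.
  carry F st0 st'.
  rewrite /= in g1.
  have sN : size done + size rest = N by rewrite -size_cat -es.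
  have er : rest = [::] by apply/nilP; rewrite /nilp; lia.
  sset; sset; sset; exists out; split=> //.
  + by rewrite es er cats0.
  + case: alt => [[]//|alt]; rewrite -[out]cats0; apply: alt.
    by move=> q.
  + by split; lia.
  + by lia.
Qed.

Lemma sort_eventsP (st : hst R) :
  (forall e, e < N -> mm st TIM e = tim e) -> rg st rM = Posz N ->
  seg (mm st EV) 0 (map Posz (iota 0 N)) ->
  tr dq sort_events (fun k st' => exists ev ba,
    [/\ perm_eq ev (iota 0 N), sorted tle ev, seg (mm st' EV) ba (map Posz ev),
        rg st' rBA = Posz ba /\ rg st' rEF = Posz (ba + N)
        & k <= (26 * N + 11) * (trunc_log 2 N).+1 + 4]) st.
Proof.
move=> Ht HM g; rewrite /sort_events; do 3!sset; set st0 := HSt _ _ _ _.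
(* After [p] passes the runs have length [2 ^ p]. A further pass happens only if [2 ^ p < N], so
   there are at most [(trunc_log 2 N).+1] of them. *)
pose I phi (st' : hst R) := exists ev ba p, [/\
  [/\ perm_eq ev (iota 0 N), runs (2 ^ p) ev & p <= (trunc_log 2 N).+1],
  phi = (26 * N + 11) * ((trunc_log 2 N).+1 - p),
  seg (mm st' EV) ba (map Posz ev) &
  [/\ rg st' rBA = Posz ba, rg st' rEF = Posz (ba + N) & rg st' rW = Posz (2 ^ p)]].
apply: (@tr_while _ _ _ _ I ((26 * N + 11) * (trunc_log 2 N).+1)).
- exists (iota 0 N), 0, 0; split=> //=; split=> //.
  by move=> q; case: (drop _ _) => //= e [].
- move=> phi st1 [ev [ba [p [[pe rr lp] -> ge [h1 h2 h3]]]]] F g1; rewrite /= in g1.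
  have H0 : rg st0 rM = Posz N by [].
  carry F st0 st1.
  have ltN : 2 ^ p < N by lia.
  have lep : p <= trunc_log 2 N by apply: trunc_log_max => //; exact: ltnW.
  apply: tr_frame; first apply: (@pass_bodyP _ ba (2 ^ p) ev) => //.
  + by move=> e eN; case: F => _ F _; rewrite F //; exact: Ht.
  + by rewrite expn_gt0.
  + by rewrite (perm_size pe) size_iota.
  + by rewrite (perm_all _ pe); apply/allP => e; rewrite mem_iota.
  move=> k st2 _ [ev' [pe' rr' ge' [h1' h2' h3'] lek]].
  exists ((26 * N + 11) * ((trunc_log 2 N).+1 - p.+1)).
    have -> : (trunc_log 2 N).+1 - p = ((trunc_log 2 N).+1 - p.+1).+1 by lia.
    rewrite mulnS; lia.
  exists ev', (ba + N), p.+1; split=> //; split=> //.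
  + exact: perm_trans pe' pe.
  + by rewrite expnS mul2n -addnn.
  + by rewrite h3' expnS mul2n -addnn.
- move=> phi k st1 [ev [ba [p [[pe rr lp] -> ge [h1 h2 h3]]]]] F g1 lek; rewrite /= in g1.
  have H0 : rg st0 rM = Posz N by [].
  carry F st0 st1.
  exists ev, ba; split=> //; last by lia.
  have := rr 0; rewrite mul0n drop0 take_oversize // (perm_size pe) size_iota; lia.
Qed.

End Sort.

(** * Parsing the input *)

Section Encoding.
Variable V : finType.
Implicit Types (T : traj V) (Ts : seq (traj V)).

Lemma size_enc_traj T : size (enc_traj T) = (3 * size T).+1.
Proof. by rewrite /enc_traj /=; congr _.+1; elim: T => //= x T ->; lia. Qed.

Lemma nth_enc_traj T x0 j : j < size T ->
  let x := nth x0 T j in let s := enc_traj T in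
  [/\ nth (Posz 0) s (3 * j).+1 = vcode x.1, nth (Posz 0) s (3 * j).+2 = x.2.1 &
      nth (Posz 0) s (3 * j).+3 = x.2.2].
Proof.
elim: T j => // x T IH [|j] // jT; rewrite mulnS; exact: IH j jT.
Qed.

Lemma enc_traj_start T : is_traj T -> nth (Posz 0) (enc_traj T) 2 = tstart T.
Proof. by case: T. Qed.

Lemma enc_traj_end T : is_traj T -> nth (Posz 0) (enc_traj T) (3 * size T) = tend T.
Proof.
case: T => // x T _.
have [//|_ _] := nth_enc_traj (T := x :: T) x (j := size T).
by rewrite [size (x :: T)]/= mulnS => ->; rewrite /tend (last_nth x).
Qed.

Lemma tstart_lt_tend T : is_traj T -> (tstart T < tend T)%R.
Proof.
case: T => // x T /= /andP[/andP[lx aT] p].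
elim: T x lx aT p => //= y T IH x lx /andP[ly aT] /andP[/andP[/eqP e _] p].
by apply: lt_trans lx _; rewrite -e; exact: IH.
Qed.

Lemma traj_within T x : is_traj T -> x \in T ->
  [/\ (tstart T <= x.2.1)%R, (x.2.1 < x.2.2)%R & (x.2.2 <= tend T)%R].
Proof.
case: T => // y T H; move: (H) => /= /andP[/andP[ly aT] p].
rewrite inE => /orP[/eqP->|].
  split=> //; case: T H aT p => // z T H /andP[lz aT] /= /andP[/andP[/eqP e _] p].
  by rewrite -e; apply/ltW/(@tstart_lt_tend (z :: T))/andP; split=> //; apply/andP.
elim: T y ly aT p {H} => //= z T IH y ly /andP[lz aT] /andP[/andP[/eqP e _] p].
rewrite inE => /orP[/eqP->|xT].
  split=> //; first by rewrite e; exact: ltW.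
  case: T aT p {IH} => // w T /andP[lw aT] /= /andP[/andP[/eqP e' _] p].
  by rewrite -e'; apply/ltW/(@tstart_lt_tend (w :: T))/andP; split=> //; apply/andP.
have [h1 h2 h3] := IH z lz aT p xT.
by split=> //; apply: le_trans (ltW ly) _; rewrite -e.
Qed.

Variables (Ts : seq (traj V)) (h : nat).

Definition inp (k : nat) : int := nth (Posz 0) (enc_input Ts h) k.

Definition posn (i : nat) : nat := 3 + size (flatten (map (@enc_traj V) (take i Ts))).

Definition trj (i : nat) : traj V := nth [::] Ts i.

Definition tim (e : nat) : int :=
  if e < size Ts then tstart (trj e) else tend (trj (e - size Ts)).

Lemma posn0 : posn 0 = 3. Proof. by rewrite /posn take0. Qed.

Lemma posnS i : i < size Ts -> posn i.+1 = posn i + (3 * size (trj i)).+1.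
Proof.
move=> lt; rewrite /posn (take_nth [::]) // map_rcons flatten_rcons size_cat.
by rewrite size_enc_traj addnA.
Qed.

Lemma inp_trj i k : i < size Ts -> k <= 3 * size (trj i) ->
  inp (posn i + k) = nth (Posz 0) (enc_traj (trj i)) k.
Proof.
move=> lt lk; rewrite /inp /enc_input /posn -addnA nth_cat ltnNge leq_addr /= addKn.
rewrite -[in map _ Ts](cat_take_drop i Ts) map_cat flatten_cat nth_cat ltnNge leq_addr /= addKn.
rewrite (drop_nth [::]) // map_cons.
rewrite -[flatten _]/(enc_traj (trj i) ++ flatten (map (@enc_traj V) (drop i.+1 Ts))).
by rewrite nth_cat size_enc_traj ltnS lk.
Qed.

Lemma posn_lt i k : i < size Ts -> k <= 3 * size (trj i) -> posn i + k < posn (size Ts).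
Proof.
move=> lt lk; rewrite /posn take_size -[in ltnRHS](cat_take_drop i Ts) map_cat flatten_cat.
rewrite size_cat (drop_nth [::]) // map_cons.
rewrite -[flatten (_ :: _)]/(enc_traj (trj i) ++ flatten (map (@enc_traj V) (drop i.+1 Ts))).
by rewrite size_cat size_enc_traj; lia.
Qed.

Variable R : realType.

(* The part of the state that stays constant after parsing. *)
Definition static (st : hst R) : Prop :=
  [/\ [/\ rg st rV = Posz #|V|, rg st rN = Posz (size Ts),
          rg st rM = Posz (size Ts + size Ts) & rg st rH = Posz (minn h #|V|)],
      forall k, k < posn (size Ts) -> mm st MAIN k = inp k,
      forall i, i < size Ts -> mm st POS i = Posz (posn i) &
      forall e, e < size Ts + size Ts -> mm st TIM e = tim e].

Lemma static_start st i : static st -> i < size Ts -> mm st TIM i = tstart (trj i).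
Proof. by case=> _ _ _ H li; rewrite H /tim ?li //; lia. Qed.

Lemma static_end st i : static st -> i < size Ts -> mm st TIM (size Ts + i) = tend (trj i).
Proof. by case=> _ _ _ H li; rewrite H ?ltn_add2l // /tim ltnNge leq_addr /= addKn. Qed.

Lemma static_len st i : static st -> i < size Ts -> mm st MAIN (posn i) = Posz (size (trj i)).
Proof.
case=> _ H _ _ li; rewrite H -[posn i]addn0 ?inp_trj //; exact: posn_lt.
Qed.

Lemma static_point st i x0 j : static st -> i < size Ts -> j < size (trj i) ->
  let x := nth x0 (trj i) j in
  [/\ mm st MAIN (posn i + (3 * j).+1) = vcode x.1,
      mm st MAIN (posn i + (3 * j).+2) = x.2.1 &
      mm st MAIN (posn i + (3 * j).+3) = x.2.2].
Proof.
case=> _ H _ _ li lj x; have [h1 h2 h3] := nth_enc_traj x0 lj.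
by rewrite !H ?inp_trj ?h1 ?h2 ?h3 //; try (apply: posn_lt => //); lia.
Qed.

Lemma static_frame c st st' : frame c st st' ->
  all (fun x => x \notin wregs c) [:: rV; rN; rM; rH] ->
  all (fun s => s \notin warrs c) [:: POS; TIM] ->
  (forall k, k < posn (size Ts) -> mm st' MAIN k = mm st MAIN k) ->
  static st -> static st'.
Proof.
move=> [F1 F2 _] /and5P[w1 w2 w3 w4 _] /and3P[w5 w6 _] ag [[a1 a2 a3 a4] b c1 d]; split.
- by split; rewrite F1.
- by move=> k lk; rewrite ag ?b.
- by move=> i li; rewrite F2 ?c1.
- by move=> i li; rewrite F2 ?d.
Qed.

Hypothesis Ts_traj : forall T, T \in Ts -> is_traj T.

Lemma trj_traj i : i < size Ts -> is_traj (trj i).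
Proof. by move=> li; apply: Ts_traj; rewrite mem_nth. Qed.

Lemma trj_size_gt0 i : i < size Ts -> 0 < size (trj i).
Proof. by move=> /trj_traj; case: (trj i). Qed.

Lemma parse_inputP (dq : int -> int -> R) (st : hst R) : (forall k, mm st MAIN k = inp k) ->
  tr dq parse_input (fun k st' => [/\ static st',
    seg (mm st' EV) 0 (map Posz (iota 0 (size Ts + size Ts))),
    mm st' MAIN = mm st MAIN,
    rg st' rP = Posz (posn (size Ts)) & k <= 20 * size Ts + 20]) st.
Proof.
move=> Hin; rewrite /parse_input; sld 0; sld 1; sld 2; rewrite !Hin.
have [-> -> ->] : [/\ inp 0 = Posz #|V|, inp 1 = Posz (size Ts) & inp 2 = Posz h] by [].
ss; apply: tr_minto => /=; do 3!sset.
set n := size Ts; set st0 := HSt _ _ _ _; ss.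
pose I i (st' : hst R) := [/\ rg st' rI = Posz i, rg st' rP = Posz (posn i),
  forall j, j < i -> mm st' POS j = Posz (posn j) &
  forall j, j < i -> mm st' TIM j = tim j /\ mm st' TIM (n + j) = tim (n + j)].
have h1 : rg st0 rN = Posz n by [].
apply: (@tr_for _ _ _ _ I n 9).
- by split=> //; rewrite /st0 /= posn0.
- by move=> i st1 li [H1 _ _ _] F; carry F st0 st1; rewrite /=; lia.
- move=> i st1 li [H1 H2 H3 H4] F; carry F st0 st1.
  have M1 : mm st1 MAIN = mm st MAIN by case: F => _ F _; rewrite F.
  have T_i := trj_traj li; have s0 := trj_size_gt0 li.
  have e1 : mm st1 MAIN (posn i) = Posz (size (trj i)).
    by rewrite M1 Hin -[posn i]addn0 inp_trj.
  have e2 : mm st1 MAIN (posn i + 2) = tstart (trj i).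
    by rewrite M1 Hin inp_trj ?enc_traj_start //; lia.
  have e3 : mm st1 MAIN (posn i + 3 * size (trj i)) = tend (trj i).
    by rewrite M1 Hin inp_trj ?enc_traj_end.
  rewrite /parse_body; sst i; sld (posn i); rewrite e1; sld (posn i + 2); rewrite e2; sst i.
  sset; sld (posn i + 3 * size (trj i)); rewrite e3; sst (n + i); sset; sset.
  split=> //; split=> /=.
  + by lia.
  + by rewrite posnS //; lia.
  + move=> j; rewrite ltnS leq_eqVlt => /orP[/eqP->|lj]; first by rewrite upd_eq; lia.
    by rewrite upd_neq ?H3 //; lia.
  + move=> j; rewrite ltnS leq_eqVlt => /orP[/eqP->|lj].
      rewrite upd_eq upd_neq ?upd_eq /tim ?li; last by lia.
      by rewrite ltnNge leq_addr /= addKn.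
    have [H5 H6] := H4 j lj.
    by rewrite !upd_neq ?H5 ?H6 //; lia.
- move=> k1 st1 [H1 H2 H3 H4] F lek1; sset; set st2 := HSt _ _ _ _.
  have g2 : rg st0 rM = Posz (n + n) by rewrite /st0 /=; lia.
  have g3 : rg st0 rV = Posz #|V| by [].
  have g4 : rg st0 rH = Posz (minn h #|V|) by rewrite /st0 /=; lia.
  carry F st0 st1.
  have M1 : mm st1 MAIN = mm st MAIN by case: F => _ F _; rewrite F.
  have H5 : rg st2 rM = Posz (n + n) by rewrite /st2.
  pose J i (st' : hst R) := rg st' rI = Posz i /\ seg (mm st' EV) 0 (map Posz (iota 0 i)).
  apply: (@tr_for _ _ _ _ J (n + n) 2).
  + by [].
  + by move=> i st3 li [H6 _] F3; carry F3 st2 st3; rewrite /=; lia.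
  + move=> i st3 li [H6 H7] F3; rewrite /events_body; sst i; sset; split=> //; split; first by rewrite /=; lia.
    rewrite -(addn1 i) iotaD map_cat seg_cat size_map size_iota add0n /= seg_cons; split.
      by apply: seg_ext H7 => x; rewrite size_map size_iota => lx; rewrite upd_neq //; lia.
    by rewrite upd_eq.
  + move=> k2 st3 [H6 H7] F3 lek2.
    have E st' : st' = st2 -> static st'.
      move=> ->; split=> //.
      * by move=> k lk; rewrite /= M1 Hin.
      * move=> e le; case: (ltnP e n) => len; first by case: (H4 e len).
        by have [|_] := H4 (e - n); rewrite ?subnKC //; lia.
    have F4 := F3; case: F3 => F31 F32 _; split=> //.
    * by apply: (static_frame F4 isT isT) (E _ erefl) => k lk; rewrite F32.
    * by rewrite F32.
    * by rewrite F31.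
    * by lia.
Qed.

End Encoding.

(** * Filtering events *)

Section Filter.
Variables (V : finType) (Ts : seq (traj V)) (h : nat) (R : realType).
Variable dq : int -> int -> R.
Notation n := (size Ts).

Definition tid (e : nat) : nat := if e < n then e else e - n.

(** The condition is known only through the registers that it may read, so the same lemma serves
    both children and the stored set. If the output also goes to [EV], it must start behind the list
    that is being read. The scan keeps the order, so sorted events stay sorted. *)
Lemma filter_eventsP (cond : gexp) (dst : nat) (P : pred nat) (st : hst R) lo s f0 ev :
  static Ts h st -> dst != POS -> dst != TIM -> (dst = EV -> lo + s + s <= f0) ->
  rg st rLO = Posz lo -> rg st rS = Posz s -> rg st rO = Posz f0 ->
  size ev = s + s -> all (fun e => e < n + n) ev -> seg (mm st EV) lo (map Posz ev) ->
  (forall (st' : hst R) e, e < n + n -> rg st' rN = Posz n -> rg st' rMU = rg st rMU ->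
     rg st' rLF = rg st rLF -> rg st' rE = Posz e -> rg st' rA = tstart (trj Ts (tid e)) ->
     rg st' rB = tend (trj Ts (tid e)) -> gval (rg st') cond = P e) ->
  tr dq (filter_events cond dst) (fun k st' =>
    [/\ seg (mm st' dst) f0 (map Posz (seq.filter P ev)),
        rg st' rO = Posz (f0 + size (seq.filter P ev)),
        rg st' rC = Posz (count (fun e => P e && (e < n)) ev),
        forall x, x < f0 -> mm st' dst x = mm st dst x &
        k <= 24 * s + 4]) st.
Proof.
move=> Hst d1 d2 dEV HLO HS HO sz aN g cP; rewrite /filter_events.
do 3!sset; set st0 := HSt _ _ _ _.
pose I i (st' : hst R) := let ev' := take i ev in
  [/\ rg st' rP = Posz (lo + i), rg st' rO = Posz (f0 + size (seq.filter P ev')),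
      rg st' rC = Posz (count (fun e => P e && (e < n)) ev'),
      seg (mm st' dst) f0 (map Posz (seq.filter P ev')) &
      forall x, x < f0 -> mm st' dst x = mm st dst x].
have [[h1 h2 h3 h4] _ _ Htim] := Hst.
have [h5 h6] : rg st0 rN = Posz n /\ rg st0 rHI = Posz (lo + s + s).
  by rewrite /st0 /=; split=> //; lia.
apply: (@tr_for _ _ _ _ I (s + s) 11).
- by rewrite /I take0 /st0 /=; split=> //; lia.
- by move=> i st1 li [H1 _ _ _ _] F; carry F st0 st1; rewrite /=; lia.
- move=> i st1 li [H1 H2 H3 H4 H5] F; carry F st0 st1.
  have lis : i < size ev by rewrite sz.
  have [e ee] : exists e, e = nth 0 ev i by exists (nth 0 ev i).
  have le : e < n + n by rewrite ee; exact: (allP aN) (mem_nth _ lis).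
  have He : mm st1 EV (lo + i) = Posz e.
    rewrite ee -(seg_nth g lis); have [ed|/eqP nd] := dst =P EV.
      by rewrite -ed H5; move: (dEV ed); lia.
    by case: F => _ F _; rewrite F //= inE eq_sym.
  have Ht x : x < n + n -> mm st1 TIM x = tim Ts x.
    by move=> lx; case: F => _ F _; rewrite F ?Htim //= inE eq_sym.
  have ltid : tid e < n by rewrite /tid; case: (ltnP e n); lia.
  have Ea : mm st1 TIM (tid e) = tstart (trj Ts (tid e)).
    by rewrite Ht /tim ?ltid //; lia.
  have Eb : mm st1 TIM (n + tid e) = tend (trj Ts (tid e)).
    by rewrite Ht /tim ?ltn_add2l // ltnNge leq_addr /= addKn.
  have [FMU FLF] : rg st1 rMU = rg st rMU /\ rg st1 rLF = rg st rLF.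
    by case: F => F _ _; rewrite !F.
  have takeS : take i.+1 ev = rcons (take i ev) e by rewrite ee (take_nth 0).
  rewrite /filter_body; sld (lo + i); rewrite He; ss.
  apply: (@tr_frame _ _ _ (fun k st2 => [/\ k = 2, mm st2 = mm st1 &
     rg st2 = rupd (rupd (rg st1) rE (Posz e)) rX (Posz (tid e))])).
    by apply: tr_if => /= g1; apply: tr_set; split=> //=; congr rupd; rewrite /tid; case: (ltnP e n); lia.
  move=> k2 st2 _ [-> M2 R2]; ss.
  have [R2X R2N R2O] : [/\ rg st2 rX = Posz (tid e), rg st2 rN = Posz n &
    rg st2 rO = Posz (f0 + size (seq.filter P (take i ev)))] by rewrite R2.
  sld (tid e); rewrite M2 Ea; sld (n + tid e).
  rewrite Eb; ss.
  apply: (@tr_frame _ _ _ (fun k st3 => k <= 5 /\ I i.+1 (HSt (rupd (rg st3) rP (Posz (lo + i.+1)))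
     (mm st3) (acc st3) (rm st3)) /\ rg st3 rP = Posz (lo + i))); last first.
    move=> k3 st3 _ [lek [I3 P3]]; sset; split; first lia.
    by move: I3; rewrite P3 (_ : (Posz (lo + i) + 1)%R = Posz (lo + i.+1)) //; lia.
  apply: tr_if; rewrite (cP _ e) /= ?R2 //= => g1.
    sst (f0 + size (seq.filter P (take i ev))); sset.
    have J : forall c (st4 : hst R), c = count (fun e => P e && (e < n)) (take i ev) + (e < n) ->
      mm st4 dst = upd (mm st1 dst) (f0 + size (seq.filter P (take i ev))) (Posz e) ->
      rg st4 rO = (Posz (f0 + size (seq.filter P (take i ev))) + 1)%R ->
      rg st4 rC = Posz c -> rg st4 rP = Posz (lo + i.+1) -> I i.+1 st4.
      move=> c st4 ec M4 O4 C4 P4; rewrite /I takeS -cats1 seq.filter_cat count_cat /= g1 /= addn0 cats1.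
      split=> //.
      + by rewrite O4 size_rcons; lia.
      + by rewrite C4 ec.
      + rewrite M4 map_rcons seg_rcons size_map upd_eq; split=> //.
        by apply: seg_ext H4 => x; rewrite size_map => lx; rewrite upd_neq //; lia.
      + by move=> x lx; rewrite M4 upd_neq ?H5 //; lia.
    sif => g2; sset; split=> //; split=> //.
    + apply: (J (count (fun e => P e && (e < n)) (take i ev) + 1)%N) => //=.
      * by congr (_ + _)%N; lia.
      * by rewrite PeanoNat.Nat.eqb_refl.
      * by lia.
      * by lia.
    + apply: (J (count (fun e => P e && (e < n)) (take i ev))%N) => //=.
      * by lia.
      * by rewrite PeanoNat.Nat.eqb_refl.
      * by lia.
  sset; split=> //; split=> //.
  rewrite /I takeS -cats1 seq.filter_cat count_cat /= (negPf g1) /= !addn0 cats0 /=.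
  by split.
- move=> k st' [H1 H2 H3 H4 H5] F lek; rewrite -sz take_size in H2 H3 H4.
  by split=> //; lia.
Qed.

End Filter.

(** * Pivot-based filters *)

Section Pivots.
Variables (V : finType) (Ts : seq (traj V)) (h : nat) (R : realType).
Variable dq : int -> int -> R.
Hypothesis Ts_traj : forall T, T \in Ts -> is_traj T.
Variable m : nat.
Hypothesis le_m : forall i, i < size Ts -> size (trj Ts i) <= m.
Notation n := (size Ts).

Definition vr (v : V) : nat := enum_rank v.

(* [lia] compares terms up to syntax, and elaboration gives two forms of the carrier of [V]. *)
Ltac vlia := change (Equality.sort (fintype_Finite__to__eqtype_Equality V)) with (Finite.sort V) in *; lia.

Lemma vcodeE v : vcode v = Posz (vr v). Proof. by []. Qed.

Lemma vr_lt v : vr v < #|V|. Proof. exact: ltn_ord. Qed.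

Lemma vr_neq cb v x : cb + #|V| <= x -> x != cb + vr v.
Proof. by apply: contraTneq => ->; rewrite -ltnNge ltn_add2l vr_lt. Qed.

Lemma vr_inj : injective vr. Proof. by move=> u v /ord_inj /enum_rank_inj. Qed.

Lemma vr_onto i : i < #|V| -> exists v, vr v = i.
Proof. by move=> li; exists (enum_val (Ordinal li)); rewrite /vr enum_valK. Qed.

Definition visited (ids : seq nat) : seq V := flatten [seq map fst (trj Ts i) | i <- ids].

Lemma visits_visited ids v : visits (map (trj Ts) ids) v = count_mem v (visited ids).
Proof.
rewrite /visits /visited big_map; elim: ids => [|i ids IH]; first by rewrite big_nil.
by rewrite big_cons IH /= count_cat count_map.
Qed.

Lemma size_visited ids : all (fun i => i < n) ids -> size (visited ids) <= size ids * m.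
Proof.
elim: ids => //= i ids IH /andP[li aN].
rewrite /visited /= size_cat size_map mulSn leq_add ?le_m //; exact: IH.
Qed.

Definition collected (cb : nat) (vs : seq V) (st : hst R) : Prop :=
  [/\ rg st rVL = Posz (size vs), seg (mm st VLST) 0 (map (@vcode V) vs),
      forall v, mm st CNT (cb + vr v) = Posz (count_mem v vs) &
      forall x, cb + #|V| <= x -> mm st CNT x = 0%R].

(** [rPE] is the last word of the trajectory and [rP] moves in steps of 3 from its first point, so
    the test succeeds exactly once per point. *)
Lemma point_loopP (st : hst R) i cb vs : static Ts h st -> i < n ->
  rg st rP = Posz (posn Ts i + 1) -> rg st rPE = Posz (posn Ts i + 3 * size (trj Ts i)) ->
  rg st rCB = Posz cb -> collected cb vs st ->
  tr dq (While (rP [<=] rPE) point_body) (fun k st' =>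
    collected cb (vs ++ map fst (trj Ts i)) st' /\ k <= 7 * m + 1) st.
Proof.
move=> Hst li HP HPE HCB Hc.
have [x0 _] : exists x0, x0 \in trj Ts i.
  by case: (trj Ts i) (trj_size_gt0 Ts_traj li) => // x T _; exists x; rewrite mem_head.
pose I j (st' : hst R) := rg st' rP = Posz (posn Ts i + 1 + 3 * j) /\
  collected cb (vs ++ map fst (take j (trj Ts i))) st'.
apply: (@tr_for _ _ _ _ I (size (trj Ts i)) 6).
- by split; rewrite ?muln0 ?addn0 // take0 cats0.
- by move=> j st1 lj [H1 _] F; carry F st st1; rewrite /=; lia.
- move=> j st1 lj [H1 [c1 c2 c3 c4]] F; carry F st st1.
  have S1 : static Ts h st1.
    by apply: (static_frame F isT isT) Hst => x lx; case: F => _ F _; rewrite F.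
  have [E1 _ _] := static_point x0 S1 li lj.
  have [v ev] : exists v, v = (nth x0 (trj Ts i) j).1 by eexists.
  rewrite -ev vcodeE in E1.
  rewrite /point_body; sld (posn Ts i + (3 * j).+1); rewrite E1.
  set vs1 := vs ++ _ in c1 c2 c3.
  sst (size vs1); sset; sld (cb + vr v); rewrite c3; sst (cb + vr v); sset.
  split=> //; rewrite /I.
  have -> : vs ++ map fst (take j.+1 (trj Ts i)) = rcons vs1 v.
    by rewrite (take_nth x0) // map_rcons -ev -rcons_cat.
  split=> /=; first by lia.
  split=> /=.
  + by rewrite c1 size_rcons; lia.
  + rewrite map_rcons seg_rcons size_map add0n upd_eq; split=> //.
    by apply: seg_ext c2 => x; rewrite size_map => lx; rewrite upd_neq //; lia.
  + move=> u; rewrite -cats1 count_cat /= addn0.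
    have [->|/eqP ne] := v =P u; first by rewrite upd_eq; lia.
    rewrite upd_neq ?c3 ?addn0 //.
    by rewrite eqn_add2l; apply: contra ne => /eqP/vr_inj->.
  + by move=> x lx; rewrite upd_neq ?c4 // vr_neq.
- move=> k st' [H1 Hc'] F lek; rewrite take_size in Hc'; split=> //.
  by have := le_m li; lia.
Qed.

Lemma collectP (st : hst R) sl ids cb : static Ts h st ->
  rg st rSL = Posz sl -> rg st rSE = Posz (sl + size ids) -> rg st rCB = Posz cb ->
  seg (mm st MAIN) sl (map Posz ids) -> all (fun i => i < n) ids -> 0 < size ids ->
  (forall x, cb <= x -> mm st CNT x = 0%R) ->
  tr dq collect (fun k st' => exists t : tinterval,
    [/\ collected cb (visited ids) st', rg st' rT1 = t.1 /\ rg st' rT2 = t.2,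
        t.1 \in map (@tstart V) (map (trj Ts) ids) /\
          (forall T, T \in map (trj Ts) ids -> (t.1 <= tstart T)%R),
        t.2 \in map (@tend V) (map (trj Ts) ids) /\
          (forall T, T \in map (trj Ts) ids -> (tend T <= t.2)%R) &
        k <= size ids * (7 * m + 15) + 6]) st.
Proof.
move=> Hst HSL HSE HCB g aN s0 cz.
have [[h1 h2 h3 h4] _ _ _] := Hst.
pose i0 := nth 0 ids 0.
have li0 : i0 < n by apply: (allP aN); exact: mem_nth.
have m0 : mm st MAIN sl = Posz i0 by rewrite -(seg_nth g s0) addn0.
rewrite /collect; sset; sld sl; rewrite m0; sld i0; sld (n + i0); sset.
rewrite (static_start Hst li0) (static_end Hst li0); set st0 := HSt _ _ _ _.
pose S := map (trj Ts) ids.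
have i0S : trj Ts i0 \in S by apply: map_f; exact: mem_nth.
pose I j (st' : hst R) := [/\ rg st' rI = Posz (sl + j), collected cb (visited (take j ids)) st',
  rg st' rT1 \in map (@tstart V) S /\
    (forall T, T \in map (trj Ts) (take j ids) -> (rg st' rT1 <= tstart T)%R) &
  rg st' rT2 \in map (@tend V) S /\
    (forall T, T \in map (trj Ts) (take j ids) -> (tend T <= rg st' rT2)%R)].
have [g1 g2 g3] : [/\ rg st0 rN = Posz n, rg st0 rSE = Posz (sl + size ids)
  & rg st0 rCB = Posz cb] by [].
apply: (@tr_for _ _ _ _ I (size ids) (7 * m + 14)).
- rewrite /I take0 /= addn0; split=> //.
  + by split=> //= [v|x lx]; apply: cz; lia.
  + by split=> //=; apply: map_f.
  + by split=> //=; apply: map_f.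
- by move=> j st1 lj [H1 _ _ _] F; carry F st0 st1; rewrite /=; lia.
- move=> j st1 lj [H1 H2 [H3 H4] [H5 H6]] F; carry F st0 st1.
  have S1 : static Ts h st1.
    by apply: (static_frame F isT isT) => [x lx|]; [case: F => _ F _; rewrite F|].
  have [i ei] : exists i, i = nth 0 ids j by eexists.
  have li : i < n by rewrite ei; apply: (allP aN); exact: mem_nth.
  have Ei : mm st1 MAIN (sl + j) = Posz i.
    by case: F => _ F _; rewrite F // ei; exact: seg_nth.
  have [_ _ Epos _] := S1.
  rewrite /collect_body; sld (sl + j); rewrite Ei; sld i; rewrite (static_start S1) //.
  sld (n + i); rewrite (static_end S1) //.
  ss; apply: tr_minto => /=; ss; apply: tr_maxto => /=.
  sld i; rewrite Epos //; sld (posn Ts i); rewrite (static_len S1) //; sset; sset; ss.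
  set st2 := HSt _ _ _ _.
  apply: tr_frame; first apply: (@point_loopP st2 i cb (visited (take j ids))) => //.
  + by rewrite /st2 /=; lia.
  move=> k st3 F3 [c3 lek]; sset; split; first lia.
  have iS : trj Ts i \in S by apply: map_f; rewrite ei; exact: mem_nth.
  have [T1 T2 I3] : [/\ rg st3 rT1 = Num.min (rg st1 rT1) (tstart (trj Ts i)),
     rg st3 rT2 = Num.max (rg st1 rT2) (tend (trj Ts i)) & rg st3 rI = Posz (sl + j)].
    by case: F3 => F3 _ _; rewrite !F3.
  rewrite /I (take_nth 0) // -ei -cats1 map_cat; split=> /=.
  + by lia.
  + by rewrite /visited map_cat flatten_cat /= cats0.
  + rewrite T1; split; first by case: leP => _ //; exact: map_f.
    by move=> T; rewrite mem_cat inE => /orP[/H4|/eqP->]; lia.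
  + rewrite T2; split; first by case: leP => _ //; exact: map_f.
    by move=> T; rewrite mem_cat inE => /orP[/H6|/eqP->]; lia.
- move=> k st' [H1 H2 H3 H4] F lek; rewrite take_size in H2 H3 H4.
  by exists (rg st' rT1, rg st' rT2); split=> //; lia.
Qed.

Definition pivot_words (t : tinterval) (ps : seq V) : seq int :=
  flatten [seq enc_traj [:: (p, t)] | p <- ps].

Lemma size_pivot_words t ps : size (pivot_words t ps) = 4 * size ps.
Proof. by elim: ps => //= p ps IH; rewrite /pivot_words /= -/(pivot_words t ps) IH; lia. Qed.

(** A round either picks a pivot or moves [rPT] past a picked vertex. All vertices before [rPT] are
    picked, so [rPT] never exceeds the number of pivots, and there are at most [2 * minn h #|V|]
    rounds. Each scans the visits once. *)
Lemma choose_pivotsP (st : hst R) cb vs t fo : static Ts h st -> collected cb vs st ->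
  rg st rT1 = t.1 -> rg st rT2 = t.2 -> rg st rFO = Posz fo -> rg st rCB = Posz cb ->
  posn Ts n <= fo ->
  tr dq choose_pivots (fun k st' => exists ps : seq V,
    [/\ [/\ uniq ps, size ps = minn h #|V| &
          forall p q : V, p \in ps -> q \notin ps -> count_mem q vs <= count_mem p vs],
        seg (mm st' MAIN) fo (pivot_words t ps),
        [/\ rg st' rFO = Posz (fo + 4 * size ps), rg st' rCB = Posz (cb + #|V|) &
            forall x, cb + #|V| <= x -> mm st' CNT x = 0%R],
        forall x, x < fo -> mm st' MAIN x = mm st MAIN x &
        k <= (2 * h) * (7 * size vs + 16) + 4]) st.
Proof.
move=> Hst [c1 c2 c3 c4] HT1 HT2 HFO HCB lefo.
have [[h1 h2 h3 h4] _ _ _] := Hst.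
rewrite /choose_pivots; sset; sset; ss; set st0 := HSt _ _ _ _.
pose H := minn h #|V|.
pose A := 7 * size vs + 16.
pose I phi (st' : hst R) := exists ps pt, [/\
  [/\ uniq ps, size ps <= H, forall p q : V, p \in ps -> q \notin ps ->
        count_mem q vs <= count_mem p vs & forall v, vr v < pt -> v \in ps],
  [/\ rg st' rR = Posz (size ps), rg st' rPT = Posz pt, rg st' rFO = Posz (fo + 4 * size ps),
      pt <= size ps & phi = (H - size ps + (H - pt)) * A],
  (forall v, mm st' CNT (cb + vr v) = if v \in ps then Negz 0 else Posz (count_mem v vs)) /\
  (forall x, cb + #|V| <= x -> mm st' CNT x = 0%R),
  seg (mm st' MAIN) fo (pivot_words t ps) &
  forall x, x < fo -> mm st' MAIN x = mm st MAIN x].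
have [g1 g2 g3 g4] : [/\ rg st0 rH = Posz H, rg st0 rCB = Posz cb, rg st0 rVL = Posz (size vs)
  & rg st0 rV = Posz #|V|] by [].
have [g5 g6] : rg st0 rT1 = t.1 /\ rg st0 rT2 = t.2 by [].
apply: (@tr_while _ _ _ _ I ((H + H) * A)).
- exists [::], 0; split=> //; split=> //=; first by lia.
  by rewrite !subn0.
- move=> phi st1 [ps [pt [[u1 u2 u3 u4] [R1 R2 R3 R4 ->] [R5 R6] R7 R8]]] F.
  carry F st0 st1; rewrite /= => gd.
  have ltr : size ps < H by lia.
  (* The pointer is still the code of a vertex, because [pt <= size ps < H <= #|V|]. *)
  have [|v ev] := @vr_onto pt; first by rewrite /H in ltr; lia.
  have E1 : mm st1 CNT (cb + pt) = if v \in ps then Negz 0 else Posz (count_mem v vs).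
    by rewrite -ev R5.
  rewrite /choose_body; sld (cb + pt); rewrite E1.
  sif => g7.
    have vps : v \in ps by move: g7; case: (v \in ps) => //; lia.
    (* Pigeonhole: the [pt.+1] vertices up to the pointer are all among the distinct pivots. *)
    have lt : pt < size ps.
      have sub : {subset iota 0 pt.+1 <= map vr ps}.
        move=> x; rewrite mem_iota /= add0n ltnS leq_eqVlt => /orP[/eqP->|lx].
          by rewrite -ev map_f.
        have [|w ew] := @vr_onto x; first by have := vr_lt v; lia.
        by rewrite -ew map_f // u4 // ew.
      have := uniq_leq_size (iota_uniq 0 pt.+1) sub.
      by rewrite size_iota size_map.
    sset; exists ((H - size ps + (H - pt.+1)) * A).
      have -> : H - pt = (H - pt.+1).+1 by lia.
      by rewrite (addnS (H - size ps)) mulSn /A; lia.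
    exists ps, pt.+1; split=> //=; split=> //; last by lia.
    move=> w; rewrite ltnS leq_eqVlt => /orP[/eqP e|]; last exact: u4.
    by rewrite (vr_inj (etrans e (esym ev))).
  have vps : v \notin ps by move: g7; case: (v \in ps) => //; lia.
  rewrite (negPf vps); do 3!sset; ss; set st2 := HSt _ _ _ _.
  (* The candidate [b] starts as the unpicked vertex under the pointer, so it exists even if no
     unpicked vertex has been visited. *)
  pose J i (st' : hst R) := exists b, [/\ rg st' rI = Posz i, rg st' rBV = Posz (vr b),
    rg st' rBC = Posz (count_mem b vs), b \notin ps &
    forall w, w \in take i vs -> w \notin ps -> count_mem w vs <= count_mem b vs].
  have [k1 k2] : rg st2 rVL = Posz (size vs) /\ rg st2 rCB = Posz cb by [].
  apply: (@tr_for _ _ _ _ J (size vs) 6).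
  + exists v; rewrite /st2 /= take0 R2 ev; split=> //.
  + by move=> i st3 li [b [H1 _ _ _ _]] F3; carry F3 st2 st3; rewrite /=; lia.
  + move=> i st3 li [b [H1 H2 H3 H4 H5]] F3; carry F3 st2 st3.
    have [M5 M6] : mm st3 VLST = mm st VLST /\ mm st3 CNT = mm st1 CNT.
      by case: F F3 => _ F _ [_ F3 _]; rewrite !F3 // /st2 /= F.
    have [w ew] : exists w, w = nth v vs i by eexists.
    have Ew : mm st3 VLST i = Posz (vr w).
      by rewrite M5 -[i]add0n (c2 (Posz 0)) ?size_map // (nth_map v) // -ew.
    have Ec : mm st3 CNT (cb + vr w) = if w \in ps then Negz 0 else Posz (count_mem w vs).
      by rewrite M6 R5.
    rewrite /best_body; sld i; rewrite Ew; sld (cb + vr w); rewrite Ec.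
    have tk x : x \in take i.+1 vs -> x = w \/ x \in take i vs.
      by rewrite (take_nth v) // -ew mem_rcons inE => /orP[/eqP|]; [left|right].
    sif => g8.
      (* A picked vertex has counter -1 and cannot beat the candidate, whose count is
         nonnegative. *)
      have wps : w \notin ps by move: g8; case: (w \in ps) => //; lia.
      move: g8; rewrite (negPf wps) => g8.
      do 3!sset; split=> //; exists w; split=> //=; first by lia.
      move=> x /tk [->//|/H5 H6 xps]; apply: leq_trans (H6 xps) _.
      by move: g8; rewrite H3 -PoszD lez_nat addn1 => /ltnW.
    do 2!sset; split=> //; exists b; split=> //=; first by lia.
    move=> x /tk [->|/H5//] xps.
    by move: g8; rewrite (negPf xps) H3 -PoszD lez_nat addn1 -leqNgt.
  + move=> k3 st3 [b [H1 H2 H3 H4 H5]] F3 lek3; rewrite take_size in H5.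
    have [X1 X2 X3] : [/\ rg st2 rFO = Posz (fo + 4 * size ps), rg st2 rT1 = t.1 &
      rg st2 rT2 = t.2] by [].
    have [X4 X5] : rg st2 rR = Posz (size ps) /\ rg st2 rPT = Posz pt by [].
    carry F3 st2 st3.
    have [M5 M6] : mm st3 MAIN = mm st1 MAIN /\ mm st3 CNT = mm st1 CNT.
      by case: F3 => _ F3 _; rewrite !F3.
    have [fo1 efo1] : exists x, x = fo + 4 * size ps by eexists.
    rewrite -efo1 in C0 C1 C2 C3 C4 C5 C6 C7 C8 C9.
    sst (cb + vr b); sst fo1; sst (fo1 + 1); sst (fo1 + 2); sst (fo1 + 3); sset; sset.
    exists ((H - (size ps).+1 + (H - pt)) * A).
      have -> : H - size ps = (H - (size ps).+1).+1 by vlia.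
      by rewrite (addSn (H - (size ps).+1)) mulSn /A; vlia.
    have pw : pivot_words t (rcons ps b) = pivot_words t ps ++ [:: Posz 1; vcode b; t.1; t.2].
      by rewrite /pivot_words map_rcons flatten_rcons.
    exists (rcons ps b), pt; split.
    * split.
      - by rewrite rcons_uniq H4.
      - by rewrite size_rcons.
      - move=> p q; rewrite !mem_rcons !inE negb_or => /orP[/eqP->|pps] /andP[qb qps]; last exact: u3.
        (* A vertex that the scan does not meet has count 0. *)
        case: (boolP (q \in vs)) => [qvs|/count_memPn->//]; exact: H5.
      - by move=> w /u4; rewrite mem_rcons inE orbC => ->.
    * by rewrite !size_rcons; split=> //=; vlia.
    * split=> [w|x lx] /=; rewrite M6.
        rewrite mem_rcons inE; have [->|/eqP ne] := w =P b; first by rewrite upd_eq.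
        by rewrite upd_neq ?R5 // eqn_add2l; apply: contra ne => /eqP/vr_inj->.
      by rewrite upd_neq ?R6 // vr_neq.
    * rewrite pw seg_cat size_pivot_words -efo1 /= M5; split.
        apply: seg_ext R7 => x; rewrite size_pivot_words => lx.
        by rewrite !upd_neq //; vlia.
      rewrite vcodeE !seg_cons /upd.
      do 4!(split; first by do ?[case: eqP => ?]; vlia); exact: seg_nil.
    * by move=> x lx /=; rewrite M5 !upd_neq ?R8 //; vlia.
- move=> phi k st1 [ps [pt [[u1 u2 u3 u4] [R1 R2 R3 R4 ->] [R5 R6] R7 R8]]] F gd lek.
  carry F st0 st1; rewrite /= in gd; sset.
  have es : size ps = H by vlia.
  exists ps; split=> //; first by split=> //=; vlia.
  have : H + H <= 2 * h by rewrite /H; vlia.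
  move=> leH; apply: (@leq_trans ((H + H) * A + 4)); last by rewrite leq_add2r leq_mul2r leH orbT.
  by have lek' := leq_trans (leq_addr _ _) lek; lia.
Qed.

End Pivots.

(** * The table of distances to the pivots *)

Section Distances.
Variables (V : finType) (R : realType) (G : wgraph R V).
Variables (Ts : seq (traj V)) (h : nat).
Hypothesis Ts_traj : forall T, T \in Ts -> is_traj T.
Variable m : nat.
Hypothesis le_m : forall i, i < size Ts -> size (trj Ts i) <= m.
Notation n := (size Ts).
Notation dq := (dist_oracle G).

Lemma dist_oracle_vcode u v : dq (vcode u) (vcode v) = gdist G u v.
Proof.
rewrite /dist_oracle; case: pickP => [u' /eqP [] /ord_inj/enum_rank_inj->|/(_ u)]; last by rewrite eqxx.
by case: pickP => [v' /eqP [] /ord_inj/enum_rank_inj->|/(_ v)]; last by rewrite eqxx.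
Qed.

Definition dist_sum (p : V) (T : traj V) : R :=
  (\sum_(y <- T) (y.2.2 - y.2.1)%:~R * expR (- gdist G p y.1))%R.

Lemma ilen_icap (t s : tinterval) : (t.1 <= s.1)%R -> (s.1 < s.2)%R -> (s.2 <= t.2)%R ->
  ilen (icap (icap t t) s) = (s.2 - s.1)%R.
Proof. by case: t s => [a b] [c d] /= *; rewrite /ilen /icap /=; lia. Qed.

(** Every interval of [T] lies inside [t], so each intersection in [Sim] is the interval of [T]
    itself, and the double sum reduces to one term per point. *)
Lemma Dist_pivot (p : V) (T : traj V) (t : tinterval) : is_traj T ->
  (t.1 <= tstart T)%R -> (tend T <= t.2)%R ->
  Dist G T [:: (p, t)] t = (1 - dist_sum p T / (t.2 - t.1)%:~R)%R.
Proof.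
move=> HT t1 t2; rewrite /Dist /Sim big_seq1 mulrC.
have lt := tstart_lt_tend HT.
have -> : ilen t = (t.2 - t.1)%R by rewrite /ilen; lia.
congr (1 - _ * _)%R; rewrite /dist_sum [LHS]big_seq [RHS]big_seq; apply: eq_bigr => y yT.
have [h1 h2 h3] := traj_within HT yT.
by rewrite ilen_icap //; [exact: le_trans h1|exact: le_trans h3 _].
Qed.

Lemma term_loopP (st : hst R) i p : static Ts h st -> i < n ->
  rg st rP = Posz (posn Ts i + 1) -> rg st rPE = Posz (posn Ts i + 3 * size (trj Ts i)) ->
  rg st rY = vcode p -> acc st = 0%R ->
  tr dq (While (rP [<=] rPE) term_body) (fun k st' =>
    acc st' = dist_sum p (trj Ts i) /\ k <= 6 * m + 1) st.
Proof.
move=> Hst li HP HPE HY HA.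
have [x0 _] : exists x0, x0 \in trj Ts i.
  by case: (trj Ts i) (trj_size_gt0 Ts_traj li) => // x T _; exists x; rewrite mem_head.
pose I j (st' : hst R) := rg st' rP = Posz (posn Ts i + 1 + 3 * j) /\
  acc st' = dist_sum p (take j (trj Ts i)).
apply: (@tr_for _ _ _ _ I (size (trj Ts i)) 5).
- by split; rewrite ?muln0 ?addn0 // take0 /dist_sum big_nil.
- by move=> j st1 lj [H1 _] F; carry F st st1; rewrite /=; lia.
- move=> j st1 lj [H1 H2] F; carry F st st1.
  have S1 : static Ts h st1.
    by apply: (static_frame F isT isT) Hst => x lx; case: F => _ F _; rewrite F.
  have [E1 E2 E3] := static_point x0 S1 li lj.
  rewrite /term_body; sld (posn Ts i + (3 * j).+1); sld (posn Ts i + (3 * j).+2).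
  sld (posn Ts i + (3 * j).+3); rewrite E1 E2 E3.
  ss; apply: tr_add => /=; sset; split=> //; split=> /=; first by lia.
  rewrite C dist_oracle_vcode H2 (take_nth x0) // /dist_sum -cats1 big_cat /= big_seq1.
  by [].
- by move=> k st' [_ H2] F lek; rewrite take_size in H2; split=> //; have := le_m li; lia.
Qed.

Lemma pivot_loopP (st : hst R) i se t ps q : static Ts h st -> i < n ->
  rg st rE = Posz i -> rg st rJ = Posz se -> rg st rFO = Posz (se + 4 * size ps) ->
  rg st rQF = Posz q -> rg st rT1 = t.1 -> rg st rT2 = t.2 ->
  seg (mm st MAIN) se (pivot_words t ps) ->
  (t.1 <= tstart (trj Ts i))%R -> (tend (trj Ts i) <= t.2)%R ->
  tr dq (While (rJ [<] rFO) pivot_body) (fun k st' =>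
    [/\ seg (rm st') q [seq Dist G (trj Ts i) [:: (p, t)] t | p <- ps],
        rg st' rQF = Posz (q + size ps),
        forall x, x < q -> rm st' x = rm st x &
        k <= size ps * (6 * m + 14) + 1]) st.
Proof.
move=> Hst li HE HJ HFO HQ HT1 HT2 g le1 le2.
pose I j (st' : hst R) := [/\ rg st' rJ = Posz (se + 4 * j), rg st' rQF = Posz (q + j),
  seg (rm st') q [seq Dist G (trj Ts i) [:: (p, t)] t | p <- take j ps] &
  forall x, x < q -> rm st' x = rm st x].
apply: (@tr_for _ _ _ _ I (size ps) (6 * m + 13)).
- by split; rewrite ?muln0 ?addn0 // take0.
- by move=> j st1 lj [H1 _ _ _] F; carry F st st1; rewrite /=; lia.
- move=> j st1 lj [H1 H2 H3 H4] F; carry F st st1.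
  have S1 : static Ts h st1.
    by apply: (static_frame F isT isT) Hst => x lx; case: F => _ F _; rewrite F.
  have [p0 _] : exists p0, p0 \in ps by case: (ps) lj => // x T _; exists x; rewrite mem_head.
  have [p ep] : exists p, p = nth p0 ps j by eexists.
  have takeS : take j.+1 ps = rcons (take j ps) p by rewrite (take_nth p0) // -ep.
  have Ep : mm st1 MAIN (se + 4 * j + 1) = vcode p.
    have -> : mm st1 MAIN = mm st MAIN by case: F => _ F _; rewrite F.
    move: g; rewrite -[X in pivot_words t X](cat_take_drop j) (drop_nth p0) // -ep.
    rewrite /pivot_words map_cat flatten_cat seg_cat -/(pivot_words _ _) size_pivot_words.
    by rewrite size_take lj /= !seg_cons => -[_ [_ [<- _]]]; congr (mm st 0 _); lia.
  have [_ _ Epos _] := S1.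
  rewrite /pivot_body; sld (se + 4 * j + 1); sld i; rewrite Epos //; sld (posn Ts i).
  rewrite (static_len S1) // Ep; sset; sset; ss; apply: tr_zero => /=; ss.
  set st2 := HSt _ _ _ _.
  apply: tr_frame; first apply: (@term_loopP st2 i p) => //.
  + by rewrite /st2 /=; lia.
  move=> k st3 F3 [A3 lek]; ss.
  have [X1 X2 X3] : [/\ rg st2 rQF = Posz (q + j), rg st2 rT1 = t.1 & rg st2 rT2 = t.2] by [].
  have X4 : rg st2 rJ = Posz (se + 4 * j) by [].
  have R3 : rm st3 = rm st1 by case: F3 => _ _ F3; rewrite F3.
  carry F3 st2 st3.
  apply: (@tr_out _ _ (q + j)) => //=; sset; sset; split; first lia.
  split=> /=; [lia|lia| |].
  + rewrite takeS map_rcons seg_rcons size_map size_take lj; split.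
      apply: seg_ext H3 => x; rewrite size_map size_take lj => lx.
      by rewrite upd_neq ?R3 //; lia.
    by rewrite upd_eq A3 Dist_pivot ?C5 ?C6 //; [congr (1 - _ / (_)%:~R)%R; lia|exact: trj_traj].
  + by move=> x lx; rewrite upd_neq ?R3 ?H4 //; lia.
- by move=> k st' [H1 H2 H3 H4] F lek; rewrite take_size in H3; split=> //; lia.
Qed.

Lemma dist_tableP (st : hst R) sl ids t ps q : static Ts h st ->
  rg st rSL = Posz sl -> rg st rSE = Posz (sl + size ids) ->
  rg st rFO = Posz (sl + size ids + 4 * size ps) ->
  rg st rQF = Posz q -> rg st rT1 = t.1 -> rg st rT2 = t.2 ->
  seg (mm st MAIN) sl (map Posz ids) -> all (fun i => i < n) ids ->
  seg (mm st MAIN) (sl + size ids) (pivot_words t ps) ->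
  (forall T, T \in map (trj Ts) ids -> (t.1 <= tstart T)%R) ->
  (forall T, T \in map (trj Ts) ids -> (tend T <= t.2)%R) ->
  tr dq dist_table (fun k st' => exists q', q <= q' /\
    [/\ seg (rm st') q (flatten [seq [seq Dist G T [:: (p, t)] t | p <- ps] | T <- map (trj Ts) ids]),
        q' = q + size ids * size ps,
        rg st' rQF = Posz q',
        forall x, x < q -> rm st' x = rm st x &
        k <= size ids * (size ps * (6 * m + 14) + 5) + 2]) st.
Proof.
move=> Hst HSL HSE HFO HQ HT1 HT2 g aN gp le1 le2; rewrite /dist_table; sset.
set st0 := HSt _ _ _ _.
have [X1 X2 X3] : [/\ rg st0 rSE = Posz (sl + size ids),
  rg st0 rFO = Posz (sl + size ids + 4 * size ps) & rg st0 rT1 = t.1] by [].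
have X4 : rg st0 rT2 = t.2 by [].
pose D i := [seq Dist G (trj Ts i) [:: (p, t)] t | p <- ps].
have sD s : size (flatten (map D s)) = size s * size ps.
  by elim: s => //= i s IH; rewrite size_cat IH size_map mulSn.
pose I j (st' : hst R) := [/\ rg st' rI = Posz (sl + j), rg st' rQF = Posz (q + j * size ps),
  seg (rm st') q (flatten (map D (take j ids))) &
  forall x, x < q -> rm st' x = rm st x].
apply: (@tr_for _ _ _ _ I (size ids) (size ps * (6 * m + 14) + 4)).
- by rewrite /I take0 mul0n !addn0; split.
- by move=> j st1 lj [H1 _ _ _] F; carry F st0 st1; rewrite /=; lia.
- move=> j st1 lj [H1 H2 H3 H4] F; carry F st0 st1.
  have S1 : static Ts h st1.
    by apply: (static_frame F isT isT) => [x lx|]; [case: F => _ F _; rewrite F|].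
  have M1 : mm st1 MAIN = mm st MAIN by case: F => _ F _; rewrite F.
  have [i ei] : exists i, i = nth 0 ids j by eexists.
  have li : i < n by rewrite ei; apply: (allP aN); exact: mem_nth.
  have iS : trj Ts i \in map (trj Ts) ids by apply: map_f; rewrite ei; exact: mem_nth.
  have Ei : mm st1 MAIN (sl + j) = Posz i by rewrite M1 ei; exact: seg_nth.
  rewrite /dist_body; sld (sl + j); rewrite Ei; sset; ss; set st2 := HSt _ _ _ _.
  apply: tr_frame; first apply: (@pivot_loopP st2 i (sl + size ids) t ps (q + j * size ps)) => //.
  + by rewrite /st2 /= M1.
  + exact: le1.
  + exact: le2.
  move=> k st3 F3 [g3 q3 a3 lek].
  have I3 : rg st2 rI = Posz (sl + j) by [].
  carry F3 st2 st3.
  sset; split; first lia.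
  split=> /=; first by lia.
  + by rewrite q3 mulSn; lia.
  + rewrite (take_nth 0) // -ei map_rcons flatten_rcons seg_cat sD size_take lj; split=> //.
    by apply: seg_ext H3 => x; rewrite sD size_take lj => lx; rewrite a3 //; lia.
  + by move=> x lx; rewrite a3 ?H4 //; lia.
- move=> k st' [H1 H2 H3 H4] F lek; rewrite take_size in H3.
  exists (q + size ids * size ps); split; first exact: leq_addr.
  split=> //; first by rewrite -map_comp.
  by move: lek; rewrite -addnS; lia.
Qed.

End Distances.

(** * Processing one node *)

(** The summands are the filter pass, the collection of visits, the choice of pivots, the table and
    the single assignments. All factors are positive, so every monomial is at most [s * (h * m)],
    and 200 exceeds the sum of the coefficients. *)
Lemma build_filter_time (s h m a v p : nat) : 0 < s -> 0 < h -> 0 < m ->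
  a <= s -> v <= a * m -> p <= h ->
  (24 * s + 4) + (a * (7 * m + 15) + 6) + (2 * h * (7 * v + 16) + 4)
    + (a * (p * (6 * m + 14) + 5) + 2) + 9 <= 200 * (s * (h * m)).
Proof.
move=> s0 h0 m0 las lv lp.
have lv' : v <= s * m by apply: leq_trans lv _; rewrite leq_mul2r las orbT.
have b1 : a * (7 * m + 15) <= s * (7 * m + 15) by rewrite leq_mul2r las orbT.
have b2 : 2 * h * (7 * v + 16) <= 2 * h * (7 * (s * m) + 16) by rewrite leq_mul2l; lia.
have b3 : a * (p * (6 * m + 14) + 5) <= s * (h * (6 * m + 14) + 5).
  by rewrite leq_mul // leq_add2r leq_mul2r lp orbT.
have [x1 x2] : s <= s * m /\ h <= h * m by rewrite !leq_pmulr.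
have [x3 x4] : s * m <= s * (h * m) /\ h * m <= s * (h * m).
  by rewrite leq_pmull // leq_pmul2l // leq_pmull.
have x5 : s * h <= s * (h * m) by rewrite leq_pmul2l // leq_pmulr.
nia.
Qed.

Section Node.
Variables (V : finType) (R : realType) (G : wgraph R V).
Variables (Ts : seq (traj V)) (h : nat).
Hypothesis Ts_uniq : uniq Ts.
Hypothesis Ts_traj : forall T, T \in Ts -> is_traj T.
Hypothesis h_gt0 : 0 < h.
Variable m : nat.
Hypothesis m_gt0 : 0 < m.
Hypothesis le_m : forall i, i < size Ts -> size (trj Ts i) <= m.
Notation n := (size Ts).
Notation dq := (dist_oracle G).
Notation stj := (map (trj Ts)).

(* The words that [leaf_words] and [node_words] have in common. *)
Definition filter_words (S : seq (traj V)) (F : pivfilter R V) (q : int) : seq int :=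
  [:: Posz (size S); Posz (size (ptrajs F)); q]
  ++ [seq Posz (index T Ts) | T <- S] ++ flatten (map (@enc_traj V) (ptrajs F)).

Lemma index_trj ids : all (fun i => i < n) ids ->
  [seq Posz (index T Ts) | T <- stj ids] = map Posz ids.
Proof.
move=> /allP aN; rewrite -map_comp; apply/eq_in_map => i /aN li /=.
by rewrite index_uniq.
Qed.

Record dyn (st : hst R) (sp fo ef q cb : nat) : Prop := Dyn {
  dyn_static : static Ts h st;
  dyn_sp : rg st rSP = Posz sp;
  dyn_fo : rg st rFO = Posz fo;
  dyn_ef : rg st rEF = Posz ef;
  dyn_q : rg st rQF = Posz q;
  dyn_cb : rg st rCB = Posz cb;
  dyn_cnt : forall x, cb <= x -> mm st CNT x = 0%R;
  dyn_le : posn Ts n <= fo }.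

(** Leaves and inner nodes share this lemma. They differ in the predicate [P] computed by [stays]
    and in the length of the header in front of [hp]. *)
Lemma build_filterP (st : hst R) sp fo ef q cb lo s hp ev (P : pred nat) :
  dyn st sp fo ef q cb -> 0 < s ->
  rg st rLO = Posz lo -> rg st rS = Posz s -> rg st rHP = Posz hp -> fo <= hp ->
  size ev = s + s -> all (fun e => e < n + n) ev -> seg (mm st EV) lo (map Posz ev) ->
  (forall (st' : hst R) e, e < n + n -> rg st' rN = Posz n -> rg st' rMU = rg st rMU ->
     rg st' rLF = rg st rLF -> rg st' rE = Posz e -> rg st' rA = tstart (trj Ts (tid Ts e)) ->
     rg st' rB = tend (trj Ts (tid Ts e)) -> gval (rg st') stays = P e) ->
  (forall e, P e -> e < n) -> 0 < size (seq.filter P ev) <= s ->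
  tr dq build_filter (fun k st' => exists F fo' q' cb',
    let S := stj (seq.filter P ev) in
    [/\ is_pivfilter G h S F, dyn st' sp fo' ef q' cb',
        fo' = hp + size (filter_words S F q) /\ seg (mm st' MAIN) hp (filter_words S F q),
        q' = q + size (flatten (pdists F)) /\ seg (rm st') q (flatten (pdists F)) &
        [/\ forall x, x < hp -> mm st' MAIN x = mm st MAIN x,
            forall x, x < q -> rm st' x = rm st x &
            k <= 200 * (s * (h * m))]]) st.
Proof.
move=> D s0 HLO HS HHP lehp sz aN g cP Pn /andP[ids0 leids].
have Hst := dyn_static D; have [[h1 h2 h3 h4] _ _ _] := Hst.
have lefo := dyn_le D.
rewrite /build_filter; sset; sset; ss; set st0 := HSt _ _ _ _.
set ids := seq.filter P ev in ids0 leids *.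
have aI : all (fun i => i < n) ids by apply/allP => i; rewrite mem_filter => /andP[/Pn].
apply: tr_frame; first apply: (@filter_eventsP _ Ts h _ _ stays MAIN P st0 lo s (hp + 3) ev) => //.
  by rewrite /st0 /=; lia.
move=> k1 st1 F1 [g1 O1 C1 a1 lek1]; rewrite -/ids in g1 O1.
(* [rC] counts the starts among the accepted events. As [P] accepts starts only, this is the size of
   the stored set. *)
have cC : count (fun e => P e && (e < n)) ev = size ids.
  rewrite size_filter; apply: eq_count => e /=.
  by case Pe : (P e) => //=; rewrite Pn.
rewrite cC in C1 => {cC}.
have [X1 X2 X3] : [/\ rg st0 rSL = Posz (hp + 3), rg st0 rHP = Posz hp & rg st0 rH = Posz (minn h #|V|)].
  by rewrite /st0 /=; split=> //; lia.
have [X4 X5 X6] : [/\ rg st0 rQF = Posz q, rg st0 rCB = Posz cb & rg st0 rSP = Posz sp].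
  by case: (D) => *; split.
have X7 : rg st0 rEF = Posz ef by case: (D).
have S1 : static Ts h st1.
  by apply: (static_frame F1 isT isT) => [x lx|//]; rewrite a1 //; lia.
have N1 : rg st1 rN = Posz n by case: S1 => -[].
have Z1 x : cb <= x -> mm st1 CNT x = 0%R.
  by move=> lx; case: F1 => _ F1 _; rewrite F1 //; exact: (dyn_cnt D).
have RM1 : rm st1 = rm st by case: F1 => _ _ F1; rewrite F1.
carry F1 st0 st1.
sset; sset; sst hp; sst (hp + 1); sst (hp + 2); ss; set st2 := HSt _ _ _ _.
pose se := hp + 3 + size ids.
have M2 x : x < hp \/ hp + 3 <= x -> mm st2 MAIN x = mm st1 MAIN x.
  by move=> lx; rewrite /st2 /= !upd_neq //; lia.
have [Y1 Y2 Y3] : [/\ rg st2 rSL = Posz (hp + 3), rg st2 rSE = Posz se & rg st2 rFO = Posz se] by [].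
have [Y4 Y5 Y6] : [/\ rg st2 rQF = Posz q, rg st2 rCB = Posz cb & rg st2 rSP = Posz sp] by [].
have Y7 : rg st2 rEF = Posz ef by [].
have S2 : static Ts h st2.
  case: S1 => u1 u2 u3 u4; split=> // k lk.
  by rewrite M2 ?u2 //; left; lia.
have g2 : seg (mm st2 MAIN) (hp + 3) (map Posz ids).
  by apply: seg_ext g1 => x lx; apply: M2; lia.
have gh2 : seg (mm st2 MAIN) hp [:: Posz (size ids); Posz (minn h #|V|); Posz q].
  rewrite !seg_cons /st2 /= /upd.
  do 3!(split; first by do ?[case: eqP => ?]; first [done|lia]); exact: seg_nil.
apply: tr_frame.
  by apply: (@collectP _ Ts h _ dq Ts_traj m le_m st2 (hp + 3) ids cb).
move=> k3 st3 F3 [t [c3 [T1 T2] t1 t2 lek3]]; ss.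
have M3 : mm st3 MAIN = mm st2 MAIN by case: F3 => _ F3 _; rewrite F3.
have RM3 : rm st3 = rm st by case: F3 => _ _ F3; rewrite F3.
carry F3 st2 st3.
have S3 : static Ts h st3.
  by apply: (static_frame F3 isT isT) S2 => x lx; rewrite M3.
apply: tr_frame.
  apply: (@choose_pivotsP _ Ts h _ dq st3 cb (visited Ts ids) t se) => //.
  by rewrite /se; lia.
move=> k4 st4 F4 [ps [[u1 u2 u3] g4 [FO4 CB4 Z4] a4 lek4]]; ss.
have RM4 : rm st4 = rm st by case: F4 => _ _ F4; rewrite F4.
carry F4 st3 st4.
have S4 : static Ts h st4.
  by apply: (static_frame F4 isT isT) S3 => x lx; rewrite a4 // /se; lia.
have g4i : seg (mm st4 MAIN) (hp + 3) (map Posz ids).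
  by apply: seg_ext g2 => x; rewrite size_map => lx; rewrite a4 ?M3 // /se; lia.
have gh4 : seg (mm st4 MAIN) hp [:: Posz (size ids); Posz (minn h #|V|); Posz q].
  by apply: seg_ext gh2 => x /= lx; rewrite a4 ?M3 // /se; lia.
apply: tr_frame.
  apply: (@dist_tableP _ _ G Ts h Ts_traj m le_m st4 (hp + 3) ids t ps q) => //.
  - by case: t1.
  - by case: t2.
move=> k5 st5 F5 [q' [leq' [g5 eq' Q5 a5 lek5]]].
have M5 : mm st5 MAIN = mm st4 MAIN by case: F5 => _ F5 _; rewrite F5.
pose F := PivFilter [seq [:: (p, t)] | p <- ps]
  [seq [seq Dist G T P t | P <- [seq [:: (p, t)] | p <- ps]] | T <- stj ids].
have pdE : flatten (pdists F) = flatten [seq [seq Dist G T [:: (p, t)] t | p <- ps] | T <- stj ids].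
  by rewrite /F /=; congr flatten; apply: eq_map => T; rewrite -map_comp.
have spd : size (flatten (pdists F)) = size ids * size ps.
  rewrite pdE; elim: (ids) => //= i l IH; by rewrite size_cat IH size_map mulSn.
exists F, (se + 4 * size ps), q', (cb + #|V|).
have fwE : filter_words (stj ids) F q =
    [:: Posz (size ids); Posz (minn h #|V|); Posz q] ++ map Posz ids ++ pivot_words t ps.
  rewrite /filter_words index_trj // size_map /F /= size_map u2.
  by rewrite /pivot_words -map_comp.
have szfw : size (filter_words (stj ids) F q) = 3 + size ids + 4 * size ps.
  by rewrite fwE /= !size_cat size_map size_pivot_words /=; lia.
split.
- exists ps, t; split=> //; split=> // p q0 pps qps.
  by rewrite !visits_visited; exact: u3.
- carry F5 st4 st5; split=> //.
  + by apply: (static_frame F5 isT isT) S4 => x lx; rewrite M5.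
  + by move=> x lx; case: F5 => _ F5 _; rewrite F5 // Z4.
  + by rewrite /se; lia.
- split; first by rewrite -[X in _ = _ + X]/(size (filter_words (stj ids) F q)) szfw /se; lia.
  by rewrite fwE M5 !seg_cat size_map.
- by rewrite spd pdE.
- split.
  + by move=> x lx; rewrite M5 a4 ?M3 ?M2 ?a1 //; rewrite /se; lia.
  + by move=> x lx; rewrite a5 ?RM4.
  + have sv := size_visited le_m aI; have lps : size ps <= h by rewrite u2 geq_minl.
    have := build_filter_time s0 h_gt0 m_gt0 leids sv lps; lia.
Qed.

End Node.

(** * Medians and the split at a node *)

Lemma is_median_perm mu s s' : perm_eq s s' -> is_median mu s -> is_median mu s'.
Proof.
move=> pe [h1 h2 h3]; split; first by rewrite -(perm_mem pe).
  by rewrite -(perm_size pe) -(permP pe).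
by rewrite -(perm_size pe) -(permP pe).
Qed.

(** No entry from index [s] on is below entry [s], and no entry up to index [s] is above it, which
    leaves at most [s] of the [2s] entries on either side. *)
Lemma sorted_median (xs : seq int) s : sorted <=%R xs -> size xs = s + s -> 0 < s ->
  is_median (nth (Posz 0) xs s) xs.
Proof.
move=> so sz s0; set mu := nth _ _ _.
have le_nth i j : i <= j -> j < size xs -> (nth (Posz 0) xs i <= nth (Posz 0) xs j)%R.
  move=> ij jx; apply: (sorted_leq_nth le_trans le_refl) => //.
  by rewrite inE; apply: leq_ltn_trans jx.
have c1 : count (fun x => x < mu)%R (drop s xs) = 0.
  apply/eqP; rewrite -leqn0 leqNgt -has_count; apply/negP => /hasP[x /(nthP (Posz 0))[i]].
  by rewrite size_drop nth_drop => li <-; rewrite ltNge le_nth ?leq_addr // -ltn_subRL.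
have c2 : count (fun x => mu < x)%R (take s.+1 xs) = 0.
  apply/eqP; rewrite -leqn0 leqNgt -has_count; apply/negP => /hasP[x /(nthP (Posz 0))[i]].
  rewrite size_take => li; rewrite nth_take; last by move: li; case: ifP; lia.
  by move=> <-; rewrite ltNge le_nth //; move: li; case: ifP; lia.
split; first by apply: mem_nth; rewrite sz; lia.
  rewrite -[in count _ _](cat_take_drop s xs) count_cat c1 addn0 sz.
  have := count_size (fun x => x < mu)%R (take s xs); rewrite size_take sz; case: ifP; lia.
rewrite -[in count _ _](cat_take_drop s.+1 xs) count_cat c2 add0n sz.
have := count_size (fun x => mu < x)%R (drop s.+1 xs); rewrite size_drop sz; lia.
Qed.

Lemma double_le (a b c s : nat) : 2 * (a + b) <= s + s -> c <= a -> c <= b -> 2 * c <= s.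
Proof. lia. Qed.

Section Split.
Variables (V : finType) (S : seq (traj V)) (mu : int).
Hypothesis S_traj : forall T, T \in S -> is_traj T.
Hypothesis med : is_median mu (endpoints S).

Lemma left_half : 2 * size [seq T <- S | (tend T < mu)%R] <= size S.
Proof.
case: med => _ + _; rewrite /endpoints count_cat size_cat !count_map !size_map size_filter => le.
have : count (fun T => tend T < mu)%R S <= count (preim (@tstart V) (fun x => x < mu)%R) S.
  rewrite -!sum1_count 2!big_mkcond [leqRHS]big_mkcond big_seq [leqRHS]big_seq.
  apply: leq_sum => T TS; case: ifP => //= lt.
  by rewrite (lt_trans (tstart_lt_tend (S_traj TS)) lt).
by move=> le2; apply: (double_le le le2).
Qed.

Lemma right_half : 2 * size [seq T <- S | (mu < tstart T)%R] <= size S.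
Proof.
case: med => _ _; rewrite /endpoints count_cat size_cat !count_map !size_map size_filter => le.
have : count (fun T => mu < tstart T)%R S <= count (preim (@tend V) (fun x => mu < x)%R) S.
  rewrite -!sum1_count 2!big_mkcond [leqRHS]big_mkcond big_seq [leqRHS]big_seq.
  apply: leq_sum => T TS; case: ifP => //= lt.
  by rewrite (lt_trans lt (tstart_lt_tend (S_traj TS))).
by move=> le2; apply: (double_le le _ le2).
Qed.

Lemma stay_nonempty : 0 < size [seq T <- S | (tstart T <= mu)%R && (mu <= tend T)%R].
Proof.
case: med => + _ _; rewrite /endpoints mem_cat size_filter -has_count.
case/orP => /mapP[T TS e]; apply/hasP; exists T => //.
  by rewrite -e lexx e; exact/ltW/tstart_lt_tend/S_traj.
by rewrite -e lexx e andbT; exact/ltW/tstart_lt_tend/S_traj.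
Qed.

(** The three classes are disjoint because a trajectory starts before it ends. This is what lets
    every node charge its cells to its own stored set. *)
Lemma split_size : size [seq T <- S | (tend T < mu)%R] + size [seq T <- S | (mu < tstart T)%R]
  + size [seq T <- S | (tstart T <= mu)%R && (mu <= tend T)%R] = size S.
Proof.
rewrite !size_filter; elim: S S_traj => //= T S' IH H.
have lt := tstart_lt_tend (H T (mem_head _ _)).
rewrite -IH => [|T' T'S]; last by apply: H; rewrite inE T'S orbT.
case: (ltP (tend T) mu) => l1; case: (ltP mu (tstart T)) => l2 /=; lia.
Qed.

End Split.

(** * The events of a set of trajectories *)

Section Events.
Variables (V : finType) (Ts : seq (traj V)).
Notation n := (size Ts).
Notation stj := (map (trj Ts)).

Definition events (J : seq nat) : seq nat := J ++ map (addn n) J.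

Lemma tid_lt i : i < n -> tid Ts i = i. Proof. by rewrite /tid => ->. Qed.

Lemma tid_ge i : tid Ts (n + i) = i.
Proof. by rewrite /tid ltnNge leq_addr /= addKn. Qed.

Lemma size_events ev J : perm_eq ev (events J) -> size ev = size J + size J.
Proof. by move=> /perm_size->; rewrite size_cat size_map. Qed.

Lemma events_lt ev J : perm_eq ev (events J) -> all (fun i => i < n) J ->
  all (fun e => e < n + n) ev.
Proof.
move=> pe /allP aJ; rewrite (perm_all _ pe) all_cat all_map; apply/andP; split; apply/allP => i /aJ /=; lia.
Qed.

Lemma filter_events_perm ev J (Q : pred nat) : perm_eq ev (events J) -> all (fun i => i < n) J ->
  perm_eq (seq.filter (fun e => Q (tid Ts e)) ev) (events (seq.filter Q J)).
Proof.
move=> pe /allP aJ; apply: perm_trans (perm_filter _ pe) _.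
rewrite /events seq.filter_cat filter_map.
rewrite (_ : seq.filter (preim _ _) J = seq.filter Q J); last first.
  by apply: eq_filter => i /=; rewrite tid_ge.
rewrite (_ : seq.filter (fun e => Q (tid Ts e)) J = seq.filter Q J); first exact: perm_refl.
by apply: eq_in_filter => i /aJ li; rewrite tid_lt.
Qed.

Lemma filter_starts_perm ev J (Q : pred nat) : perm_eq ev (events J) -> all (fun i => i < n) J ->
  perm_eq (seq.filter (fun e => (e < n) && Q (tid Ts e)) ev) (seq.filter Q J).
Proof.
move=> pe /allP aJ; apply: perm_trans (perm_filter _ pe) _.
rewrite /events seq.filter_cat filter_map.
have -> : seq.filter (preim (addn n) (fun e => (e < n) && Q (tid Ts e))) J = [::].
  by rewrite -[RHS](filter_pred0 J); apply: eq_filter => i /=; rewrite ltnNge leq_addr.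
rewrite cats0 (_ : seq.filter _ J = seq.filter Q J); first exact: perm_refl.
by apply: eq_in_filter => i /aJ li; rewrite tid_lt // li.
Qed.

Lemma endpoints_events J : all (fun i => i < n) J ->
  endpoints (stj J) = map (tim Ts) (events J).
Proof.
move=> /allP aJ; rewrite /endpoints /events map_cat -!map_comp; congr (_ ++ _).
  by apply/eq_in_map => i /aJ li /=; rewrite /tim li.
by apply/eq_in_map => i /aJ li /=; rewrite /tim ltnNge leq_addr /= addKn.
Qed.

Lemma events_median ev J : perm_eq ev (events J) -> all (fun i => i < n) J ->
  sorted (tle (tim Ts)) ev -> 0 < size J ->
  is_median (tim Ts (nth 0 ev (size J))) (endpoints (stj J)).
Proof.
move=> pe aJ so J0; rewrite endpoints_events //.
apply: (is_median_perm (perm_map _ pe)).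
have sz := size_events pe.
have := @sorted_median (map (tim Ts) ev) (size J).
rewrite size_map sorted_map (nth_map 0); last by rewrite sz; lia.
by apply.
Qed.

End Events.

(** * Processing one stack entry *)

Section Items.
Variables (V : finType) (R : realType) (G : wgraph R V).
Variables (Ts : seq (traj V)) (h : nat).
Notation n := (size Ts).
Notation dq := (dist_oracle G).
Notation stj := (map (trj Ts)).
Notation dyn := (@dyn V R Ts h).

Lemma stj_traj J : (forall T, T \in Ts -> is_traj T) -> all (fun i => i < n) J ->
  forall T, T \in stj J -> is_traj T.
Proof. by move=> Ts_traj /allP aJ T /mapP[i /aJ li ->]; exact: trj_traj. Qed.

Definition has_events (st : hst R) (lo : nat) (J : seq nat) : Prop :=
  exists ev, [/\ perm_eq ev (events Ts J), sorted (tle (tim Ts)) ev &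
                 seg (mm st EV) lo (map Posz ev)].

Definition entry (st : hst R) (sp fo ef : nat) (J : seq nat) (pp : nat) : Prop :=
  exists lo, [/\ [/\ mm st STK sp = Posz lo, mm st STK (sp + 1) = Posz (size J) &
                     mm st STK (sp + 2) = Posz pp],
                 posn Ts n <= pp < fo, lo + size J + size J <= ef,
                 has_events st lo J & all (fun i => i < n) J].

(** Processing an entry writes [EV] only from the free pointer on and [STK] only from its own
    position on, so the entries waiting below it stay valid. *)
Lemma entry_stable st st' sp fo fo' ef ef' J pp :
  (forall x, x < ef -> mm st' EV x = mm st EV x) ->
  (forall x, x < sp + 3 -> mm st' STK x = mm st STK x) -> fo <= fo' -> ef <= ef' ->
  entry st sp fo ef J pp -> entry st' sp fo' ef' J pp.
Proof.
move=> a1 a2 l1 l2 [lo [[b1 b2 b3] c1 c2 [ev [d1 d2 d3]] aJ]].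
exists lo; split=> //; [|lia|lia|].
  by split; rewrite a2 //; lia.
exists ev; split=> //; apply: seg_ext d3 => x.
by rewrite size_map (size_events d1) => lx; apply: a1; lia.
Qed.

Lemma events_sub (ev J : seq nat) (Q : pred nat) st lo : perm_eq ev (events Ts J) ->
  sorted (tle (tim Ts)) ev -> all (fun i => i < n) J ->
  seg (mm st EV) lo (map Posz (seq.filter (fun e => Q (tid Ts e)) ev)) ->
  has_events st lo (seq.filter Q J).
Proof.
move=> pe so aJ g; exists (seq.filter (fun e => Q (tid Ts e)) ev); split=> //.
  exact: filter_events_perm.
by apply: sorted_filter so; exact: tle_trans.
Qed.

Lemma count_starts ev J (Q : pred nat) : perm_eq ev (events Ts J) -> all (fun i => i < n) J ->
  count (fun e => Q (tid Ts e) && (e < n)) ev = size (seq.filter Q J).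
Proof.
move=> pe aJ; rewrite -(perm_size (filter_starts_perm Q pe aJ)) size_filter.
by apply: eq_count => e; rewrite andbC.
Qed.

Lemma rupd_rupd (B : Type) (f : nat -> B) x u v : rupd (rupd f x u) x v = rupd f x v.
Proof. by apply/funext => y; rewrite !rupdE; case: eqP. Qed.

Lemma pushP (st : hst R) x y e sp (Q : nat -> hst R -> Prop) :
  rg st rSP = Posz sp ->
  (forall stk, (forall z, z < sp -> stk z = mm st STK z) -> stk sp = rg st x ->
     stk (sp + 1) = rg st y -> stk (sp + 2) = aval (rg st) e ->
     Q 4 (HSt (rupd (rg st) rSP (Posz (sp + 3))) (rupd (mm st) STK stk) (acc st) (rm st))) ->
  tr dq (push x y e) Q st.
Proof.
move=> HSP HQ; rewrite /push; sst sp; sst (sp + 1); sst (sp + 2); sset.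
rewrite !rupd_rupd /=.
have -> : (rg st rSP + 3)%R = Posz (sp + 3) by lia.
apply: HQ => [z lz| | |]; rewrite /upd; do ?[case: eqP => ?]; first [done|lia].
Qed.

Definition left_of (mu : int) (J : seq nat) := [seq i <- J | (tend (trj Ts i) < mu)%R].
Definition right_of (mu : int) (J : seq nat) := [seq i <- J | (mu < tstart (trj Ts i))%R].

(** The free pointer [fo] moves past the header of the node only when the filter has been built. The
    new entries are therefore stated for every later value [fo']. *)
Lemma split_nodeP (st : hst R) sp fo ef q cb lo ev J mu :
  dyn st sp fo ef q cb -> 0 < size J -> all (fun i => i < n) J ->
  rg st rLO = Posz lo -> rg st rS = Posz (size J) -> lo + size J + size J <= ef ->
  perm_eq ev (events Ts J) -> sorted (tle (tim Ts)) ev -> seg (mm st EV) lo (map Posz ev) ->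
  mu = tim Ts (nth 0 ev (size J)) ->
  tr dq split_node (fun k st' => exists ef',
    [/\ dyn st' (sp + 6) fo ef' q cb /\ ef <= ef',
        [/\ rg st' rLO = Posz lo, rg st' rS = Posz (size J), rg st' rHP = Posz (fo + 4),
            rg st' rMU = mu & rg st' rLF = Posz 0],
        [/\ mm st' MAIN fo = Posz 1, mm st' MAIN (fo + 1) = mu,
            forall x, x < fo -> mm st' MAIN x = mm st MAIN x & rm st' = rm st],
        [/\ forall x, x < ef -> mm st' EV x = mm st EV x,
            forall x, x < sp -> mm st' STK x = mm st STK x,
            (forall fo', fo + 3 < fo' -> entry st' (sp + 3) fo' ef' (left_of mu J) (fo + 2)) &
            (forall fo', fo + 3 < fo' -> entry st' sp fo' ef' (right_of mu J) (fo + 3))]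
        & k <= 48 * size J + 30]) st.
Proof.
move=> D J0 aJ HLO HS leef pe so g emu; set Jl := left_of mu J; set Jr := right_of mu J.
have sz := size_events pe; have aN := events_lt pe aJ.
have Hst := dyn_static D; have [[h1 h2 h3 h4] Hm Hp Ht] := Hst.
have lefo := dyn_le D.
have HSP := dyn_sp D; have HFO := dyn_fo D; have HEF := dyn_ef D; have HQ := dyn_q D; have HCB := dyn_cb D.
have [e ee] : exists e, e = nth 0 ev (size J) by eexists.
have le : e < n + n by rewrite ee; apply: (allP aN); apply: mem_nth; rewrite sz; lia.
have Ee : mm st EV (lo + size J) = Posz e by rewrite ee; apply: seg_nth => //; rewrite sz; lia.
rewrite /split_node; sset; sld (lo + size J); rewrite Ee; sld e; rewrite Ht // {1 2}ee -emu.
sst fo; sst (fo + 1); sset; sset; ss; set st0 := HSt _ _ _ _.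
have S0 : static Ts h st0.
  by split=> // k lk /=; rewrite !upd_neq ?Hm //; lia.
have [X1 X2 X3] : [/\ rg st0 rLO = Posz lo, rg st0 rS = Posz (size J) & rg st0 rO = Posz ef] by [].
have [X4 X5 X6] : [/\ rg st0 rMU = mu, rg st0 rLF = Posz 0 & rg st0 rN = Posz n] by [].
have [X7 X8 X9] : [/\ rg st0 rSP = Posz sp, rg st0 rFO = Posz fo & rg st0 rQF = Posz q] by [].
have [X10 X11] : rg st0 rCB = Posz cb /\ rg st0 rLL = Posz ef by [].
pose Pl e := (tend (trj Ts (tid Ts e)) < mu)%R.
pose Pr e := (mu < tstart (trj Ts (tid Ts e)))%R.
apply: tr_frame.
  apply: (@filter_eventsP _ Ts h _ _ ends_before EV Pl st0 lo (size J) ef ev) => //.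
  by move=> st' e' le' N' MU' _ E' A' B'; rewrite /= MU' B' X4 /Pl; lia.
move=> k1 st1 F1 [g1 O1 cc1 a1 lek1].
have S1 : static Ts h st1 by apply: (static_frame F1 isT isT) S0 => x lx; case: F1 => _ F1 _; rewrite F1.
have M1 : mm st1 MAIN = mm st0 MAIN by case: F1 => _ F1 _; rewrite F1.
carry F1 st0 st1.
have c1 : rg st1 rC = Posz (size Jl).
  by rewrite cc1 (count_starts (fun i => tend (trj Ts i) < mu)%R pe aJ).
sset; sset; ss; set st2 := HSt _ _ _ _.
set ef1 := ef + size (seq.filter Pl ev) in O1.
have S2 : static Ts h st2 by case: S1.
have g2 : seg (mm st2 EV) lo (map Posz ev).
  by apply: seg_ext g => x; rewrite size_map sz => lx; rewrite /st2 /= a1 //; lia.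
have [Y1 Y2 Y3] : [/\ rg st2 rLO = Posz lo, rg st2 rS = Posz (size J) & rg st2 rO = Posz ef1] by [].
have [Y4 Y5 Y6] : [/\ rg st2 rMU = mu, rg st2 rLF = Posz 0 & rg st2 rN = Posz n] by [].
have [Y7 Y8 Y9] : [/\ rg st2 rSP = Posz sp, rg st2 rFO = Posz fo & rg st2 rQF = Posz q] by [].
have [Y10 Y11] : rg st2 rCB = Posz cb /\ rg st2 rLL = Posz ef by [].
have [Y12 Y13] : rg st2 rLS = Posz (size Jl) /\ rg st2 rRL = Posz ef1 by [].
apply: tr_frame.
  apply: (@filter_eventsP _ Ts h _ _ starts_after EV Pr st2 lo (size J) ef1 ev) => //.
    by rewrite /ef1; lia.
  by move=> st' e' le' N' MU' _ E' A' B'; rewrite /= MU' A' Y4 /Pr; lia.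
move=> k3 st3 F3 [g3 O3 cc3 a3 lek3].
have S3 : static Ts h st3 by apply: (static_frame F3 isT isT) S2 => x lx; case: F3 => _ F3 _; rewrite F3.
have M3 : mm st3 MAIN = mm st0 MAIN by case: F3 => _ F3 _; rewrite F3.
have K3 : mm st3 STK = mm st STK by case: F1 F3 => _ F1 _ [_ F3 _]; rewrite F3 // /st2 /= F1.
have T3 : mm st3 CNT = mm st CNT by case: F1 F3 => _ F1 _ [_ F3 _]; rewrite F3 // /st2 /= F1.
have R3 : rm st3 = rm st by case: F1 F3 => _ _ F1 [_ _ F3]; rewrite F3 // /st2 /= F1.
carry F3 st2 st3.
have c3 : rg st3 rC = Posz (size Jr).
  by rewrite cc3 (count_starts (fun i => mu < tstart (trj Ts i))%R pe aJ).
set ef2 := ef1 + size (seq.filter Pr ev) in O3.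
sset; sset; ss; apply: (pushP (sp := sp)) => //= stk1 s1 s2 s3 s4; ss.
apply: (pushP (sp := sp + 3)) => //= stk2 r1 r2 r3 r4; sset.
set st4 := HSt _ _ _ _.
have El : has_events st4 ef Jl.
  apply: (events_sub (Q := fun i => (tend (trj Ts i) < mu)%R) pe so aJ).
  apply: seg_ext g1 => x; rewrite size_map => lx; rewrite /st4 /= a3 //; rewrite /ef1; lia.
have Er : has_events st4 ef1 Jr.
  by apply: (events_sub (Q := fun i => (mu < tstart (trj Ts i))%R) pe so aJ).
have zl : size (seq.filter Pl ev) = size Jl + size Jl.
  by rewrite (size_events (filter_events_perm (fun i => tend (trj Ts i) < mu)%R pe aJ)).
have zr : size (seq.filter Pr ev) = size Jr + size Jr.
  by rewrite (size_events (filter_events_perm (fun i => mu < tstart (trj Ts i))%R pe aJ)).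
have aJl : all (fun i => i < n) Jl by apply/allP => i; rewrite mem_filter => /andP[_ /(allP aJ)].
have aJr : all (fun i => i < n) Jr by apply/allP => i; rewrite mem_filter => /andP[_ /(allP aJ)].
exists ef2; split.
- split; last by rewrite /ef2 /ef1; lia.
  have cz x : cb <= x -> mm st3 CNT x = 0%R by move=> lx; rewrite T3; exact: (dyn_cnt D).
  by split=> //=; first [by case: S3|lia].
- by split=> //=; lia.
- split=> //=; rewrite ?M3 /st0 /=.
  + by rewrite upd_neq ?upd_eq //; lia.
  + by rewrite upd_eq.
  + by move=> x lx; rewrite !upd_neq //; lia.
- split=> /=.
  + by move=> x lx; rewrite a3 ?a1 //; rewrite /ef1; lia.
  + by move=> x lx; rewrite r1 ?s1 ?K3 //; lia.
  + move=> fo' lf; exists ef; split=> //=; [|lia|rewrite /ef2 /ef1; lia].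
    by split; rewrite ?r2 ?r3 ?r4; lia.
  + move=> fo' lf; exists ef1; split=> //=; [|lia|rewrite /ef2; lia].
    by split; rewrite r1 ?s2 ?s3 ?s4; lia.
- by lia.
Qed.

End Items.

(** * Building a subtree *)

Section Iterations.
Variables (R : realType) (dq : int -> int -> R) (b : gexp) (c : hcom).

(* Finitely many iterations of [While b c], possibly with more to come. *)
Inductive iters : hst R -> nat -> hst R -> Prop :=
| iters0 st : iters st 0 st
| itersS st k1 st1 k2 st2 : gval (rg st) b -> hexec dq c st k1 st1 -> iters st1 k2 st2 ->
    iters st (k1 + k2).+1 st2.

Lemma iters1 st k st' : gval (rg st) b -> hexec dq c st k st' -> iters st k.+1 st'.
Proof. by move=> g H; have := itersS g H (iters0 st'); rewrite addn0. Qed.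

Lemma iters_trans st1 k1 st2 k2 st3 :
  iters st1 k1 st2 -> iters st2 k2 st3 -> iters st1 (k1 + k2) st3.
Proof.
elim=> {st1 k1 st2} // st1 k1 st2 k st3' g H _ IH /IH.
rewrite addSn -addnA; exact: itersS.
Qed.

Lemma iters_while st k st' : iters st k st' -> ~~ gval (rg st') b ->
  hexec dq (While b c) st k.+1 st'.
Proof.
elim=> {st k st'} [st g|st k1 st1 k2 st2 g H _ IH g2]; first exact: hx_while_false.
by rewrite -addnS; apply: hx_while_true g H (IH g2).
Qed.

End Iterations.

Section Subtree.
Variables (V : finType) (R : realType) (G : wgraph R V) (minsz : nat).
Variables (Ts : seq (traj V)) (h : nat).
Hypothesis Ts_uniq : uniq Ts.
Hypothesis Ts_traj : forall T, T \in Ts -> is_traj T.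
Hypothesis h_gt0 : 0 < h.
Variable m : nat.
Hypothesis m_gt0 : 0 < m.
Hypothesis le_m : forall i, i < size Ts -> size (trj Ts i) <= m.
Notation n := (size Ts).
Notation dq := (dist_oracle G).
Notation stj := (map (trj Ts)).
Notation dyn := (@dyn V R Ts h).
Notation entry := (@entry V R Ts).
Notation iters := (iters dq (lit 0 [<] rSP) (item_body minsz)).

(* The tree [t] lies at address [a], in the cells [fo, ..., fo' - 1] and
   [q, ..., q' - 1], so that it survives changes of all other cells. *)
Definition stored (st : hst R) (fo fo' q q' : nat) (a : int) (t : tindex R V) : Prop :=
  forall sl : state R,
    (forall x, fo <= x < fo' -> imem sl (Posz x) = mm st MAIN x) ->
    (forall x, q <= x < q' -> rmem sl (Posz x) = rm st x) -> index_at Ts sl a t.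

(** Below [fo] the only cell of [MAIN] that may change is [pp], the pointer held by the parent. This
    makes separately built subtrees compatible. *)
Record built (st st' : hst R) (sp fo ef q fo' ef' q' cb' : nat) (J : seq nat) (pp : nat)
    (t : tindex R V) : Prop := Built {
  built_dyn : dyn st' sp fo' ef' q' cb';
  built_le : [/\ fo <= fo', ef <= ef' & q <= q'];
  built_stk : forall x, x < sp -> mm st' STK x = mm st STK x;
  built_ev : forall x, x < ef -> mm st' EV x = mm st EV x;
  built_rm : forall x, x < q -> rm st' x = rm st x;
  built_main : forall x, x < fo -> x != pp -> mm st' MAIN x = mm st MAIN x;
  built_index : is_tindex G minsz h (stj J) t;
  built_stored : stored st' fo fo' q q' (mm st' MAIN pp) t }.

Lemma block_at_seg (A : Type) (f : int -> A) (g : nat -> A) a s :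
  seg g a s -> (forall x, a <= x < a + size s -> f (Posz x) = g x) -> block_at f (Posz a) s.
Proof.
move=> H E x0 i li; rewrite -PoszD E; last by rewrite leq_addr ltn_add2l.
exact: H.
Qed.

(** The 8 pays for an entry with an empty set. The constant 400 is twice the one of the filter; the
    surplus covers the split and the constants of the two children. *)
Definition item_time (s : nat) : nat := 8 + 400 * (s * (h * m)) * (trunc_log 2 s).+1.

Lemma item_bodyP (st : hst R) sp fo ef q cb J pp (Q : nat -> hst R -> Prop) :
  dyn st (sp + 3) fo ef q cb -> entry st sp fo ef J pp ->
  (forall st1 lo ev,
    dyn st1 sp fo ef q cb -> rg st1 rLO = Posz lo -> rg st1 rS = Posz (size J) ->
    rg st1 rPP = Posz pp -> mm st1 = mm st -> rm st1 = rm st ->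
    perm_eq ev (events Ts J) -> sorted (tle (tim Ts)) ev ->
    seg (mm st1 EV) lo (map Posz ev) -> lo + size J + size J <= ef ->
    tr dq (If (rS [<=] lit 0)
      (St MAIN rPP (lit 0))
      (St MAIN rPP rFO;;
       If (rS [<=] lit minsz) make_leaf split_node;;
       build_filter)) (fun k => Q (4 + k)) st1) ->
  tr dq (item_body minsz) Q st.
Proof.
move=> D [lo [[b1 b2 b3] c1 c2 [ev [d1 d2 d3]] aJ]] H.
have HSP := dyn_sp D.
rewrite /item_body; sset; sld sp; sld (sp + 1); sld (sp + 2); rewrite b1 b2 b3.
apply: (H _ lo ev) => //=.
case: D => s1 s2 s3 s4 s5 s6 s7 s8; split=> //=; lia.
Qed.

Lemma item_empty (st : hst R) sp fo ef q cb pp :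
  dyn st (sp + 3) fo ef q cb -> entry st sp fo ef [::] pp ->
  exists k st' t fo' ef' q' cb', [/\ iters st k st',
    built st st' sp fo ef q fo' ef' q' cb' [::] pp t & k <= item_time 0].
Proof.
move=> D E.
have lpp : posn Ts n <= pp < fo by case: E => lo [].
have g : gval (rg st) (lit 0 [<] rSP) by have := dyn_sp D; rewrite /=; lia.
suff [k [st' [H [le_k B]]]] : tr dq (item_body minsz) (fun k st' => k <= 6 /\
    built st st' sp fo ef q fo ef q cb [::] pp TNone) st.
  exists k.+1, st', TNone, fo, ef, q, cb; split=> //.
    exact: iters1 g H.
  by rewrite /item_time; lia.
apply: item_bodyP D E _ => st1 lo ev D1 L1 S1 P1 M1 R1 _ _ _ _.
sif => gd; last by rewrite S1 /= in gd.
sst pp; split=> //; split=> //=.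
- case: D1 => s1 s2 s3 s4 s5 s6 s7 s8; split=> //=.
  case: s1 => u1 u2 u3 u4; split=> //= k lk.
  by rewrite upd_neq ?u2 //; lia.
- by rewrite M1.
- by rewrite M1.
- by rewrite R1.
- by move=> x lx nx; rewrite upd_neq // M1.
- exact: is_TNone.
- by move=> sl _ _; rewrite upd_eq.
Qed.

Lemma item_leaf (st : hst R) sp fo ef q cb J pp :
  dyn st (sp + 3) fo ef q cb -> entry st sp fo ef J pp -> 0 < size J <= minsz ->
  exists k st' t fo' ef' q' cb', [/\ iters st k st',
    built st st' sp fo ef q fo' ef' q' cb' J pp t & k <= item_time (size J)].
Proof.
move=> D E /andP[J0 Jm].
have lpp : posn Ts n <= pp < fo by case: E => lo [].
have aJ : all (fun i => i < n) J by case: E => lo [].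
have g : gval (rg st) (lit 0 [<] rSP) by have := dyn_sp D; rewrite /=; lia.
suff [k [st' [H [le_k [F [S [fo' [q' [cb' B]]]]]]]]] : tr dq (item_body minsz)
    (fun k st' => k <= 200 * (size J * (h * m)) + 12 /\ exists F S fo' q' cb',
      built st st' sp fo ef q fo' ef q' cb' J pp (TLeaf S F)) st.
  exists k.+1, st', (TLeaf S F), fo', ef, q', cb'; split=> //.
    exact: iters1 g H.
  have : 0 < size J * (h * m) by rewrite !muln_gt0 J0 h_gt0.
  rewrite /item_time; nia.
apply: item_bodyP D E _ => st1 lo ev D1 L1 S1 P1 M1 R1 pe so gv lo_ef.
have FO1 := dyn_fo D1; have lefo := dyn_le D1.
sif => gd; first by rewrite S1 /= in gd; lia.
sst pp; ss; apply: tr_if => /= gd2; last by lia.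
rewrite /make_leaf; sset; sst fo; sset.
set st2 := HSt _ _ _ _.
have D2 : dyn st2 sp fo ef q cb.
  case: D1 => s1 s2 s3 s4 s5 s6 s7 s8; split=> //=.
  case: s1 => u1 u2 u3 u4; split=> //= k lk.
  by rewrite !upd_neq ?u2 //; lia.
have sz := size_events pe.
pose Q : pred nat := predT.
have pe2 := filter_starts_perm Q pe aJ; rewrite filter_predT in pe2.
apply: tr_frame.
  apply: (@build_filterP _ _ G Ts h Ts_uniq Ts_traj h_gt0 m m_gt0 le_m st2 sp fo ef q cb lo
    (size J) (fo + 1) ev (fun e => (e < n) && Q (tid Ts e)) D2) => //=.
  - by lia.
  - by lia.
  - exact: events_lt pe aJ.
  - move=> st' e le N' MU' LF' E' A' B'; by rewrite LF' N' E' -[Q _]/true !andbT; lia.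
  - by move=> e /andP[].
  - by rewrite (perm_size pe2) J0 /=.
move=> k3 st3 F3 [F [fo' [q' [cb' [PF D3 [efo gfo] [eq' gq] [a1 a2 lek]]]]]].
split; first by lia.
set S := map _ _ in PF efo gfo.
exists F, S, fo', q', cb'.
have m1 : mm st3 MAIN fo = Posz 0 by rewrite a1 /st2 /= ?upd_eq //; lia.
have m2 : mm st3 MAIN pp = Posz fo.
  by rewrite a1 /st2 /=; [rewrite upd_neq ?upd_eq //; lia|lia].
split=> //.
- by rewrite efo eq'; split=> //; lia.
- by move=> x lx; case: F3 => _ F3 _; rewrite F3 // /st2 /= M1.
- by move=> x lx; case: F3 => _ F3 _; rewrite F3 // /st2 /= M1.
- by move=> x lx; rewrite a2 // /st2 /= R1.
- by move=> x lx nx; rewrite a1 /st2 /= ?upd_neq ?M1 //; lia.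
- apply: is_TLeaf => //; first by rewrite size_map J0.
  by rewrite perm_map.
- move=> sl i1 i2; rewrite m2; split; first by case; lia.
  exists (Posz q); split; last first.
    by apply: block_at_seg gq _ => x lx; apply: i2; rewrite eq'.
  apply: (@block_at_seg _ _ (mm st3 MAIN)).
    rewrite -[leaf_words _ _ _ _]/(Posz 0 :: filter_words Ts S F q) seg_cons -addn1.
    by split.
  move=> x lx; apply: i1; move: lx.
  by rewrite -[leaf_words _ _ _ _]/(Posz 0 :: filter_words Ts S F q) efo /=; lia.
Qed.

(** A child has at most half the size, so its logarithm is smaller by at least one, and
    [l + r <= s]. Both children together cost at most the summand with [trunc_log 2 s], and the
    remaining [400 * (s * (h * m))] pays for the node. *)
Lemma item_time_split (l r s : nat) : 2 * l <= s -> 2 * r <= s -> 0 < s ->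
  200 * (s * (h * m)) + 48 * s + 45 + item_time l + item_time r <= item_time s.
Proof.
move=> ls rs s0; rewrite /item_time.
have log x : 2 * x <= s -> x * (trunc_log 2 x).+1 <= x * trunc_log 2 s.
  case: x => // x xs; rewrite leq_pmul2l //; apply: trunc_log_max => //.
  by rewrite expnS; apply: leq_trans xs; rewrite leq_pmul2l // trunc_logP.
move: (log _ ls) (log _ rs); set tl := (trunc_log 2 l).+1; set tr := (trunc_log 2 r).+1.
set ts := trunc_log 2 s => l1 l2.
have hm : 0 < h * m by rewrite muln_gt0 h_gt0.
have b1 : 400 * (l * (h * m)) * tl <= 400 * (h * m) * (l * ts).
  by rewrite (_ : _ * tl = 400 * (h * m) * (l * tl)); [rewrite leq_mul2l l1 orbT|lia].
have b2 : 400 * (r * (h * m)) * tr <= 400 * (h * m) * (r * ts).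
  by rewrite (_ : _ * tr = 400 * (h * m) * (r * tr)); [rewrite leq_mul2l l2 orbT|lia].
have b3 : 400 * (h * m) * (l * ts) + 400 * (h * m) * (r * ts) <= 400 * (h * m) * (s * ts).
  by rewrite -mulnDr leq_mul2l -mulnDl leq_mul2r; lia.
have b4 : s <= s * (h * m) by rewrite leq_pmulr.
have -> : 400 * (s * (h * m)) * ts.+1 = 400 * (s * (h * m)) + 400 * (h * m) * (s * ts) by rewrite mulnS; lia.
lia.
Qed.

Lemma stj_filter (Q : pred (traj V)) J : stj [seq i <- J | Q (trj Ts i)] = [seq T <- stj J | Q T].
Proof. by rewrite filter_map. Qed.

(** Strong induction on the size. One iteration stores the node and replaces its entry by two. The
    left one, on top, is consumed by the induction hypothesis at [sp + 3]; the right one survives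
    this and is then consumed at [sp]. *)
Lemma itemP J (st : hst R) sp fo ef q cb pp :
  dyn st (sp + 3) fo ef q cb -> entry st sp fo ef J pp ->
  exists k st' t fo' ef' q' cb', [/\ iters st k st',
    built st st' sp fo ef q fo' ef' q' cb' J pp t & k <= item_time (size J)].
Proof.
have [N] := ubnP (size J); elim: N J st sp fo ef q cb pp => // N IH J st sp fo ef q cb pp ltN D E.
have [/size0nil J0|J0] := posnP (size J); first by rewrite J0 in E *; exact: item_empty D E.
case: (leqP (size J) minsz) => Jm; first by apply: item_leaf D E _; rewrite J0.
have lpp : posn Ts n <= pp < fo by case: E => lo [].
have aJ : all (fun i => i < n) J by case: E => lo [].
have g : gval (rg st) (lit 0 [<] rSP) by have := dyn_sp D; rewrite /=; lia.
have : tr dq (item_body minsz) (fun k st' => exists mu F S fo' ef' q' cb',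
    [/\ [/\ is_median mu (endpoints (stj J)),
            perm_eq S [seq T <- stj J | (tstart T <= mu)%R && (mu <= tend T)%R] &
            is_pivfilter G h S F],
        dyn st' (sp + 6) fo' ef' q' cb' /\ ef <= ef',
        [/\ entry st' (sp + 3) fo' ef' (left_of Ts mu J) (fo + 2),
            entry st' sp fo' ef' (right_of Ts mu J) (fo + 3),
            forall x, x < sp -> mm st' STK x = mm st STK x &
            forall x, x < ef -> mm st' EV x = mm st EV x],
        [/\ mm st' MAIN fo = Posz 1, mm st' MAIN (fo + 1) = mu,
            fo' = fo + 4 + size (filter_words Ts S F q),
            seg (mm st' MAIN) (fo + 4) (filter_words Ts S F q) &
            mm st' MAIN pp = Posz fo /\
            forall x, x < fo -> x != pp -> mm st' MAIN x = mm st MAIN x]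
        & [/\ q' = q + size (flatten (pdists F)), seg (rm st') q (flatten (pdists F)),
              forall x, x < q -> rm st' x = rm st x &
              k <= 200 * (size J * (h * m)) + 48 * size J + 44]]) st.
  apply: item_bodyP D E _ => st1 lo ev D1 L1 S1 P1 M1 R1 pe so gv lo_ef.
  have FO1 := dyn_fo D1; have lefo := dyn_le D1.
  sif => gd; first by rewrite S1 /= in gd; lia.
  sst pp; ss; apply: tr_if => /= gd2; first by lia.
  set st2 := HSt _ _ _ _.
  have D2 : dyn st2 sp fo ef q cb.
    case: D1 => s1 s2 s3 s4 s5 s6 s7 s8; split=> //=.
    case: s1 => u1 u2 u3 u4; split=> //= k lk.
    by rewrite !upd_neq ?u2 //; lia.
  have [mu emu] : exists mu, mu = tim Ts (nth 0 ev (size J)) by eexists.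
  have med : is_median mu (endpoints (stj J)) by rewrite emu; exact: events_median.
  apply: tr_frame.
    exact: (split_nodeP G D2 J0 aJ L1 S1 lo_ef pe so gv emu).
  move=> k3 st3 F3 [ef' [[D3 le3] [L3 S3 H3 MU3 LF3] [m1 m2 a1 R3] [a2 a3 el er] lek3]].
  have sz := size_events pe.
  pose Q i := (tstart (trj Ts i) <= mu)%R && (mu <= tend (trj Ts i))%R.
  have pe2 := filter_starts_perm Q pe aJ.
  have gv3 : seg (mm st3 EV) lo (map Posz ev).
    by apply: seg_ext gv => x; rewrite size_map sz => lx; rewrite a2 //; lia.
  have stay0 := stay_nonempty (stj_traj Ts_traj aJ) med.
  rewrite -(stj_filter (fun T => (tstart T <= mu)%R && (mu <= tend T)%R)) size_map in stay0.
  apply: tr_frame.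
    apply: (@build_filterP _ _ G Ts h Ts_uniq Ts_traj h_gt0 m m_gt0 le_m st3 (sp + 6) fo ef' q cb lo
      (size J) (fo + 4) ev (fun e => (e < n) && Q (tid Ts e)) D3) => //=.
    - by lia.
    - exact: events_lt pe aJ.
    - move=> st' e le N' MU' LF' E' A' B'; rewrite LF' N' E' MU' A' B' LF3 MU3 /= negbK.
      by congr (_ && _); lia.
    - by move=> e /andP[].
    - by rewrite (perm_size pe2) stay0 size_filter count_size.
  move=> k4 st4 F4 [F [fo' [q' [cb' [PF D4 [efo gfo] [eq' gq] [b1 b2 lek4]]]]]].
  set S := map _ _ in PF efo gfo.
  have [E4 K4] : mm st4 EV = mm st3 EV /\ mm st4 STK = mm st3 STK.
    by case: F4 => _ F4 _; rewrite !F4.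
  have efo' : fo + 3 < fo' by rewrite efo; lia.
  exists mu, F, S, fo', ef', q', cb'; split=> //; split=> //.
  - rewrite -(stj_filter (fun T => (tstart T <= mu)%R && (mu <= tend T)%R)).
    by rewrite perm_map.
  - by apply: entry_stable (el _ efo') => // x lx; rewrite ?E4 ?K4.
  - by apply: entry_stable (er _ efo') => // x lx; rewrite ?E4 ?K4.
  - by move=> x lx; rewrite K4 a3 // /st2 /= M1.
  - by move=> x lx; rewrite E4 a2 // /st2 /= M1.
  - by rewrite b1 ?m1 //; lia.
  - by rewrite b1 ?m2 //; lia.
  - split=> [|x lx nx]; rewrite b1 ?a1 /st2 /= ?upd_eq ?upd_neq ?M1 //; lia.
  - by move=> x lx; rewrite b2 // R3 /st2 /= R1.
  - by lia.
move=> [k1 [st1 [H1 [mu [F [S [fo1 [ef1 [q1 [cb1 [[med pS PF] [D1 le1] [el er k_stk k_ev]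
  [m1 m2 efo1 gfo [mpp a_main]] [eq1 gq a_rm lek1]]]]]]]]]]]].
have SJ := stj_traj Ts_traj aJ.
have lh := left_half SJ med; have rh := right_half SJ med.
rewrite -(stj_filter (fun T => tend T < mu)%R) !size_map -/(left_of Ts mu J) in lh.
rewrite -(stj_filter (fun T => mu < tstart T)%R) !size_map -/(right_of Ts mu J) in rh.
have [||k2 [st2 [tl [fo2 [ef2 [q2 [cb2 [I2 B2 lek2]]]]]]]] :=
  IH (left_of Ts mu J) st1 (sp + 3) fo1 ef1 q1 cb1 (fo + 2) _ _ el.
- by lia.
- by rewrite -addnA.
have [lfo2 lef2 lq2] := built_le B2.
have er2 : entry st2 sp fo2 ef2 (right_of Ts mu J) (fo + 3).
  by apply: entry_stable er => //; [exact: (built_ev B2)|exact: (built_stk B2)].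
have [|k3 [st3 [tr [fo3 [ef3 [q3 [cb3 [I3 B3 lek3]]]]]]]] :=
  IH (right_of Ts mu J) st2 sp fo2 ef2 q2 cb2 (fo + 3) _ (built_dyn B2) er2.
- by lia.
have [lfo3 lef3 lq3] := built_le B3.
exists (k1.+1 + (k2 + k3)), st3, (TNode mu S F tl tr), fo3, ef3, q3, cb3; split.
- by apply: iters_trans (iters1 g H1) _; apply: iters_trans I2 I3.
(* Below [fo1] the two subtrees change only the child pointers of this node. *)
- have M3 x : x < fo1 -> x != fo + 2 -> x != fo + 3 -> mm st3 MAIN x = mm st1 MAIN x.
    by move=> lx n2 n3; rewrite (built_main B3) ?(built_main B2) //; lia.
  have Ml x : x < fo2 -> x != fo + 3 -> mm st3 MAIN x = mm st2 MAIN x.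
    by move=> lx n3; rewrite (built_main B3).
  split.
  + exact: (built_dyn B3).
  + by split; lia.
  + by move=> x lx; rewrite (built_stk B3) ?(built_stk B2) ?k_stk //; lia.
  + by move=> x lx; rewrite (built_ev B3) ?(built_ev B2) ?k_ev //; lia.
  + by move=> x lx; rewrite (built_rm B3) ?(built_rm B2) ?a_rm //; lia.
  + by move=> x lx nx; rewrite M3 ?a_main //; lia.
  + apply: is_TNode => //; first by rewrite size_map.
      by rewrite -(stj_filter (fun T => tend T < mu)%R); exact: (built_index B2).
    by rewrite -(stj_filter (fun T => mu < tstart T)%R); exact: (built_index B3).
  + move=> sl i1 i2.
    have -> : mm st3 MAIN pp = Posz fo by rewrite M3 ?mpp //; lia.
    (* The address is not the null pointer, since [fo] lies behind the three header words of the
       input. *)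
    split; first by case; have := dyn_le D; have := posn0 Ts; rewrite /posn; lia.
    exists (Posz q), (mm st2 MAIN (fo + 2)), (mm st3 MAIN (fo + 3)).
    set w := node_words _ _ _ _ _ _ _.
    have ew : w = [:: Posz 1; mu; mm st2 MAIN (fo + 2); mm st3 MAIN (fo + 3)]
       ++ filter_words Ts S F q by [].
    split.
    * apply: (@block_at_seg _ _ (mm st3 MAIN)); last first.
        move=> x lx; apply: i1; move: lx.
        have -> : size w = 4 + size (filter_words Ts S F q) by rewrite ew size_cat.
        by lia.
      rewrite ew seg_cat; split; last first.
        rewrite [size _]/=; apply: seg_ext gfo => x lx; rewrite M3 //; lia.
      rewrite !seg_cons -[fo.+3]addn3 -[fo.+2]addn2 -[fo.+1]addn1; split; first by rewrite M3 //; lia.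
      split; first by rewrite M3 //; lia.
      by split; first by rewrite Ml //; lia.
    * apply: block_at_seg gq _ => x lx; rewrite i2; last by lia.
      by rewrite (built_rm B3) ?(built_rm B2) //; lia.
    * apply: (built_stored B2) => x lx.
        by rewrite i1 ?Ml //; lia.
      by rewrite i2 ?(built_rm B3) //; lia.
    * apply: (built_stored B3) => x lx.
        by rewrite i1 //; lia.
      by rewrite i2 //; lia.
- have := item_time_split lh rh J0; lia.
Qed.

End Subtree.

(** * The whole program *)

Section Program.
Variables (V : finType) (R : realType) (G : wgraph R V) (minsz : nat).
Variables (Ts : seq (traj V)) (h : nat).
Hypothesis Ts_uniq : uniq Ts.
Hypothesis Ts_traj : forall T, T \in Ts -> is_traj T.
Hypothesis h_gt0 : 0 < h.
Variable m : nat.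
Hypothesis m_gt0 : 0 < m.
Hypothesis le_m : forall i, i < size Ts -> size (trj Ts i) <= m.
Notation n := (size Ts).
Notation dq := (dist_oracle G).

Lemma events_iota : events Ts (iota 0 n) = iota 0 (n + n).
Proof. by rewrite /events iotaD add0n -iotaDl addn0. Qed.

Lemma programP (st : hst R) : (forall k, mm st MAIN k = inp Ts h k) ->
  (forall k, mm st CNT k = 0%R) ->
  tr dq (program minsz) (fun k st' => exists t, [/\ is_tindex G minsz h Ts t,
    forall sl, sim sl st' -> index_at Ts sl (rg st' 0) t &
    k <= 20 * n + (26 * (n + n) + 11) * (trunc_log 2 (n + n)).+1 + item_time h m n + 40]) st.
Proof.
move=> Hin Hcnt; rewrite /program; ss.
apply: tr_frame; first by apply: (parse_inputP Ts_traj dq Hin).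
move=> k1 st1 F1 [S1 g1 M1 P1 lek1]; ss.
have [[h1 h2 h3 h4] Hm Hp Ht] := S1.
apply: tr_frame; first by apply: (sort_eventsP (tim := tim Ts) (N := n + n) dq Ht h3).
move=> k2 st2 F2 [ev [ba [pe so g2 [B2 E2] lek2]]].
have S2 : static Ts h st2.
  by apply: (static_frame F2 isT isT) S1 => x lx; case: F2 => _ F2 _; rewrite F2.
carry F2 st1 st2.
do 5!sset; ss; apply: (pushP G (sp := 0)) => //= stk _ s1 s2 s3; ss.
set st3 := HSt _ _ _ _.
have D3 : dyn Ts h st3 (0 + 3) (posn Ts n + 1) (ba + (n + n)) 0 0.
  have cz x : 0 <= x -> mm st2 CNT x = 0%R.
    by move=> _; case: F1 F2 => _ F1 _ [_ F2 _]; rewrite F2 // F1.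
  by split=> //=; first [by case: S2|lia].
have E3 : entry Ts st3 0 (posn Ts n + 1) (ba + (n + n)) (iota 0 n) (posn Ts n).
  exists ba; rewrite size_iota; split=> //=; [|lia|lia| |].
  - by rewrite add0n in s2 s3; split=> //; rewrite ?s1 ?s2 ?s3.
  - by exists ev; split=> //; rewrite events_iota.
  - by apply/allP => i; rewrite mem_iota.
have [k4 [st4 [t [fo' [ef' [q' [cb' [I4 B4 lek4]]]]]]]] :=
  itemP G minsz Ts_uniq Ts_traj h_gt0 m_gt0 le_m D3 E3.
have g4 : ~~ gval (rg st4) (lit 0 [<] rSP).
  by have := dyn_sp (built_dyn B4); rewrite /=; lia.
have H4 := iters_while I4 g4.
exists k4.+1, st4; split=> //.
have W4 : rg st4 rW = Posz (posn Ts n) by have [F4 _ _] := hexec_frame H4; rewrite F4.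
sld (posn Ts n); exists t; split.
(* The entry of the root lists all positions, and reading [Ts] at all positions gives back [Ts]. *)
- have := built_index B4; rewrite -/(mkseq _ _).
  by rewrite [mkseq _ _](mkseq_nth [::] Ts).
- move=> sl [r1 r2 r3 r4]; apply: (built_stored B4) => x lx.
  + by rewrite (r2 0).
  + by rewrite r4.
- by rewrite size_iota in lek4; lia.
Qed.

End Program.

(** * The memory bound, for every tree that is an index of [Ts] *)

Section Space.
Variables (V : finType) (R : realType) (G : wgraph R V) (minsz h : nat) (Ts : seq (traj V)).
Hypothesis h_gt0 : 0 < h.

(** A filter forces its set to be nonempty, because [t.1] is the start of one of its members. The
    overhead of a node can therefore always be charged to its set. *)
Lemma pivfilter_sizes S (F : pivfilter R V) : is_pivfilter G h S F ->
  [/\ 0 < size S, size (ptrajs F) <= h & size (flatten (pdists F)) = size S * size (ptrajs F)].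
Proof.
move=> [ps [t [[_ sz _] [t1 _] _ -> ->]]]; rewrite size_map; split.
- by case: S t1.
- by rewrite sz geq_minl.
- by elim: S {t1} => //= T S IH; rewrite size_cat IH !size_map mulSn.
Qed.

Lemma size_enc_pivots S (F : pivfilter R V) : is_pivfilter G h S F ->
  size (flatten (map (@enc_traj V) (ptrajs F))) = 4 * size (ptrajs F).
Proof.
move=> [ps [t [_ _ _ -> _]]]; rewrite size_map -map_comp.
exact: (size_pivot_words t ps).
Qed.

(** 13 = 7 + 1 + 4 + 1, for the header, the positions, the encoded pivots and the table. Each part
    is at most its coefficient times [a * h], as [a] and [h] are positive. *)
Lemma node_cells_le (a p l r cl cr : nat) : 0 < a -> p <= h ->
  cl <= 13 * (l * h) -> cr <= 13 * (r * h) ->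
  7 + (a + 4 * p) + a * p + cl + cr <= 13 * ((l + r + a) * h).
Proof.
move=> a0 ph lel ler; have := leq_mul (leqnn a) ph.
have : a <= a * h by rewrite leq_pmulr.
have : h <= a * h by rewrite leq_pmull.
rewrite !mulnDl; lia.
Qed.

Lemma leaf_cells_le (a p : nat) : 0 < a -> p <= h -> 4 + (a + 4 * p) + a * p <= 13 * (a * h).
Proof. by move=> a0 ph; have := node_cells_le (l := 0) (r := 0) a0 ph (leqnn _) (leqnn _); lia. Qed.

Lemma index_cells_le Tx (t : tindex R V) : is_tindex G minsz h Tx t ->
  (forall T, T \in Tx -> is_traj T) -> index_cells Ts t <= 13 * (size Tx * h).
Proof.
elim=> {Tx t} [//|Tx S F _ pS PF _|Tx mu S F l r _ med pS PF _ IHl _ IHr Tx_traj].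
  have [S0 ph sd] := pivfilter_sizes PF; have se := size_enc_pivots PF.
  rewrite [index_cells _ _]/= size_cat se size_map sd -(perm_size pS).
  exact: leaf_cells_le.
have [S0 ph sd] := pivfilter_sizes PF; have se := size_enc_pivots PF.
have sub (Q : pred (traj V)) T : T \in [seq T <- Tx | Q T] -> is_traj T.
  by rewrite mem_filter => /andP[_ /Tx_traj].
rewrite [index_cells _ _]/= size_cat se size_map sd -(split_size mu Tx_traj) -(perm_size pS).
exact: node_cells_le S0 ph (IHl (sub _)) (IHr (sub _)).
Qed.

End Space.

(** * From integer logarithms to [ln] *)

Lemma trunc_log_le_ln (R : realType) (n : nat) : 0 < n ->
  ((trunc_log 2 n)%:R * ln 2 <= ln n%:R :> R)%R.
Proof.
move=> n0; rewrite mulrC mulr_natr -lnXn ?ltr0n // ler_ln ?posrE ?exprn_gt0 ?ltr0n //.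
by rewrite -natrX ler_nat trunc_logP.
Qed.

(** For [n > 1] the logarithm is at least 1 and absorbs all lower-order terms. At [n = 1] the
    right-hand side would be 0. *)
Lemma program_time (n h m : nat) : 1 < n -> 0 < h -> 0 < m ->
  20 * n + (26 * (n + n) + 11) * (trunc_log 2 (n + n)).+1 + item_time h m n + 40
  <= 1200 * (trunc_log 2 n * n * (h * m)).
Proof.
move=> n1 h0 m0; rewrite addnn trunc_log2_double ?(ltnW n1) // /item_time.
have L1 : 0 < trunc_log 2 n by rewrite trunc_log_gt0.
have hm : 0 < h * m by rewrite muln_gt0 h0.
move: (trunc_log 2 n) L1 => L L1.
set X := n * (h * m); rewrite -mulnA -/X.
have nX : n <= X by rewrite leq_pmulr.
have b1 : X <= L * X by rewrite leq_pmull.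
have b2 : L * n <= L * X by rewrite leq_mul2l nX orbT.
(* Here [11 <= 6 * n], because [n] is at least 2. *)
have b3 : (26 * n.*2 + 11) * L.+2 <= 58 * n * L.+2 by rewrite leq_mul2r; lia.
have b4 : 58 * n * L.+2 = 58 * (L * n) + 116 * n by lia.
have b5 : 400 * X * L.+1 = 400 * (L * X) + 400 * X by lia.
lia.
Qed.

Unset Implicit Arguments.
Local Open Scope ring_scope.

Theorem theorem3 (R : realType) (minsz : nat) (minsz_gt0 : (0 < minsz)%N) :
  exists (prog : com) (C1 C2 : R),
  forall (V : finType) (G : wgraph R V) (Ts : seq (traj V)) (h : nat),
    connected_graph G ->
    uniq Ts -> (forall T, T \in Ts -> is_traj T) ->
    (0 < h)%N ->
    (exists (time : nat) (st : state R) (t : tindex R V),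
       [/\ exec (dist_oracle G) prog (init_state R Ts h) time st,
           is_tindex G minsz h Ts t,
           index_at Ts st (ireg st 0) t &
           (1 < size Ts)%N ->
           time%:R <= C1 * (ln (size Ts)%:R * (size Ts)%:R
                            * (h%:R * (max_len Ts)%:R))])
    /\
    (forall t : tindex R V, is_tindex G minsz h Ts t ->
       (index_cells Ts t)%:R <= C2 * ((size Ts)%:R * h%:R)).
Proof.
pose P := program minsz.
exists (hcom_com P), ((slowdown P * 1200)%:R / ln 2), 13%:R => V G Ts h _ Ts_uniq Ts_traj h0; split.
  (* The maximum with 1 keeps [m] positive when [Ts] is empty. *)
  pose m := maxn 1 (max_len Ts).
  have le_max i : (i < size Ts)%N -> (size (trj Ts i) <= max_len Ts)%N.
    by move=> li; apply: (leq_bigmax_seq (F := fun T => size T)); rewrite ?mem_nth.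
  have le_m i : (i < size Ts)%N -> (size (trj Ts i) <= m)%N.
    by move=> li; rewrite leq_max le_max ?orbT.
  have m0 : (0 < m)%N by rewrite leq_max.
  pose hs0 := HSt (fun=> 0) (fun s i => if s is 0%N then inp Ts h i else 0) (0 : R) (fun=> 0).
  (* The input fills the nonnegative half of the memory. All other arrays lie on the negative half,
     where the initial memory is 0. *)
  have sim0 : sim (init_state R Ts h) hs0 by split=> // -[|s] i.
  have [k [hs [H [t [It At lek]]]]] :=
    programP G minsz Ts_uniq Ts_traj h0 m0 le_m (st := hs0) (fun=> erefl) (fun=> erefl).
  have [time [st [E le_time S]]] := hexec_com H (isT : hcom_wf P) sim0.
  exists time, st, t; split=> //; first by have [-> _ _ _] := S; exact: At.
  move=> n1.
  (* A trajectory has at least one pair, so the maximum with 1 changes nothing once [Ts] is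
     nonempty. *)
  have Em : m = max_len Ts.
    apply/maxn_idPr; have li : (0 < size Ts)%N by exact: ltnW.
    exact: leq_trans (trj_size_gt0 Ts_traj li) (le_max _ li).
  have le2 : (time <= slowdown P * 1200 * (trunc_log 2 (size Ts) * size Ts * (h * m)))%N.
    apply: leq_trans le_time _; rewrite -mulnA leq_mul2l; apply/orP; right.
    exact: leq_trans lek (program_time n1 h0 m0).
  have ln2 : 0 < ln 2 :> R by rewrite ln_gt0 // ltr1n.
  apply: (@le_trans _ _ (slowdown P * 1200 * (trunc_log 2 (size Ts) * size Ts * (h * m)))%:R).
    by rewrite ler_nat.
  move: (slowdown P * 1200)%N => K.
  rewrite -Em [leLHS]natrM -[leRHS]mulrA; apply: ler_wpM2l => //.
  rewrite !natrM !mulrA; do 3!apply: ler_wpM2r => //.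
  rewrite mulrC ler_pdivlMr //.
  by apply: trunc_log_le_ln; exact: ltnW.
move=> t It; rewrite -!natrM ler_nat; exact: (index_cells_le Ts h0 It Ts_traj).
Qed.
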